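(* Let $d\ge1$ be fixed, let $\alpha,\beta\in(0,2)$, let $Z=(Z_t)$ and $Y=(Y_t)$ be independent rotationally symmetric stable processes in $\mathbb{R}^d$ with parameters $\alpha$ and $\beta$ respectively, let $b\in UC^2_b(\mathbb{R}^d)$ be real-valued, let $X_t(x)$ be the solution of $$\mathrm{d}X_t=b(X_{t-})\,\mathrm{d}Y_t+\mathrm{d}Z_t,\qquad X_0=x\in\mathbb{R}^d,$$ and let $P_tf(x)=\mathbb{E}\,f(X_t(x))$. If $\beta\in(0,\alpha/2)$, then there exists $t_0\in(0,1)$, depending on $\alpha$, $\beta$ and $\|b\|_\infty$, such that for any $f\in UC_b(\mathbb{R}^d)$, $$\left\|(-\Delta)^{\beta/2}P_tf\right\|_\infty\le C_1t^{-1/2}\|f\|_\infty,\qquad 0<t\le t_0,$$ $$\left\|(-\Delta)^{\beta/2}P_tf\right\|_\infty\le C_2\|f\|_\infty,\qquad t>t_0,$$ where the constants $C_1,C_2$ depend on $\alpha$, $\beta$ and $t_0$.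
   Context: $UC_b(\mathbb{R}^d)$ is the space of bounded uniformly continuous real functions on $\mathbb{R}^d$, with norm $\|f\|_\infty=\sup_x|f(x)|$; $UC^2_b(\mathbb{R}^d)$ is the space of functions which together with their derivatives up to order $2$ are bounded and uniformly continuous. The stochastic differential equation has a unique weak solution, and $(P_t)$ is a $C_0$-semigroup on $UC_b(\mathbb{R}^d)$. Its generator $\mathcal{L}$ has a domain containing $UC^2_b(\mathbb{R}^d)$, and for $f\in UC_b^2(\mathbb{R}^d)$, $$\mathcal{L}f(x)=-(-\Delta)^{\alpha/2}f(x)-|b(x)|^\beta(-\Delta)^{\beta/2}f(x),$$ and the backward Kolmogorov equation $\partial_tP_tf=\mathcal{L}P_tf$ holds. The processes $Z$ and $Y$ are normalized so that their generators are $-(-\Delta)^{\alpha/2}$ and $-(-\Delta)^{\beta/2}$. For $\gamma\in(0,2)$ the fractional Laplacian is, with the multiplicative normalizing constant taken equal to $1$, $$(-\Delta)^{\gamma/2}g(x)=-\int_{\mathbb{R}^d}\frac{g(x+y)-g(x)}{|y|^{d+\gamma}}\,\mathrm{d}y ,$$ the integral being understood in the principal value sense when $\gamma\ge1$. It is a closable operator on $UC_b(\mathbb{R}^d)$ with initial domain $UC_b^2(\mathbb{R}^d)$, and for $f\in UC_b(\mathbb{R}^d)$ the expression $(-\Delta)^{\beta/2}P_tf$ refers to its closure. *)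

(* Defs.v *)
From HB Require Import structures.
From mathcomp Require Import all_boot all_order all_algebra.
From mathcomp Require Import all_classical all_reals all_analysis.

Set Implicit Arguments.
Unset Strict Implicit.
Unset Printing Implicit Defensive.

Import Order.TTheory GRing.Theory Num.Theory.
Import numFieldNormedType.Exports.

Local Open Scope classical_set_scope.
Local Open Scope ring_scope.

(* R^d is 'rV[R]_d, with the sigma-algebra generated by the coordinates
   (that is, the Borel sigma-algebra). *)
Definition measure_rV_display : measure_display. Proof. exact. Qed.

Section measurable_rV.
Context {R : realType} {d : nat}.

Let coors : 'I_d -> 'rV[R]_d -> measurableTypeR R := fun i x => x ord0 i.

Let rV_set0 : g_sigma_preimage coors set0.
Proof. exact: sigma_algebra0. Qed.

Let rV_setC A : g_sigma_preimage coors A -> g_sigma_preimage coors (~` A).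
Proof. exact: sigma_algebraC. Qed.

Let rV_bigcup (F : _^nat) : (forall i, g_sigma_preimage coors (F i)) ->
  g_sigma_preimage coors (\bigcup_i (F i)).
Proof. exact: sigma_algebra_bigcup. Qed.

HB.instance Definition _ := @isMeasurable.Build measure_rV_display
  'rV[R]_d (g_sigma_preimage coors) rV_set0 rV_setC rV_bigcup.

End measurable_rV.

Section lebesgue_rV.
Context {R : realType}.

Lemma measurable_fun_rVP d0 (T : measurableType d0) n (f : T -> 'rV[R]_n) :
  (forall i, measurable_fun [set: T] (fun x => f x ord0 i)) ->
  measurable_fun [set: T] f.
Proof.
move=> mf _; apply: (@measurability _ _ _ _ _ _
  (\big[setU/set0]_(i < n) preimage_set_system setT
     (fun x : 'rV[R]_n => (x ord0 i : measurableTypeR R)) measurable)) => //.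
move=> _ [A] /= + <-.
rewrite -bigcup_seq => -[/= i _ [B mB <-]].
by rewrite !setTI; have := mf i measurableT B mB; rewrite setTI.
Qed.

Lemma measurable_rV_coord n (i : 'I_n) :
  measurable_fun [set: 'rV[R]_n] (fun x => x ord0 i).
Proof.
move=> _ B mB; apply: sub_sigma_algebra.
by rewrite -bigcup_seq /=; exists i; [rewrite /= mem_index_enum | exists B].
Qed.

Definition cons_rV n (p : measurableTypeR R * 'rV[R]_n) : 'rV[R]_n.+1 :=
  \row_i (if unlift ord0 i is Some j then p.2 ord0 j else p.1).

Lemma measurable_cons_rV n :
  measurable_fun [set: measurableTypeR R * 'rV[R]_n] (@cons_rV n).
Proof.
apply: measurable_fun_rVP => i; case: (unliftP ord0 i) => [j|] ->.
  rewrite (_ : (fun _ => _) = (fun v : 'rV[R]_n => v ord0 j) \o snd).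
    exact: measurableT_comp (measurable_rV_coord j) measurable_snd.
  by apply/funext => p; rewrite mxE liftK.
rewrite (_ : (fun _ => _) = fst); first exact: measurable_fst.
by apply/funext => p; rewrite mxE unlift_none.
Qed.

Variables (n : nat) (m1 : {sigma_finite_measure set (measurableTypeR R) -> \bar R}).
Variable (m : {sigma_finite_measure set 'rV[R]_n -> \bar R}).

Definition cons_measure : set 'rV[R]_n.+1 -> \bar R :=
  pushforward (m1 \x m)%E (@cons_rV n).

Let M := measure_function_pushforward__canonical__measure_function_Measure
  (m1 \x m)%E (@measurable_cons_rV n).

Let cons_measure0 : cons_measure set0 = 0%E.
Proof. exact: (measure0 M). Qed.

Let cons_measure_ge0 A : (0 <= cons_measure A)%E.
Proof. exact: (measure_ge0 M). Qed.

Let cons_measure_sigma_additive : semi_sigma_additive cons_measure.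
Proof. exact: (@measure_semi_sigma_additive _ _ _ M). Qed.

HB.instance Definition _ := isMeasure.Build _ _ _ cons_measure
  cons_measure0 cons_measure_ge0 cons_measure_sigma_additive.

Lemma cons_measure_sigma_finite : sigma_finite setT cons_measure.
Proof.
have /sigma_finiteP[A [TA ndA Aoo]] := sigma_finiteT m1.
have /sigma_finiteP[B [TB ndB Boo]] := sigma_finiteT m.
pose F k := A k `*` B k.
have FT : setT = \bigcup_k F k.
  rewrite -setXTT TA TB predeqE => -[x y]; split.
    move=> [/= [i _ Aix] [j _ Bjy]]; exists (maxn i j) => //; split.
    - by move: x Aix; exact/subsetPset/ndA/leq_maxl.
    - by move: y Bjy; exact/subsetPset/ndB/leq_maxr.
  by move=> [i _ []/= ? ?]; split; exists i.
have Ffin k : measurable (F k) /\ ((m1 \x m)%E (F k) < +oo)%E.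
  have [? ?] := Aoo k; have [? ?] := Boo k.
  split; first exact: measurableX.
  by rewrite product_measure1E// lte_mul_pinfty// ge0_fin_numE.
pose g (x : 'rV[R]_n.+1) : measurableTypeR R * 'rV[R]_n :=
  (x ord0 ord0, \row_j x ord0 (lift ord0 j)).
have mg : measurable_fun setT g.
  apply/measurable_fun_pairP; split; first exact: measurable_rV_coord.
  apply: measurable_fun_rVP => i; rewrite /g.
  rewrite (_ : (fun _ => _) = fun x : 'rV[R]_n.+1 => x ord0 (lift ord0 i)).
    exact: measurable_rV_coord.
  by apply/funext => x; rewrite /= mxE.
have gK p : g (cons_rV p) = p.
  case: p => a v; congr (_, _); first by rewrite mxE unlift_none.
  by apply/rowP => j; rewrite !mxE liftK.
exists (fun i => g @^-1` F i).
  by rewrite -preimage_bigcup -FT preimage_setT.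
move=> i; have [mFi Fioo] := Ffin i; split.
  by rewrite -[_ @^-1` _]setTI; exact: mg.
rewrite /cons_measure /pushforward -comp_preimage.
by rewrite (_ : g \o @cons_rV n = id) //; apply/funext => p; exact: gK.
Qed.

HB.instance Definition _ := Measure_isSigmaFinite.Build _ _ _ cons_measure
  cons_measure_sigma_finite.

End lebesgue_rV.

Fixpoint lebesgue_rV {R : realType} (n : nat) :
    {sigma_finite_measure set 'rV[R]_n -> \bar R} :=
  if n is n'.+1 then cons_measure (@lebesgue_measure R) (lebesgue_rV n')
  else dirac (0 : 'rV[R]_0).

Lemma lebesgue_rV_box {R : realType} (n : nat)
    (A : 'I_n -> set (measurableTypeR R)) :
  (forall i, measurable (A i)) ->
  lebesgue_rV n [set x | forall i, A i (x ord0 i)] =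
  (\prod_(i < n) lebesgue_measure (A i))%E.
Proof.
elim: n A => [|n IHn] A mA.
  by rewrite big_ord0 /= diracE mem_set//= => -[].
pose B := [set v : 'rV[R]_n | forall i, A (lift ord0 i) (v ord0 i)].
have mB : measurable B.
  rewrite (_ : B = \bigcap_(i in [set: 'I_n])
      (fun x : 'rV[R]_n => x ord0 i) @^-1` A (lift ord0 i)).
    apply: fin_bigcap_measurable => // i _; rewrite -[_ @^-1` _]setTI.
    exact: (@measurable_rV_coord R n i measurableT _ (mA _)).
  by apply/seteqP; split=> x /= h i => [_|]; exact: h.
rewrite big_ord_recl -IHn // [LHS]/= /cons_measure /pushforward -/B.
rewrite (_ : _ @^-1` _ = A ord0 `*` B); first by rewrite product_measure1E.
apply/seteqP; split=> -[a v] /=.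
  move=> h; split; first by have := h ord0; rewrite mxE unlift_none.
  by move=> j; have := h (lift ord0 j); rewrite mxE liftK.
move=> [h1 h2] i; case: (unliftP ord0 i) => [j|] ->.
  by rewrite mxE liftK; exact: h2.
by rewrite mxE unlift_none.
Qed.

Section analysis_rV.
Context {R : realType} {d : nat}.
Local Notation V := 'rV[R]_d.
Implicit Types (f g : V -> R).

(* The library norm of 'rV[R]_d is the max norm; it is used below only through
   the topology and the uniform structure. *)
Definition dotp (x y : V) : R := \sum_(i < d) x ord0 i * y ord0 i.
Definition enorm (x : V) : R := Num.sqrt (dotp x x).

Definition supnorm f : \bar R := ereal_sup [set `|f x|%:E | x in setT].

Definition UCb f := bounded_fun f /\ unif_continuous f.

Definition partial (i : 'I_d) f : V -> R := 'D_(delta_mx ord0 i) f.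

Definition UCb2 f :=
  [/\ UCb f,
    forall i, (forall x, derivable f x (delta_mx ord0 i)) /\
              UCb (partial i f) &
    forall i j,
      (forall x, derivable (partial i f) x (delta_mx ord0 j)) /\
      UCb (partial j (partial i f))].

Definition frac_kernel (gamma : R) f (x y : V) : R :=
  (f (x + y) - f x) / enorm y `^ (d%:R + gamma).

Definition frac_lap (gamma : R) f (x : V) : R :=
  - (if gamma < 1
     then \int[lebesgue_rV d]_y frac_kernel gamma f x y
     else lim (\int[lebesgue_rV d]_(y in [set y | e < enorm y])
                 frac_kernel gamma f x y @[e --> 0^'+])).

(* Graph of the closure in UC_b of (-Delta)^{gamma/2} with domain UC_b^2. *)
Definition frac_lap_closure (gamma : R) f g :=
  UCb f /\ UCb g /\
  exists fn : nat -> V -> R,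
    [/\ forall n, UCb2 (fn n),
      supnorm (fun x => fn n x - f x) @[n --> \oo] --> 0%E &
      supnorm (fun x => frac_lap gamma (fn n) x - g x) @[n --> \oo] --> 0%E].

Record C0_semigroup (P : R -> (V -> R) -> V -> R) : Prop := {
  C0_UCb : forall (t : R) f, 0 <= t -> UCb f -> UCb (P t f) ;
  C0_linear : forall (t a : R) f g, 0 <= t -> UCb f -> UCb g ->
    P t (fun x => a * f x + g x) = (fun x => a * P t f x + P t g x) ;
  C0_bounded : forall t : R, 0 <= t -> exists M : R,
    forall f, UCb f -> (supnorm (P t f) <= M%:E * supnorm f)%E ;
  C0_zero : forall f, UCb f -> P 0 f = f ;
  C0_add : forall (s t : R) f, 0 <= s -> 0 <= t -> UCb f ->
    P (s + t) f = P s (P t f) ;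
  C0_continuous : forall f, UCb f ->
    supnorm (fun x => P t f x - f x) @[t --> 0^'+] --> 0%E }.

(* [generator P f g]: f is in the domain of the generator L of P, and L f = g *)
Definition generator (P : R -> (V -> R) -> V -> R) f g :=
  [/\ UCb f, UCb g &
    supnorm (fun x => (P t f x - f x) / t - g x) @[t --> 0^'+] --> 0%E].

End analysis_rV.

Section stochastic.
Context {R : realType} {disp : measure_display} {Omega : measurableType disp}.
Variable P : probability Omega R.

Definition filtration (F : R -> set (set Omega)) :=
  (forall t : R, 0 <= t -> sigma_algebra setT (F t) /\ F t `<=` measurable) /\
  (forall s t : R, 0 <= s -> s <= t -> F s `<=` F t).

Section processes.
Context {n : nat}.
Implicit Types (F : R -> set (set Omega)) (Y : R -> Omega -> 'rV[R]_n).

Definition adapted F Y :=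
  forall (t : R) (B : set 'rV[R]_n), 0 <= t -> measurable B -> F t (Y t @^-1` B).

Definition cadlag Y := forall w,
  (forall t : R, 0 <= t -> Y s w @[s --> t^'+] --> Y t w) /\
  (forall t : R, 0 < t -> cvg (Y s w @[s --> t^'-])).

Record levy_process F Y : Prop := {
  levy_adapted : adapted F Y ;
  levy_cadlag : cadlag Y ;
  levy0 : {ae P, forall w, Y 0 w = 0} ;
  levy_indep : forall (s t : R) (A : set Omega) (B : set 'rV[R]_n),
    0 <= s -> s <= t -> F s A -> measurable B ->
    let I := [set w | B (Y t w - Y s w)] in P (A `&` I) = (P A * P I)%E ;
  levy_stationary : forall (s t : R) (B : set 'rV[R]_n),
    0 <= s -> s <= t -> measurable B ->
    P [set w | B (Y t w - Y s w)] = P [set w | B (Y (t - s) w)] }.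

(* Characteristic function E e^{i<xi, Y_t>} = e^{- c t |xi|^gamma}, with the
   scale fixed by requiring the generator to be -(-Delta)^{gamma/2}. *)
Record symmetric_stable (gamma : R) Y : Prop := {
  stable_char : exists2 c : R, 0 < c & forall (t : R) (xi : 'rV[R]_n), 0 <= t ->
    ('E_P[fun w => cos (dotp xi (Y t w))] =
      (expR (- (c * t * enorm xi `^ gamma)))%:E)%E /\
    ('E_P[fun w => sin (dotp xi (Y t w))] = 0)%E ;
  stable_generator : forall f, UCb2 f ->
    supnorm (fun x => (fine 'E_P[fun w => f (x + Y t w)%R]%E - f x) / t
                      + frac_lap gamma f x) @[t --> 0^'+] --> 0%E }.

Definition sigma_process Y : set (set Omega) :=
  <<s [set A | exists (t : R) (B : set 'rV[R]_n),
    [/\ 0 <= t, measurable B & A = Y t @^-1` B]] >>.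

Definition independent_processes Y Y' := forall A A',
  sigma_process Y A -> sigma_process Y' A' -> P (A `&` A') = (P A * P A')%E.

(* [stochastic_integral H Y t J]: J is \int_0^t H_{s-} dY_s, for H cadlag
   adapted and Y a semimartingale, as the limit in probability of the Riemann
   sums with integrand evaluated at the left end points.  The integrand of the
   limit is the left limit H_{s-}, not H_s. *)
Definition stochastic_integral (H : R -> Omega -> R) Y (t : R)
    (J : Omega -> 'rV[R]_n) :=
  forall e : R, 0 < e -> exists2 delta : R, 0 < delta &
    forall (N : nat) (tau : nat -> R), tau 0%N = 0 -> tau N = t ->
      (forall i, (i < N)%N -> tau i <= tau i.+1 < tau i + delta) ->
      let S w := \sum_(i < N) H (tau i) w *: (Y (tau i.+1) w - Y (tau i) w) in
      (P [set w | (e <= enorm (S w - J w))%R] <= e%:E)%E.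

End processes.

(* dX_t = b(X_{t-}) dY_t + dZ_t, X_0 = x.  The pair (Y, Z) is a Levy process in
   R^{d+d} with respect to F, so that b(X_{t-}) is nonanticipating. *)
Record solves_sde {d : nat} (alpha beta : R) (b : 'rV[R]_d -> R) (x : 'rV[R]_d)
    (F : R -> set (set Omega)) (Y Z X : R -> Omega -> 'rV[R]_d) : Prop := {
  sde_filtration : filtration F ;
  sde_levy : levy_process F (fun t w => row_mx (Y t w) (Z t w)) ;
  sde_independent : independent_processes Y Z ;
  sde_Z : symmetric_stable alpha Z ;
  sde_Y : symmetric_stable beta Y ;
  sde_adapted : adapted F X ;
  sde_cadlag : cadlag X ;
  sde_init : {ae P, forall w, X 0 w = x} ;
  sde_eq : forall t : R, 0 <= t -> exists J : Omega -> 'rV[R]_d,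
    [/\ measurable_fun setT J,
      stochastic_integral (fun s w => b (X s w)) Y t J &
      {ae P, forall w, X t w = x + J w + Z t w}] }.

End stochastic.

Section weak_solutions.
Context {R : realType} {d : nat}.
Local Notation V := 'rV[R]_d.

Record weak_solution (alpha beta : R) (b : V -> R) (x : V) := WeakSolution {
  ws_disp : measure_display ;
  ws_Omega : measurableType ws_disp ;
  ws_prob : probability ws_Omega R ;
  ws_filtration : R -> set (set ws_Omega) ;
  ws_Y : R -> ws_Omega -> V ;
  ws_Z : R -> ws_Omega -> V ;
  ws_X : R -> ws_Omega -> V ;
  ws_solves : solves_sde ws_prob alpha beta b x ws_filtration ws_Y ws_Z ws_X }.

Arguments ws_prob {alpha beta b x} _.
Arguments ws_X {alpha beta b x} _ _ _.

Definition unique_in_law (alpha beta : R) (b : V -> R) :=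
  forall (x : V) (S S' : weak_solution alpha beta b x)
    (n : nat) (t : 'I_n -> R) (B : 'I_n -> set V),
    (forall i, 0 <= t i) -> (forall i, measurable (B i)) ->
    ws_prob S [set w | forall i, B i (ws_X S (t i) w)] =
    ws_prob S' [set w | forall i, B i (ws_X S' (t i) w)].

(* P_t f(x) = E f(X_t(x)) *)
Definition transition (alpha beta : R) (b : V -> R)
    (X : forall x, weak_solution alpha beta b x) (t : R) (f : V -> R) (x : V) :=
  fine 'E_(ws_prob (X x))[fun w => f (ws_X (X x) t w)]%E.

Definition sde_generator (alpha beta : R) (b : V -> R) (f : V -> R) (x : V) :=
  - frac_lap alpha f x - `|b x| `^ beta * frac_lap beta f x.

Definition backward_kolmogorov (P : R -> (V -> R) -> V -> R) :=
  forall f, UCb2 f -> forall t : R, 0 < t -> exists2 h, generator P (P t f) h &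
    forall x, is_derive t 1 (fun s => P s f x) (h x).

End weak_solutions.

(* Main.v *)
(* Write A = -(-Delta)^(alpha/2), D = (-Delta)^(beta/2), theta = alpha/2 > beta,
   and let S be the semigroup of Z.

   Smoothing of S.  Let k <= |y|^(-d-alpha) be a smooth piece of the jump kernel
   at distance rho from the origin, of mass lambda ~ rho^(-alpha).  At a maximum
   point of w one has A w <= k * w - lambda w, whence
   (mu + lambda) sup w <= sup (mu w - A w) + sup (k * w) for mu > 0.  Apply this
   with mu = 1/epsilon to the implicit Euler scheme of step epsilon for
   w = S_t f(. + h) - S_t f: since the translation by h can be put on k, the
   convolution term is at most C lambda (|h| / rho) |f|, so that sup w decays
   like exp(- lambda t) up to an error C (|h| / rho) |f|.  Choosing rho gives
   |S_t f(x + h) - S_t f(x)| <= C |h|^theta t^(-1/2) |f|.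

   Since beta < theta, D g is controlled by the sup norm and the theta-Hölder
   constant of g, and mollifying g shows that g is in the domain of the closure.

   Perturbation.  As d/ds P_(t-s) S_s f = P_(t-s) (|b|^beta D S_s f), the
   increment of P_t f by h is at most that of S_t f plus a multiple, of order
   sqrt T, of the best bound for the increments of P_s, 0 < s <= T.  For small T
   this absorbs, and P_t f satisfies the same Hölder estimate as S_t f.  For
   t > T one writes P_t = P_T P_(t-T). *)
Require Import Defs.
From HB Require Import structures.
From mathcomp Require Import all_boot all_order all_algebra.
From mathcomp Require Import ring lra.
From mathcomp Require Import all_classical all_reals all_analysis.
From mathcomp Require Import measurable_realfun.

Set Implicit Arguments.
Unset Strict Implicit.
Unset Printing Implicit Defensive.

Import Order.TTheory GRing.Theory Num.Theory.
Import numFieldNormedType.Exports.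

Local Open Scope classical_set_scope.
Local Open Scope ring_scope.

(** * Bounded uniformly continuous functions *)

(** The estimates are written for increments in place of derivatives, and the tool for S is the
    maximum principle: S enters through linearity, order, translation invariance and the action of
    its generator on [UCb2]. Hence the order of the factors in P_(t-s) S_s f, where the generator of
    P meets S_s f alone, and hence the two stages: f in [UCb2] first, then general f by
    mollification, which preserves every bound on increments.

    The exponent theta = alpha/2 makes the time singularities match. By scaling, a Hölder exponent
    theta costs t^(-theta/alpha) = t^(-1/2); since beta < theta, D S_s f is of order s^(-1/2) for s
    <= 1; and the integral of s^(-1/2) (t-s)^(-1/2) over (0, t) does not depend on t. Compared with
    the target t^(-1/2), a bounded contribution is a gain of sqrt t, and this is the factor that
    absorbs. *)

Section euclidean_norm.
Context {R : realType} {d : nat}.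
Local Notation V := 'rV[R]_d.
Implicit Types x y h : V.

Lemma normrV_coord x i : `|x ord0 i| <= `|x|.
Proof.
rewrite [leRHS]/Num.Def.normr /= mx_normE -[leLHS]nngE num_le.
exact: (@le_bigmax _ _ _ _ _ (ord0, i)).
Qed.

Lemma normrV_le x (M : R) : 0 <= M -> (forall i, `|x ord0 i| <= M) -> `|x| <= M.
Proof.
move=> M0 H; rewrite [leLHS]/Num.Def.normr /= mx_normrE.
by apply/bigmax_leP; split=> // -[i j] _ /=; rewrite ord1.
Qed.

Lemma normrV_lt x (M : R) : 0 < M -> (forall i, `|x ord0 i| < M) -> `|x| < M.
Proof.
move=> M0 H; rewrite [ltLHS]/Num.Def.normr /= mx_normrE.
by apply/bigmax_ltP; split=> // -[i j] _ /=; rewrite ord1.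
Qed.

Lemma dotp_ge0 x : 0 <= dotp x x.
Proof. by apply: sumr_ge0 => i _; rewrite -expr2 sqr_ge0. Qed.

Lemma enorm_ge0 x : 0 <= enorm x.
Proof. exact: sqrtr_ge0. Qed.

Lemma coord_le_enorm x i : `|x ord0 i| <= enorm x.
Proof.
rewrite -sqrtr_sqr ler_sqrt ?dotp_ge0// /dotp (bigD1 i)//= expr2 lerDl.
by apply: sumr_ge0 => j _; rewrite -expr2 sqr_ge0.
Qed.

Lemma normrV_le_enorm x : `|x| <= enorm x.
Proof. by apply: normrV_le => [|i]; [exact: enorm_ge0|exact: coord_le_enorm]. Qed.

(** Multiplying by [enorm x + enorm y] gives a difference of squares, which is estimated coordinate
    by coordinate. *)
Lemma enorm_lip x y : `|enorm x - enorm y| <= d%:R * `|x - y|.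
Proof.
have [S0|S0] := eqVneq (enorm x + enorm y) 0.
  have [x0 y0] : enorm x = 0 /\ enorm y = 0.
    by have := enorm_ge0 x; have := enorm_ge0 y; lra.
  by rewrite x0 y0 subrr normr0 mulr_ge0.
have Sp : 0 < enorm x + enorm y.
  by rewrite lt_neqAle eq_sym S0 addr_ge0 ?enorm_ge0.
rewrite -(ler_pM2r Sp) -{1}(ger0_norm (ltW Sp)) -normrM -subr_sqr.
rewrite /enorm !sqr_sqrtr ?dotp_ge0// -/(enorm x) -/(enorm y) /dotp -sumrB.
apply: (le_trans (ler_norm_sum _ _ _)).
have -> : d%:R * `|x - y| * (enorm x + enorm y) =
  \sum_(i < d) `|x - y| * (enorm x + enorm y).
  by rewrite sumr_const card_ord -[RHS]mulr_natl mulrA.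
apply: ler_sum => i _.
have -> : x ord0 i * x ord0 i - y ord0 i * y ord0 i =
  (x - y) ord0 i * (x ord0 i + y ord0 i) by rewrite !mxE; ring.
rewrite normrM ler_pM ?normrV_coord//.
by rewrite (le_trans (ler_normD _ _))// lerD ?coord_le_enorm.
Qed.

Lemma enorm0 : enorm (0 : V) = 0.
Proof. by rewrite /enorm /dotp big1 ?sqrtr0// => i _; rewrite mxE mul0r. Qed.

Lemma enorm_le x : enorm x <= d%:R * `|x|.
Proof. by have := enorm_lip x 0; rewrite enorm0 !subr0 ger0_norm ?enorm_ge0. Qed.

Lemma enorm_gt0 x : (0 < enorm x) = (x != 0).
Proof.
apply/idP/idP => [|x0]; first by apply: contraTN => /eqP ->; rewrite enorm0 ltxx.
by rewrite (lt_le_trans _ (normrV_le_enorm x))// normr_gt0.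
Qed.

End euclidean_norm.

Section uniformly_continuous_functions.
Context {R : realType} {d : nat}.
Local Notation V := 'rV[R]_d.
Implicit Types (f g : V -> R).

Lemma UCbP f : UCb f <-> (exists M, forall x, `|f x| <= M) /\
  (forall e, 0 < e -> exists2 r, 0 < r &
     forall x h, `|h| < r -> `|f (x + h) - f x| <= e).
Proof.
split=> [[fb /unif_continuousP fu]|[[M fM] fu]].
  split; first by move: fb => [N [_ H]]; exists (N + 1) => x; apply: H => //; rewrite ltrDl.
  move=> e e0; have [r r0 H] := fu _ e0; exists r => // x h hr.
  apply: ltW; rewrite distrC; have := H (x, x + h); rewrite -!ball_normE /=.
  by apply; rewrite opprD addNKr normrN.
split; first by exists M; split; [exact: num_real|move=> N MN x _; rewrite /= (le_trans (fM x))// ltW].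
apply/unif_continuousP => e e0; have [r r0 H] := fu (e / 2) ltac:(lra).
exists r => // -[x y] /=; rewrite -!ball_normE /= => xy.
have := H x (y - x); rewrite subrKC distrC => /(_ xy) {}H.
by rewrite (le_lt_trans _ (_ : e / 2 < e)) 1?distrC//; lra.
Qed.

Lemma UCb_bound f : UCb f -> exists2 M, 0 <= M & forall x, `|f x| <= M.
Proof.
move=> /UCbP[[M fM] _]; exists M => //.
by apply: le_trans (fM 0); rewrite normr_ge0.
Qed.

Lemma UCb_unif f e : UCb f -> 0 < e -> exists2 r, 0 < r &
  forall x h, `|h| < r -> `|f (x + h) - f x| <= e.
Proof. by move=> /UCbP[_]; apply. Qed.

Lemma UCb_continuous f : UCb f -> continuous f.
Proof.
move=> /UCbP[_ fu] x; apply/(@cvgrPdist_le _ _ _ (nbhs x)) => e e0.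
have [r r0 H] := fu _ e0; apply/nbhs_ballP; exists r => //= y; rewrite -ball_normE /= => xy.
by rewrite distrC -{1}(subrKC x y); apply: H; rewrite distrC.
Qed.

Lemma UCb_cst (c : R) : UCb (fun _ : V => c).
Proof.
apply/UCbP; split; first by exists `|c|.
by move=> e e0; exists 1 => // x h _; rewrite subrr normr0 ltW.
Qed.

Lemma UCb_lin (a : R) f g : UCb f -> UCb g -> UCb (fun x => a * f x + g x).
Proof.
move=> Uf Ug; have [M M0 fM] := UCb_bound Uf; have [N N0 gN] := UCb_bound Ug.
apply/UCbP; split.
  exists (`|a| * M + N) => x; rewrite (le_trans (ler_normD _ _))// lerD// normrM.
  exact: ler_wpM2l.
move=> e e0.
have [r r0 fr] := UCb_unif Uf (ltac:(by rewrite ?divr_gt0// ltr_wpDl) : 0 < e / 2 / (`|a| + 1)).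
have [s s0 gs] := UCb_unif Ug (ltac:(lra) : 0 < e / 2).
exists (Num.min r s); first by rewrite lt_min r0 s0.
move=> x h; rewrite lt_min => /andP[hr hs].
have -> : a * f (x + h) + g (x + h) - (a * f x + g x) =
  a * (f (x + h) - f x) + (g (x + h) - g x) by ring.
rewrite (le_trans (ler_normD _ _))// (splitr e) lerD ?gs// normrM.
apply: (@le_trans _ _ ((`|a| + 1) * (e / 2 / (`|a| + 1)))); last first.
  by rewrite mulrC divfK// gt_eqF// ltr_wpDl.
by rewrite ler_pM ?fr// lerDl.
Qed.

Lemma UCbD f g : UCb f -> UCb g -> UCb (fun x => f x + g x).
Proof. by move=> /(UCb_lin 1) H /H; under eq_fun do rewrite mul1r. Qed.

Lemma UCbB f g : UCb f -> UCb g -> UCb (fun x => f x - g x).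
Proof.
by move=> Uf Ug; have := UCb_lin (-1) Ug Uf; under eq_fun do rewrite mulN1r addrC.
Qed.

Lemma UCbZ (a : R) f : UCb f -> UCb (fun x => a * f x).
Proof.
by move=> Uf; have := UCb_lin a Uf (UCb_cst 0); under eq_fun do rewrite addr0.
Qed.

Lemma UCbN f : UCb f -> UCb (fun x => - f x).
Proof. by move=> /(UCbZ (-1)); under eq_fun do rewrite mulN1r. Qed.

Lemma UCbM f g : UCb f -> UCb g -> UCb (fun x => f x * g x).
Proof.
move=> Uf Ug; have [M M0 fM] := UCb_bound Uf; have [N N0 gN] := UCb_bound Ug.
apply/UCbP; split.
  by exists (M * N) => x; rewrite normrM ler_pM.
move=> e e0.
have [r r0 fr] := UCb_unif Uf (ltac:(by rewrite ?divr_gt0// ltr_wpDl) : 0 < e / 2 / (N + 1)).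
have [s s0 gs] := UCb_unif Ug (ltac:(by rewrite ?divr_gt0// ltr_wpDl) : 0 < e / 2 / (M + 1)).
exists (Num.min r s); first by rewrite lt_min r0 s0.
move=> x h; rewrite lt_min => /andP[hr hs].
have -> : f (x + h) * g (x + h) - f x * g x =
  (f (x + h) - f x) * g (x + h) + f x * (g (x + h) - g x) by ring.
rewrite (le_trans (ler_normD _ _))// (splitr e) lerD// normrM.
  rewrite (@le_trans _ _ (e / 2 / (N + 1) * (N + 1)))//.
    by rewrite ler_pM ?fr// (le_trans (gN _))// lerDl.
  by rewrite divfK// gt_eqF// ltr_wpDl.
rewrite (@le_trans _ _ ((M + 1) * (e / 2 / (M + 1))))//.
  by rewrite ler_pM ?gs// (le_trans (fM _))// lerDl.
by rewrite mulrC divfK// gt_eqF// ltr_wpDl.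
Qed.

Lemma UCb_shift f h : UCb f -> UCb (fun x => f (x + h)).
Proof.
move=> /UCbP[[M fM] fu]; apply/UCbP; split; first by exists M => x.
move=> e /fu[r r0 H]; exists r => // x k kr.
by rewrite addrAC H.
Qed.

Lemma UCb_limit f : (forall e, 0 < e -> exists2 g, UCb g &
  forall x, `|g x - f x| <= e) -> UCb f.
Proof.
move=> H; apply/UCbP; split.
  have [g /UCb_bound[M M0 gM] gf] := H 1 ltac:(lra).
  exists (M + 1) => x; rewrite -[f x](subKr (g x)) (le_trans (ler_normB _ _))//.
  exact: lerD.
move=> e e0; have [g Ug gf] := H (e / 3) ltac:(lra).
have [r r0 gr] := UCb_unif Ug (ltac:(lra) : 0 < e / 3); exists r => // x h hr.
have := gf x; have := gf (x + h); have := gr x h hr.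
rewrite !ler_norml => /andP[? ?] /andP[? ?] /andP[? ?]; apply/andP; split; lra.
Qed.

End uniformly_continuous_functions.

(** * Directional derivatives with a uniform remainder *)

Section uniform_partial_derivatives.
Context {R : realType} {d : nat}.
Local Notation V := 'rV[R]_d.
Implicit Types (f g : V -> R) (v : V).

(** The remainder is uniform in x. In this form a derivative is carried over by every linear
    sup-norm contraction that commutes with translations, in particular by the semigroup of Z. *)
Definition unif_derive v f g := forall e : R, 0 < e -> exists2 r : R, 0 < r &
  forall x (h : R), `|h| < r -> `|f (x + h *: v) - f x - h * g x| <= e * `|h|.

Lemma unif_derive_is_derive v f g x :
  unif_derive v f g -> derivable f x v /\ 'D_v f x = g x.
Proof.
move=> H.
have cvgf : h^-1 *: ((f \o shift x) (h *: v) - f x) @[h --> 0^'] --> g x.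
  apply/cvgrPdist_le => e e0; have [r r0 fr] := H e e0.
  near=> h.
  have h0 : h != 0 by near: h; exact: nbhs_dnbhs_neq.
  have hr : `|h| < r.
    near: h; apply: nbhs_dnbhs; apply/nbhs_ballP; exists r => //= h.
    by rewrite -ball_normE /= sub0r normrN.
  have := fr x h hr; rewrite /= [h *: v + x]addrC.
  set F := f _ - f x => hfr.
  rewrite -(ler_pM2r (_ : 0 < `|h|)) ?normr_gt0// -normrM.
  have -> : (g x - h^-1 *: F) * h = - (F - h * g x).
    by rewrite mulrBl opprB mulrAC mulVf// mul1r [g x * h]mulrC.
  by rewrite normrN.
by split; [apply/cvg_ex; exists (g x)|exact/cvg_lim].
Unshelve. all: by end_near. Qed.

Lemma is_derive_line v f x (s : R) : (forall y, derivable f y v) ->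
  is_derive s (1 : R) (fun s : R => f (x + s *: v)) ('D_v f (x + s *: v)).
Proof.
move=> df.
have E (h : R) : h^-1 *: (((fun s : R => f (x + s *: v)) \o shift s) (h *: 1) - f (x + s *: v)) =
   h^-1 *: ((f \o shift (x + s *: v)) (h *: v) - f (x + s *: v)).
  by congr (_ *: (f _ - _)); rewrite /= [h *: 1]mulr1 scalerDl addrCA.
have Ef := funext E.
by split; rewrite /derivable /derive; [rewrite [X in cvg (X @ _)]Ef; exact: df|
  by rewrite [X in lim (X @ _)]Ef].
Qed.

(** By the mean value theorem on the line through x, the remainder is h times an increment of the
    derivative, which uniform continuity makes small independently of x. *)
Lemma derive_unif_derive v f : (forall x, derivable f x v) -> UCb ('D_v f) ->
  unif_derive v f ('D_v f).
Proof.
move=> df Ug e e0; have [r r0 gr] := UCb_unif Ug e0.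
exists (r / (`|v| + 1)) => [|x h hr]; first by rewrite divr_gt0// ltr_wpDl.
pose F (s : R) := f (x + s *: v).
have dF s : is_derive s (1 : R) F ('D_v f (x + s *: v)) by exact: is_derive_line.
have cF : continuous F.
  by move=> s; apply/differentiable_continuous/derivable1_diffP; have [] := dF s.
have key a b : a <= b -> `|a| <= `|h| -> `|b| <= `|h| ->
    `|F b - F a - (b - a) * 'D_v f x| <= e * `|b - a|.
  move=> ab ah bh; have [c cab ->] := @MVT_segment R F (fun s => 'D_v f (x + s *: v))
    a b ab (fun s _ => dF s) (continuous_subspaceT cF).
  rewrite [(b - a) * _]mulrC -mulrBl normrM ler_wpM2r//; apply: gr.
  rewrite normrZ (@le_lt_trans _ _ (`|h| * `|v|))//.
    rewrite ler_wpM2r//; move: cab; rewrite in_itv /= => /andP[ac cb].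
    by move: ah bh; rewrite !ler_norml => /andP[? ?] /andP[? ?]; apply/andP; split; lra.
  move: hr; rewrite ltr_pdivlMr ?ltr_wpDl// => /(le_lt_trans _); apply.
  by rewrite ler_wpM2l// lerDl.
have F0 : F 0 = f x by rewrite /F scale0r addr0.
have [h0|h0] := leP 0 h.
  by have := key 0 h h0; rewrite normr0 normr_ge0 lexx F0 subr0; apply.
have := key h 0 (ltW h0); rewrite normr0 normr_ge0 lexx F0 sub0r normrN => /(_ isT isT).
by congr (_ <= _); rewrite -[LHS]normrN; congr (`| _ |); rewrite /F; ring.
Qed.

Lemma unif_derive_lin v (a : R) f f' g g' : unif_derive v f f' -> unif_derive v g g' ->
  unif_derive v (fun x => a * f x + g x) (fun x => a * f' x + g' x).
Proof.
move=> Hf Hg e e0.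
have [r r0 fr] := Hf (e / 2 / (`|a| + 1)) ltac:(by rewrite ?divr_gt0// ltr_wpDl).
have [s s0 gs] := Hg (e / 2) ltac:(lra).
exists (Num.min r s); first by rewrite lt_min r0 s0.
move=> x h; rewrite lt_min => /andP[hr hs].
have -> : a * f (x + h *: v) + g (x + h *: v) - (a * f x + g x) - h * (a * f' x + g' x) =
  a * (f (x + h *: v) - f x - h * f' x) + (g (x + h *: v) - g x - h * g' x) by ring.
rewrite (le_trans (ler_normD _ _))// (splitr e) mulrDl lerD ?gs// normrM.
apply: (@le_trans _ _ ((`|a| + 1) * (e / 2 / (`|a| + 1) * `|h|))); last first.
  by rewrite le_eqVlt; apply/orP; left; apply/eqP; field; rewrite gt_eqF// ltr_wpDl.
by rewrite ler_pM ?fr// lerDl.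
Qed.

Lemma unif_derive_cst v (c : R) : unif_derive v (fun=> c) (fun=> 0).
Proof.
by move=> e e0; exists 1 => // x h _; rewrite subrr mulr0 subr0 normr0 mulr_ge0// ltW.
Qed.

Lemma unif_derive_shift v f f' y : unif_derive v f f' ->
  unif_derive v (fun x => f (x + y)) (fun x => f' (x + y)).
Proof.
by move=> H e /H[r r0 fr]; exists r => // x h hr; rewrite (addrAC x); exact: fr.
Qed.

Lemma UCb_Zline f v : UCb f -> forall e, 0 < e -> exists2 r, 0 < r &
  forall x (h : R), `|h| < r -> `|f (x + h *: v) - f x| <= e.
Proof.
move=> Uf e e0; have [r r0 H] := UCb_unif Uf e0.
exists (r / (`|v| + 1)) => [|x h hr]; first by rewrite divr_gt0// ltr_wpDl.
apply: H; rewrite normrZ (le_lt_trans _ (_ : `|h| * (`|v| + 1) < _))//.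
  by rewrite ler_wpM2l// lerDl.
by rewrite -ltr_pdivlMr// ltr_wpDl.
Qed.

Lemma unif_derive_mul v f f' g g' : UCb f -> UCb f' -> UCb g -> UCb g' ->
  unif_derive v f f' -> unif_derive v g g' ->
  unif_derive v (fun x => f x * g x) (fun x => f' x * g x + f x * g' x).
Proof.
move=> Uf Uf' Ug Ug' Hf Hg e e0.
have [M M0 fM] := UCb_bound Uf; have [N N0 gN] := UCb_bound Ug.
have [M' M'0 f'M] := UCb_bound Uf'.
have p0 (B : R) : 0 <= B -> 0 < e / 3 / (B + 1) by move=> B0; rewrite ?divr_gt0// ltr_wpDl.
have [r r0 fr] := Hf _ (p0 _ N0).
have [s s0 gs] := Hg _ (p0 _ M0).
have [q q0 gq] := UCb_Zline v Ug (p0 _ M'0).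
exists (Num.min r (Num.min s q)); first by rewrite !lt_min r0 s0.
move=> x h; rewrite !lt_min => /and3P[hr hs hq].
have -> : f (x + h *: v) * g (x + h *: v) - f x * g x - h * (f' x * g x + f x * g' x) =
  (f (x + h *: v) - f x - h * f' x) * g (x + h *: v) +
  f x * (g (x + h *: v) - g x - h * g' x) +
  h * (f' x * (g (x + h *: v) - g x)) by ring.
have -> : e * `|h| = e / 3 * `|h| + e / 3 * `|h| + `|h| * (e / 3) by field.
have pK (B : R) : 0 <= B -> e / 3 / (B + 1) * (B + 1) = e / 3.
  by move=> B0; rewrite divfK// gt_eqF// ltr_wpDl.
rewrite (le_trans (ler_normD _ _))// lerD//.
  rewrite (le_trans (ler_normD _ _))// lerD// normrM.
    rewrite -(pK _ N0) mulrAC ler_pM ?fr// (le_trans (gN _))// lerDl//.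
  by rewrite -(pK _ M0) mulrC -mulrA [_ * `|h|]mulrC mulrA ler_pM ?gs// (le_trans (fM _))// lerDl.
rewrite normrM ler_wpM2l// normrM -(pK _ M'0) mulrC ler_pM ?gq//.
by rewrite (le_trans (f'M _))// lerDl.
Qed.

(** The derivatives become witnesses: closure of [UCb2] under an operation is then shown by
    exhibiting the derivatives of the result. *)
Lemma UCb2P f : UCb2 f <-> UCb f /\ exists (g : 'I_d -> V -> R) (k : 'I_d -> 'I_d -> V -> R),
  [/\ forall i, UCb (g i), forall i, unif_derive (delta_mx ord0 i) f (g i),
      forall i j, UCb (k i j) & forall i j, unif_derive (delta_mx ord0 j) (g i) (k i j)].
Proof.
split=> [[Uf H1 H2]|[Uf [g [k [Ug Hg Uk Hk]]]]].
  split=> //; exists (fun i => partial i f), (fun i j => partial j (partial i f)).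
  split=> [i|i|i j|i j]; first by case: (H1 i).
  - by case: (H1 i) => ? ?; exact: derive_unif_derive.
  - by case: (H2 i j).
  - by case: (H2 i j) => ? ?; exact: derive_unif_derive.
have pE i : partial i f = g i.
  by apply/funext => x; have [_] := unif_derive_is_derive x (Hg i).
have ppE i j : partial j (partial i f) = k i j.
  by rewrite pE; apply/funext => x; have [_] := unif_derive_is_derive x (Hk i j).
split=> // [i|i j].
  by rewrite pE; split=> // x; have [] := unif_derive_is_derive x (Hg i).
by rewrite ppE pE; split=> // x; have [] := unif_derive_is_derive x (Hk i j).
Qed.

Lemma UCb2_UCb f : UCb2 f -> UCb f. Proof. by case. Qed.

Lemma UCb2_lin (a : R) f g : UCb2 f -> UCb2 g -> UCb2 (fun x => a * f x + g x).
Proof.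
move=> /UCb2P[Uf [f1 [f2 [Uf1 Hf1 Uf2 Hf2]]]] /UCb2P[Ug [g1 [g2 [Ug1 Hg1 Ug2 Hg2]]]].
apply/UCb2P; split; first exact: UCb_lin.
exists (fun i x => a * f1 i x + g1 i x), (fun i j x => a * f2 i j x + g2 i j x).
split=> *; [exact: UCb_lin|exact: unif_derive_lin|exact: UCb_lin|exact: unif_derive_lin].
Qed.

Lemma UCb2_cst (c : R) : UCb2 (fun _ : V => c).
Proof.
apply/UCb2P; split; first exact: UCb_cst.
exists (fun _ _ => 0), (fun _ _ _ => 0).
by split=> *; [exact: UCb_cst|exact: unif_derive_cst|exact: UCb_cst|exact: unif_derive_cst].
Qed.

Lemma UCb2_shift f y : UCb2 f -> UCb2 (fun x => f (x + y)).
Proof.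
move=> /UCb2P[Uf [f1 [f2 [Uf1 Hf1 Uf2 Hf2]]]].
apply/UCb2P; split; first exact: UCb_shift.
exists (fun i x => f1 i (x + y)), (fun i j x => f2 i j (x + y)).
by split=> *; [exact: UCb_shift|exact: unif_derive_shift|exact: UCb_shift|
  exact: unif_derive_shift].
Qed.

Lemma UCb2M f g : UCb2 f -> UCb2 g -> UCb2 (fun x => f x * g x).
Proof.
move=> /UCb2P[Uf [f1 [f2 [Uf1 Hf1 Uf2 Hf2]]]] /UCb2P[Ug [g1 [g2 [Ug1 Hg1 Ug2 Hg2]]]].
apply/UCb2P; split; first exact: UCbM.
exists (fun i x => f1 i x * g x + f x * g1 i x),
  (fun i j x => 1 * (f2 i j x * g x + f1 i x * g1 j x) +
                    (f1 j x * g1 i x + f x * g2 i j x)).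
split=> [i|i|i j|i j].
- by apply: UCbD; exact: UCbM.
- exact: unif_derive_mul.
- by apply: UCb_lin; apply: UCbD; exact: UCbM.
- have := @unif_derive_lin (delta_mx ord0 j) 1 _ _ _ _
    (unif_derive_mul (Uf1 i) (Uf2 i j) Ug (Ug1 j) (Hf2 i j) (Hg1 j))
    (unif_derive_mul Uf (Uf1 j) (Ug1 i) (Ug2 i j) (Hf1 j) (Hg2 i j)).
  by under eq_fun do rewrite mul1r.
Qed.

Lemma UCb2_ext f g : UCb2 f -> (forall x, f x = g x) -> UCb2 g.
Proof. by move=> + /funext <-. Qed.

Lemma UCb2N f : UCb2 f -> UCb2 (fun x => - f x).
Proof. by move=> /(UCb2_lin (-1))/(_ (UCb2_cst 0))/UCb2_ext; apply => x; ring. Qed.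

Lemma UCb2B f g : UCb2 f -> UCb2 g -> UCb2 (fun x => f x - g x).
Proof. by move=> /[swap] /(UCb2_lin (-1)) /[apply]/UCb2_ext; apply => x; ring. Qed.

Lemma UCb2_prod (I : Type) (s : seq I) (F : I -> V -> R) :
  (forall i, UCb2 (F i)) -> UCb2 (fun x => \prod_(i <- s) F i x).
Proof.
move=> UF; elim: s => [|i s IH].
  by apply: UCb2_ext (UCb2_cst 1) _ => x; rewrite big_nil.
by apply: UCb2_ext (UCb2M (UF i) IH) _ => x; rewrite big_cons.
Qed.

End uniform_partial_derivatives.

(** * Lebesgue measure on R^d *)

Section measurability.
Context {R : realType} {d : nat}.
Local Notation V := 'rV[R]_d.

Let grid (n : nat) (x : V) : 'rV[int]_d :=
  \row_i Num.floor (x ord0 i * n.+1%:R).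

Let gridpt (n : nat) (z : 'rV[int]_d) : V := \row_i ((z ord0 i)%:~R / n.+1%:R).

Let measurable_grid n z : measurable [set x | grid n x = z].
Proof.
rewrite (_ : [set _ | _] = \bigcap_(i in [set: 'I_d])
   (fun x : V => x ord0 i) @^-1`
     [set t : R | Num.floor (t * n.+1%:R) = z ord0 i]).
  apply: fin_bigcap_measurable => // i _; rewrite -[_ @^-1` _]setTI.
  apply: (@measurable_rV_coord R d i measurableT).
  rewrite (_ : mkset _ = [set` `[(z ord0 i)%:~R / n.+1%:R, (z ord0 i + 1)%:~R / n.+1%:R[]).
    exact: measurable_itv.
  apply/seteqP; split=> t /=; rewrite in_itv /= ler_pdivrMr// ltr_pdivlMr//.
    by move=> <-; exact: floor_itv.
  exact: floor_def.
apply/seteqP; split=> x /=; first by move=> <- i _; rewrite /= mxE.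
by move=> H; apply/rowP => i; rewrite mxE; exact: H.
Qed.

(** The sigma-algebra is generated by the coordinates, so open sets are not at hand directly. A
    continuous f is the pointwise limit of its values at the lower grid points of mesh 1/(n+1), and
    each approximation takes countably many values, on measurable cells. *)
Lemma continuous_measurable_rV (f : V -> R) : continuous f -> measurable_fun setT f.
Proof.
move=> cf; apply: (@measurable_fun_cvg _ _ _ _
    (fun n x => f (gridpt n (grid n x)))) => [n _ B mB|x _].
  rewrite setTI (_ : _ @^-1` _ = \bigcup_k
     (if unpickle k is Some z then
        if f (gridpt n z) \in B then [set x | grid n x = z] else set0 else set0)).
    apply: bigcupT_measurable => k; case: unpickle => [z|]; last exact: measurable0.
    by case: ifP => _; [exact: measurable_grid|exact: measurable0].
  apply/seteqP; split=> x /=.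
    move=> Bx; exists (pickle (grid n x)) => //.
    by rewrite pickleK (mem_set Bx).
  move=> [k _]; case: unpickle => // z; case: ifP => // /set_mem Bz /= ->.
  exact: Bz.
apply: (cvg_comp (fun n => gridpt n (grid n x)) f); last exact: (cf x).
apply/(@cvgrPdist_lt _ _ _ (nbhs \oo)) => e e0; near=> n.
have n1 : (0 : R) < n.+1%:R by [].
apply: (@le_lt_trans _ _ (n.+1%:R^-1)).
  apply: normrV_le => [|i]; first by rewrite invr_ge0.
  rewrite !mxE.
  have /andP[] := floor_itv (x ord0 i * n.+1%:R); rewrite intrD => H1 H2.
  have -> : x ord0 i - (Num.floor (x ord0 i * n.+1%:R))%:~R / n.+1%:R =
    (x ord0 i * n.+1%:R - (Num.floor (x ord0 i * n.+1%:R))%:~R) / n.+1%:R.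
    by rewrite mulrBl mulfK// gt_eqF.
  rewrite normrM (ger0_norm (_ : 0 <= n.+1%:R^-1)) ?invr_ge0// ler_piMl ?invr_ge0//.
  by rewrite ger0_norm; lra.
near: n; exact: near_infty_natSinv_lt (PosNum e0).
Unshelve. all: by end_near. Qed.

Lemma UCb_measurable (f : V -> R) : UCb f -> measurable_fun setT f.
Proof. by move=> /UCb_continuous; exact: continuous_measurable_rV. Qed.

Lemma measurable_enorm : measurable_fun setT (@enorm R d).
Proof.
apply: continuous_measurable_rV => x; apply/(@cvgrPdist_le _ _ _ (nbhs x)) => e e0.
have r0 : 0 < e / (d%:R + 1) by rewrite divr_gt0// ltr_wpDl.
apply/nbhs_ballP; exists (e / (d%:R + 1)) => //= y; rewrite -ball_normE /= => xy.
rewrite (le_trans (enorm_lip _ _))// (@le_trans _ _ ((d%:R + 1) * `|x - y|))//.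
  by rewrite ler_wpM2r// lerDl.
by rewrite mulrC -ler_pdivlMr ?ltr_wpDl// ltW.
Qed.

Lemma measurable_shift (h : V) : measurable_fun setT (fun x : V => x + h).
Proof.
apply: measurable_fun_rVP => i.
rewrite (_ : (fun _ => _) = (fun x : V => x ord0 i + h ord0 i)); last first.
  by apply/funext => x; rewrite mxE.
by apply: measurable_funD; [exact: measurable_rV_coord|exact: measurable_cst].
Qed.

Lemma measurable_box (a b : V) : measurable [set x : V | forall i, a ord0 i <= x ord0 i <= b ord0 i].
Proof.
rewrite (_ : mkset _ = \bigcap_(i in [set: 'I_d])
   (fun x : V => x ord0 i) @^-1` [set` `[a ord0 i, b ord0 i]]).
  apply: fin_bigcap_measurable => // i _; rewrite -[_ @^-1` _]setTI.
  apply: (@measurable_rV_coord R d i measurableT); exact: measurable_itv.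
apply/seteqP; split=> x /=; first by move=> + i _ => /(_ i); rewrite /= in_itv.
by move=> H i; have := H i I; rewrite /= in_itv.
Qed.

Lemma lebesgue_rV_cube (c : V) (r : R) : 0 <= r ->
  lebesgue_rV d [set x : V | `|x - c| <= r] = ((2 * r) ^+ d)%:E /\
  measurable [set x : V | `|x - c| <= r].
Proof.
move=> r0.
have E : [set x : V | `|x - c| <= r] =
    [set x | forall i, (`[c ord0 i - r, c ord0 i + r]%classic) (x ord0 i)].
  apply/seteqP; split=> x /= H; last first.
    apply: normrV_le => // i; rewrite !mxE ler_norml.
    by have := H i; rewrite /= in_itv /= => /andP[? ?]; apply/andP; split; lra.
  move=> i; have := le_trans (normrV_coord (x - c) i) H; rewrite !mxE ler_norml in_itv /=.
  by move=> /andP[? ?]; apply/andP; split; lra.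
split.
  rewrite E (lebesgue_rV_box (A := fun i => `[c ord0 i - r, c ord0 i + r]%classic)); last first.
    by move=> i; exact: measurable_itv.
  rewrite (eq_bigr (fun=> (2 * r)%:E)).
    by rewrite prodEFin prodr_const card_ord.
  move=> i _; rewrite lebesgue_measure_itv /= lte_fin.
  have [H|H] := ltP; first by rewrite -EFinB; congr _%:E; ring.
  by congr _%:E; lra.
pose s : V := \row_i r.
have := measurable_box (c - s) (c + s); congr (measurable _).
rewrite E; apply/seteqP; split=> x /= H i; have := H i; rewrite /= !mxE in_itv //.
Qed.

End measurability.

Section translation_invariance.
Context {R : realType}.

Lemma lebesgue_measure_shift (h : R) (A : set (measurableTypeR R)) : measurable A ->
  lebesgue_measure ((fun x : measurableTypeR R => x + h) @^-1` A) = lebesgue_measure A.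
Proof.
have ms : measurable_fun setT ((fun x => x + h) : measurableTypeR R -> measurableTypeR R).
  by apply: measurable_funD; [exact: measurable_id|exact: measurable_cst].
move=> mA; symmetry.
pose M := measure_function_pushforward__canonical__measure_function_Measure
  (@lebesgue_measure R) ms.
rewrite [RHS](_ : _ = M A) //.
apply: (@lebesgue_measure_unique R M _ A mA) => _ [[a b] _ <-] /=.
rewrite /pushforward (_ : _ @^-1` _ = `]a - h, b - h]%classic).
  rewrite !lebesgue_measure_itv /= !lte_fin ltrD2r; case: ifPn => // _.
  by rewrite -!EFinB; congr _%:E; ring.
apply/seteqP; split=> x /=; rewrite !in_itv /= ltrBlDr lerBrDr //.
Qed.

(** Induction on the dimension: the translation acts separately on the two factors behind
    [cons_measure], and uniqueness of the product measure reduces the claim to rectangles. *)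
Lemma lebesgue_rV_shift n (h : 'rV[R]_n) (A : set 'rV[R]_n) : measurable A ->
  lebesgue_rV n ((fun x => x + h) @^-1` A) = lebesgue_rV n A.
Proof.
elim: n h A => [|n IHn] h A mA.
  by congr (lebesgue_rV 0 _); apply/seteqP; split=> x; rewrite /= [x + h]thinmx0 [x]thinmx0.
pose m1 := @lebesgue_measure R; pose m := @lebesgue_rV R n.
pose h' : 'rV[R]_n := \row_j h ord0 (lift ord0 j).
pose s (p : measurableTypeR R * 'rV[R]_n) := (p.1 + h ord0 ord0 : measurableTypeR R, p.2 + h').
have ms : measurable_fun setT s.
  apply/measurable_fun_pairP; split.
    by apply: measurable_funD; [exact: measurable_fst|exact: measurable_cst].
  exact: measurableT_comp (measurable_shift h') measurable_snd.
pose M := measure_function_pushforward__canonical__measure_function_Measure (m1 \x m)%E ms.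
have HM X : measurable X -> (m1 \x m)%E X = M X.
  apply: product_measure_unique => B C mB mC.
  rewrite [LHS](_ : _ = (m1 \x m)%E (((fun x : measurableTypeR R => x + h ord0 ord0) @^-1` B)
    `*` ((fun x => x + h') @^-1` C))) //.
  rewrite product_measure1E.
  - by congr (_ * _)%E; [exact: lebesgue_measure_shift|exact: IHn].
  - rewrite -[_ @^-1` _]setTI.
    suff : measurable_fun setT (fun x : measurableTypeR R => x + h ord0 ord0) by apply.
    by apply: measurable_funD; [exact: measurable_id|exact: measurable_cst].
  - by rewrite -[_ @^-1` _]setTI; exact: measurable_shift.
rewrite /= /cons_measure /pushforward -/m1 -/m.
have mcA : measurable ((@cons_rV R n) @^-1` A).
  by rewrite -[_ @^-1` _]setTI; exact: measurable_cons_rV.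
rewrite (HM _ mcA) /M /= /pushforward; congr ((m1 \x m)%E _).
apply/seteqP; split=> -[a v] /=; congr A; apply/rowP => i; rewrite !mxE /=;
  by case: (unliftP ord0 i) => [j ->|->]; rewrite ?liftK ?unlift_none ?mxE.
Qed.

End translation_invariance.

(** * Integrals of powers of |y| by dyadic shells *)

Section integration_on_rV.
Context {R : realType} {d : nat}.
Local Notation V := 'rV[R]_d.
Local Notation leb := (@lebesgue_rV R d).
Implicit Types (f g : V -> R).

Definition integrable_rV f := leb.-integrable setT (EFin \o f).

Lemma Rintegral_rV_bound f (S : R) : measurable_fun setT f -> 0 <= S ->
  (\int[leb]_y `|f y|%:E <= S%:E)%E -> integrable_rV f /\ `|\int[leb]_y f y| <= S.
Proof.
move=> mf S0 fS.
have If : integrable_rV f.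
  apply/integrableP; split; first exact/measurable_EFinP.
  by apply: le_lt_trans fS _; exact: ltry.
split=> //; rewrite -lee_fin (le_trans _ fS)//.
apply: le_trans (_ : (`|\int[leb]_y (f y)%:E| <= _)%E).
  by rewrite /Rintegral -[leLHS]/(`|(fine _)%:E|%E) fineK//; exact: integrable_fin_num.
by apply: le_abse_integral => //; exact/measurable_EFinP.
Qed.

Lemma lebesgue_rV_cube0 (r : R) : 0 <= r ->
  leb [set x : V | `|x| <= r] = ((2 * r) ^+ d)%:E /\ measurable [set x : V | `|x| <= r].
Proof. by move=> r0; have := lebesgue_rV_cube (0 : V) r0; under eq_set do rewrite subr0. Qed.

(** This plays the part of polar coordinates: f is dominated by the sum of the c_k times the
    indicators of the cubes |y| <= r_k, and the sum is integrated term by term. *)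
Lemma integral_le_shells f (c r : nat -> R) (S : R) : measurable_fun setT f ->
  (forall y, 0 <= f y) -> (forall k, 0 <= c k) -> (forall k, 0 <= r k) ->
  (forall y, 0 < f y -> exists k, `|y| <= r k /\ f y <= c k) ->
  (forall n, \sum_(k < n) c k * (2 * r k) ^+ d <= S) ->
  (\int[leb]_y (f y)%:E <= S%:E)%E.
Proof.
move=> mf f0 c0 r0 H HS.
have mr k : measurable [set x : V | `|x| <= r k].
  by have [] := lebesgue_rV_cube0 (r0 k).
pose F k (y : V) : \bar R := (c k * \1_[set x : V | `|x| <= r k] y)%:E.
have mF k : measurable_fun setT (F k).
  apply/measurable_EFinP; apply: measurable_funM => //.
have F0 k y : (0 <= F k y)%E by rewrite lee_fin mulr_ge0.
apply: (@le_trans _ _ (\int[leb]_y (\sum_(0 <= k <oo) F k y))%E).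
  apply: ge0_le_integral => //.
  - by move=> y _; rewrite lee_fin.
  - exact/measurable_EFinP.
  - by apply: ge0_emeasurable_sum => //.
  move=> y _; have [fy|fy] := leP (f y) 0.
    by rewrite (le_trans (_ : _ <= 0%E)%E) ?lee_fin// nneseries_ge0.
  have [k [yk fk]] := H y fy.
  apply: le_trans (_ : (\sum_(0 <= i < k.+1) F i y <= _)%E).
    rewrite big_nat_recr//= (@le_trans _ _ (F k y))//.
      by rewrite lee_fin indicE mem_set// mulr1.
    by rewrite leeDr// sume_ge0.
  exact: nneseries_lim_ge.
rewrite integral_nneseries//.
apply: lime_le.
  by apply: is_cvg_nneseries => n _ _; apply: integral_ge0 => y _; exact: F0.
apply: nearW => n; rewrite (eq_bigr (fun k => (c k * (2 * r k) ^+ d)%:E)).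
  by rewrite sumEFin lee_fin big_mkord.
move=> k _; rewrite /F; under eq_integral do rewrite EFinM.
rewrite ge0_integralZl//; last 2 first.
- by apply/measurable_EFinP.
- by rewrite lee_fin.
rewrite integral_indic// setIT EFinM; congr (_ * _)%E.
by have [<- _] := lebesgue_rV_cube0 (r0 k).
Qed.

Lemma geometric_partial_sum_le (a x : R) n : 0 <= a -> 0 <= x < 1 ->
  \sum_(k < n) a * x ^+ k <= a / (1 - x).
Proof.
move=> a0 /andP[x0 x1]; have p : 0 < 1 - x by lra.
rewrite -mulr_sumr ler_wpM2l// -[leRHS]mul1r ler_pdivlMr// mulrC.
have := subrX1 x n; have : 0 <= x ^+ n by rewrite exprn_ge0.
set s := \sum_(i < n) _ => ? ?; nra.
Qed.

Lemma powR_nat_mul (x : R) (p : R) (k : nat) : 0 <= x -> (x ^+ k) `^ p = (x `^ p) ^+ k.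
Proof. move=> x0; rewrite -(powR_mulrn k x0) -(powR_mulrn k (powR_ge0 x p)).
by rewrite -!powRrM mulrC. Qed.

Lemma exp2_gt (x : R) : exists k : nat, x < 2 ^+ k.+1.
Proof.
have [k hk] : exists k : nat, `|x| < k%:R.
  by exists (Num.Def.archi_bound `|x|); apply: archi_boundP.
exists k; rewrite (le_lt_trans (ler_norm x))// (lt_le_trans hk)// -natrX ler_nat.
by rewrite (leq_trans (ltnW (ltn_expl k (isT : (1 < 2)%N))))// leq_exp2l.
Qed.

Lemma dyadic_shell_gt (r n : R) : 0 < r -> r < n ->
  exists k, 2 ^+ k * r < n <= 2 ^+ k.+1 * r.
Proof.
move=> r0 rn.
have ex : exists k : nat, n <= 2 ^+ k.+1 * r.
  by have [k hk] := exp2_gt (n / r); exists k; rewrite -ler_pdivrMr// ltW.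
have := ex_minnP ex => -[k hk kmin]; exists k; rewrite hk andbT.
case: k hk kmin => [|k] hk kmin; first by rewrite expr0 mul1r.
by rewrite ltNge; apply/negP => /kmin; rewrite ltnn.
Qed.

Lemma dyadic_shell_le (r n : R) : 0 < r -> 0 < n <= r ->
  exists k, 2^-1 ^+ k.+1 * r < n <= 2^-1 ^+ k * r.
Proof.
move=> r0 /andP[n0 nr].
have ex : exists k : nat, 2^-1 ^+ k.+1 * r < n.
  have [k hk] := exp2_gt (r / n); exists k.
  by rewrite exprVn mulrC ltr_pdivrMr ?exprn_gt0// -ltr_pdivrMl// mulrC.
have := ex_minnP ex => -[k hk kmin]; exists k; rewrite hk /=.
case: k hk kmin => [|k] hk kmin; first by rewrite expr0 mul1r.
by rewrite leNgt; apply/negP => /kmin; rewrite ltnn.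
Qed.

(** The weight |y|^(-p), with default value 0 at the origin when p is nonzero. *)
Definition ipow (p : R) (y : V) : R := (enorm y `^ p)^-1.

Lemma ipow_ge0 p y : 0 <= ipow p y.
Proof. by rewrite invr_ge0 powR_ge0. Qed.

Lemma measurable_ipow p : measurable_fun setT (ipow p).
Proof.
have -> : ipow p = (fun t : R => (t `^ (- p))) \o @enorm R d.
  by apply/funext => y; rewrite /ipow /= powRN.
by apply: measurableT_comp; [exact: measurable_powR|exact: measurable_enorm].
Qed.

Lemma ipow_le (p a : R) y : 0 <= p -> 0 < a -> a <= `|y| -> ipow p y <= a `^ (- p).
Proof.
move=> p0 a0 ay; have ae := le_trans ay (normrV_le_enorm y).
rewrite /ipow powRN lef_pV2 ?posrE ?powR_gt0//; last exact: lt_le_trans ae.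
by rewrite ge0_ler_powR// nnegrE; [exact: ltW|exact: enorm_ge0].
Qed.

Let powR_shell (gamma q : R) : 0 < q -> q `^ (- (d%:R + gamma)) * (4 * q) ^+ d = 4 ^+ d * q `^ (- gamma).
Proof.
move=> q0; rewrite opprD powRD; last by rewrite (gt_eqF q0) implybT.
rewrite (powRN q d%:R) powR_mulrn ?(ltW q0)// exprMn mulrCA; congr (_ * _).
by rewrite mulrAC mulVf ?mul1r// expf_neq0// gt_eqF.
Qed.

Let halfpow (b : R) : 2 `^ (- b) = (2^-1 : R) `^ b.
Proof. by rewrite -powR_inv1// -powRrM mulN1r. Qed.

(** On the shell 2^k r < |y| <= 2^(k+1) r the weight is at most (2^k r)^(-d-gamma), and the
    enclosing cube has volume (4 * 2^k r)^d. The contributions form a geometric series of ratio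
    2^(-gamma). *)
Lemma integral_ipow_far (gamma : R) : 0 < gamma -> exists2 K, 0 < K & forall r, 0 < r ->
  (\int[leb]_y (ipow (d%:R + gamma) y * \1_[set x : V | r < `|x|] y)%:E
     <= (K * r `^ (- gamma))%:E)%E.
Proof.
move=> g0; pose x := (2^-1 : R) `^ gamma.
have p0 : 0 <= d%:R + gamma by rewrite addr_ge0// ltW.
have x01 : 0 <= x < 1.
  by rewrite powR_ge0/= (lt_le_trans (gt0_ltr_powR g0 _ _ (_ : _ < 1))) ?powR1// ?nnegrE; lra.
exists (4 ^+ d / (1 - x)); first by rewrite divr_gt0 ?exprn_gt0//; lra.
move=> r r0.
have mc : measurable [set x : V | `|x| <= r].
  by have [] := lebesgue_rV_cube0 (ltW r0).
have mB : measurable [set x : V | r < `|x|].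
  rewrite (_ : mkset _ = ~` [set x : V | `|x| <= r]); first exact: measurableC.
  by apply/seteqP; split=> y /=; [rewrite ltNge => /negP|move/negP; rewrite -ltNge].
apply: (@integral_le_shells _ (fun k => (2 ^+ k * r) `^ (- (d%:R + gamma))) (fun k => 2 ^+ k.+1 * r)).
- apply: measurable_funM; [exact: measurable_ipow|exact: measurable_indic].
- by move=> y; rewrite mulr_ge0 ?ipow_ge0.
- by move=> k; exact: powR_ge0.
- by move=> k; rewrite mulr_ge0// ?exprn_ge0// ltW.
- move=> y; have [ry|yr] := ltP r `|y|; last first.
    by rewrite indicE memNset /= ?mulr0 ?ltxx//; apply/negP; rewrite -leNgt.
  move=> _; have [k /andP[k1 k2]] := dyadic_shell_gt r0 ry; exists k; split=> //.
  rewrite indicE mem_set// mulr1; apply: ipow_le => //; last exact: ltW.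
  by rewrite mulr_gt0// exprn_gt0.
- move=> n; rewrite mulrAC.
  apply: le_trans (geometric_partial_sum_le n _ x01); last first.
    by rewrite mulr_ge0 ?powR_ge0// exprn_ge0.
  apply: ler_sum => k _.
  have p2 : (0 : R) < 2 ^+ k by rewrite exprn_gt0.
  have q0 : 0 < 2 ^+ k * r by rewrite mulr_gt0.
  have -> : 2 * (2 ^+ k.+1 * r) = 4 * (2 ^+ k * r) by rewrite exprS; ring.
  rewrite powR_shell// -mulrA ler_wpM2l ?exprn_ge0//.
  by rewrite powRM ?(ltW p2) ?(ltW r0)// mulrC powR_nat_mul// halfpow.
Qed.

(** The same series over shells shrinking to the origin, now of ratio 2^gamma < 1. The inner radius
    carries the index k+1, whence the additional factor x in the constant. *)
Lemma integral_ipow_near (gamma : R) : gamma < 0 -> 0 <= d%:R + gamma ->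
  exists2 K, 0 < K & forall r, 0 < r ->
  (\int[leb]_y (ipow (d%:R + gamma) y * \1_[set x : V | (0 < `|x| <= r)%R] y)%:E
     <= (K * r `^ (- gamma))%:E)%E.
Proof.
move=> g0 p0; pose x := (2^-1 : R) `^ (- gamma).
have x01 : 0 <= x < 1.
  by rewrite powR_ge0/= (lt_le_trans (@gt0_ltr_powR _ (- gamma) _ _ 1 _ _ _)) ?powR1// ?nnegrE; lra.
exists (4 ^+ d * x / (1 - x)).
  by rewrite divr_gt0 ?mulr_gt0 ?exprn_gt0 ?powR_gt0//; lra.
move=> r r0.
have mc s : 0 <= s -> measurable [set x : V | `|x| <= s].
  by move=> s0; have [] := lebesgue_rV_cube0 s0.
have mB : measurable [set x : V | (0 < `|x| <= r)%R].
  rewrite (_ : mkset _ = [set x : V | `|x| <= r] `\` [set x : V | `|x| <= 0]).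
    by apply: measurableD; apply: mc; rewrite // ltW.
  apply/seteqP; split=> y /=.
    by move=> /andP[H1 H2]; split=> //; apply/negP; rewrite -ltNge.
  by move=> [H1 /negP]; rewrite -ltNge => -> .
apply: (@integral_le_shells _ (fun k => (2^-1 ^+ k.+1 * r) `^ (- (d%:R + gamma))) (fun k => 2^-1 ^+ k * r)).
- apply: measurable_funM; [exact: measurable_ipow|exact: measurable_indic].
- by move=> y; rewrite mulr_ge0 ?ipow_ge0.
- by move=> k; exact: powR_ge0.
- by move=> k; rewrite mulr_ge0// ?exprn_ge0// ltW.
- move=> y; have [ry|/negP yr] := boolP (0 < `|y| <= r); last first.
    by rewrite indicE memNset// mulr0 ltxx.
  move=> _; have [k /andP[k1 k2]] := dyadic_shell_le r0 ry; exists k; split=> //.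
  rewrite indicE mem_set// mulr1; apply: ipow_le => //; last exact: ltW.
  by rewrite mulr_gt0// exprn_gt0.
- move=> n; rewrite mulrAC.
  apply: le_trans (geometric_partial_sum_le n _ x01); last first.
    by rewrite !mulr_ge0 ?powR_ge0// exprn_ge0.
  apply: ler_sum => k _.
  have p2 : (0 : R) < 2^-1 ^+ k.+1 by rewrite exprn_gt0.
  have q0 : 0 < 2^-1 ^+ k.+1 * r by rewrite mulr_gt0.
  have -> : 2 * (2^-1 ^+ k * r) = 4 * (2^-1 ^+ k.+1 * r) by rewrite exprS; field.
  rewrite powR_shell// -!mulrA ler_wpM2l ?exprn_ge0//.
  by rewrite powRM ?(ltW p2) ?(ltW r0)// powR_nat_mul// -/x exprS -mulrA ler_wpM2l ?powR_ge0// mulrC.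
Qed.

End integration_on_rV.

(** * Bump functions and mollification *)

Section bump_line.
Context {R : realType}.
Implicit Types s t h c : R.

Let clamp s : R := Num.max (-1) (Num.min s 1).

Let clampP s : (s < -1 /\ clamp s = -1) \/ (-1 <= s <= 1 /\ clamp s = s) \/
  (1 < s /\ clamp s = 1).
Proof.
rewrite /clamp; case: (ltP s (-1)) => h1.
  by left; split=> //; rewrite min_l ?max_l//; lra.
case: (leP s 1) => h2; last by right; right; split=> //; rewrite ?max_r//; lra.
by right; left; split; [lra|rewrite max_r].
Qed.

Let clamp_itv s : -1 <= clamp s <= 1.
Proof. by case: (clampP s) => [|[]] [? ->]; lra. Qed.

Let clamp_lip s t : `|clamp s - clamp t| <= `|s - t|.
Proof.
have [st|st] := leP t s; [rewrite [leRHS]ger0_norm|rewrite [leRHS]ltr0_norm]; try lra;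
case: (clampP s) => [|[]] [? ->]; case: (clampP t) => [|[]] [? ->];
rewrite ler_norml; lra.
Qed.

(** The function (1 - s^2)^3 on [-1, 1], extended by 0. The exponent 3 is the least one for which
    the second derivative is continuous at the end points; clamping leaves one polynomial formula
    for the whole line. *)
Definition bump1 s : R := (1 - clamp s ^+ 2) ^+ 3.
Definition bump1' s : R := -6 * clamp s * (1 - clamp s ^+ 2) ^+ 2.
Definition bump1'' s : R :=
  -6 * (1 - clamp s ^+ 2) ^+ 2 + 24 * clamp s ^+ 2 * (1 - clamp s ^+ 2).

Let sq_itv c : -1 <= c <= 1 -> 0 <= 1 - c ^+ 2 <= 1.
Proof. by move=> /andP[? ?]; have := sqr_ge0 c; nra. Qed.

Lemma bump1_itv s : 0 <= bump1 s <= 1.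
Proof.
have /andP[? ?] := sq_itv (clamp_itv s).
by rewrite exprn_ge0//= exprn_ile1.
Qed.

Lemma bump1_out s : 1 <= `|s| -> bump1 s = 0.
Proof.
move=> h; suff : clamp s ^+ 2 = 1 by rewrite /bump1 => ->; ring.
by case: (clampP s) => [|[]] [? ->]; rewrite ?sqrrN ?expr1n//;
  apply/eqP; rewrite sqrf_eq1; move: h; rewrite ler_normr; lra.
Qed.

Lemma bump1_in s : `|s| <= 2^-1 -> 4^-1 <= bump1 s.
Proof.
rewrite ler_norml => h; have -> : bump1 s = (1 - s ^+ 2) ^+ 3.
  by rewrite /bump1; case: (clampP s) => [|[]] [? ->] //; lra.
have h1 : 3 / 4 <= 1 - s ^+ 2 by nra.
by apply: le_trans (_ : (3 / 4) ^+ 3 <= _); [lra|rewrite lerXn2r// nnegrE; lra].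
Qed.

Lemma bump1_0 : bump1 0 = 1.
Proof. by rewrite /bump1 /clamp min_l// max_r ?expr0n/= ?subr0 ?expr1n//; lra. Qed.

(* [P1] vanishes at the end points, so clamping keeps [P] differentiable. *)
Let comp_clamp (P P1 : R -> R) (K : R) : 0 <= K ->
  (forall c c', -1 <= c <= 1 -> -1 <= c' <= 1 ->
     `|P c' - P c - (c' - c) * P1 c| <= K * (c' - c) ^+ 2) ->
  (forall c, -1 <= c <= 1 -> `|P1 c| <= K * (1 - c ^+ 2)) ->
  forall s h, `|P (clamp (s + h)) - P (clamp s) - h * P1 (clamp s)| <= 3 * K * h ^+ 2.
Proof.
move=> K0 A B s h; set c := clamp s; set c' := clamp (s + h).
have -> : P c' - P c - h * P1 c =
  (P c' - P c - (c' - c) * P1 c) + (c' - c - h) * P1 c by ring.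
have -> : 3 * K * h ^+ 2 = K * h ^+ 2 + 2 * K * h ^+ 2 by ring.
rewrite (le_trans (ler_normD _ _))// lerD//.
  apply: (le_trans (A _ _ (clamp_itv s) (clamp_itv (s + h)))).
  rewrite ler_wpM2l//.
  have := clamp_lip (s + h) s; rewrite addrAC subrr add0r -/c -/c' => H.
  by rewrite -(real_normK (num_real (c' - c))) -(real_normK (num_real h)) lerXn2r// nnegrE.
rewrite normrM; apply: le_trans (_ : `|c' - c - h| * (K * (1 - c ^+ 2)) <= _).
  by rewrite ler_wpM2l// B// clamp_itv.
rewrite mulrCA -[2 * K]mulrC -mulrA ler_wpM2l//.
rewrite /c /c'; case: (clampP s) => [|[]] [hs ->]; rewrite ?sqrrN ?expr1n ?subrr ?mulr0//.
- by have := sqr_ge0 h; lra.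
- case: (clampP (s + h)) => [|[]] [hh ->].
  + rewrite ger0_norm; last by lra.
    have /andP[? ?] := hs; have e1 : 1 - s ^+ 2 <= 2 * (- h) by nra.
    have e2 : 0 <= 1 - s ^+ 2 by nra.
    apply: le_trans (_ : (- h) * (2 * (- h)) <= _); last by rewrite le_eqVlt; apply/orP; left; apply/eqP; ring.
    by apply: ler_pM => //; lra.
  + by rewrite (_ : s + h - s - h = 0) ?normr0 ?mul0r; [have := sqr_ge0 h; lra|ring].
  + rewrite ler0_norm; last by lra.
    have /andP[? ?] := hs; have e1 : 1 - s ^+ 2 <= 2 * h by nra.
    have e2 : 0 <= 1 - s ^+ 2 by nra.
    apply: le_trans (_ : h * (2 * h) <= _); last by rewrite le_eqVlt; apply/orP; left; apply/eqP; ring.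
    by apply: ler_pM => //; lra.
- by have := sqr_ge0 h; lra.
Qed.

Lemma bump1_taylor s h : `|bump1 (s + h) - bump1 s - h * bump1' s| <= 45 * h ^+ 2.
Proof.
have -> : 45 * h ^+ 2 = 3 * 15 * h ^+ 2 by ring.
apply: (@comp_clamp (fun c => (1 - c ^+ 2) ^+ 3) (fun c => -6 * c * (1 - c ^+ 2) ^+ 2)) => //.
  move=> c c' cI c'I; have /andP[a0 a1] := sq_itv cI; have /andP[b0 b1] := sq_itv c'I.
  (* The Taylor remainder is exactly a polynomial times (c' - c)^2, so that only the size of this
     polynomial on [-1, 1]^2 is left to estimate. *)
  have -> : (1 - c' ^+ 2) ^+ 3 - (1 - c ^+ 2) ^+ 3 - (c' - c) * (-6 * c * (1 - c ^+ 2) ^+ 2) =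
    ((c' + c) ^+ 2 * ((1 - c' ^+ 2) + 2 * (1 - c ^+ 2)) - 3 * (1 - c ^+ 2) ^+ 2) * (c' - c) ^+ 2.
    by ring.
  rewrite normrM [X in _ * X]ger0_norm ?sqr_ge0// ler_wpM2r ?sqr_ge0//.
  set a := 1 - c ^+ 2 in a0 a1 *; set b := 1 - c' ^+ 2 in b0 b1 *.
  have e4 : 0 <= (c' + c) ^+ 2 <= 4 by have := sqr_ge0 (c' + c); nra.
  move: e4; set e := (c' + c) ^+ 2 => /andP[e0 e4].
  have a2 : 0 <= a ^+ 2 <= 1 by have := sqr_ge0 a; nra.
  by rewrite ler_norml; nra.
move=> c cI; have /andP[a0 a1] := sq_itv cI.
rewrite expr2 mulrA normrM [X in _ * X]ger0_norm// ler_wpM2r//.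
rewrite ler_norml; nra.
Qed.

Lemma bump1'_taylor s h : `|bump1' (s + h) - bump1' s - h * bump1'' s| <= 180 * h ^+ 2.
Proof.
have -> : 180 * h ^+ 2 = 3 * 60 * h ^+ 2 by ring.
apply: (@comp_clamp (fun c => -6 * c * (1 - c ^+ 2) ^+ 2)
  (fun c => -6 * (1 - c ^+ 2) ^+ 2 + 24 * c ^+ 2 * (1 - c ^+ 2))) => //.
  move=> c c' cI c'I; have /andP[a0 a1] := sq_itv cI; have /andP[b0 b1] := sq_itv c'I.
  have -> : -6 * c' * (1 - c' ^+ 2) ^+ 2 - -6 * c * (1 - c ^+ 2) ^+ 2 -
     (c' - c) * (-6 * (1 - c ^+ 2) ^+ 2 + 24 * c ^+ 2 * (1 - c ^+ 2)) =
    (-6 * (- ((c + c') * ((1 - c ^+ 2) + (1 - c' ^+ 2))) +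
           c * (- 2 * (1 - c ^+ 2) + (c + c') ^+ 2))) * (c' - c) ^+ 2 by ring.
  rewrite normrM [X in _ * X]ger0_norm ?sqr_ge0// ler_wpM2r ?sqr_ge0//.
  set a := 1 - c ^+ 2 in a0 a1 *; set b := 1 - c' ^+ 2 in b0 b1 *.
  have e4 : 0 <= (c + c') ^+ 2 <= 4 by have := sqr_ge0 (c' + c); nra.
  move: e4; set e := (c + c') ^+ 2 => /andP[e0 e4].
  have h1 : -4 <= (c + c') * (a + b) <= 4 by apply/andP; split; nra.
  have h2 : -6 <= c * (- 2 * a + e) <= 6 by apply/andP; split; nra.
  by rewrite ler_norml; move: h1 h2 => /andP[? ?] /andP[? ?]; apply/andP; split; lra.
move=> c cI; have /andP[a0 a1] := sq_itv cI.
have -> : -6 * (1 - c ^+ 2) ^+ 2 + 24 * c ^+ 2 * (1 - c ^+ 2) =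
  (-6 * (1 - c ^+ 2) + 24 * c ^+ 2) * (1 - c ^+ 2) by ring.
rewrite normrM [X in _ * X]ger0_norm// ler_wpM2r//.
by rewrite ler_norml; apply/andP; split; lra.
Qed.

Let comp_clamp_lip (P : R -> R) K : 0 <= K ->
  (forall c c', -1 <= c <= 1 -> -1 <= c' <= 1 -> `|P c' - P c| <= K * `|c' - c|) ->
  forall s t, `|P (clamp s) - P (clamp t)| <= K * `|s - t|.
Proof.
move=> K0 H s t; apply: (le_trans (H _ _ (clamp_itv t) (clamp_itv s))).
by rewrite ler_wpM2l.
Qed.

Lemma bump1_lip s t : `|bump1 s - bump1 t| <= 6 * `|s - t|.
Proof.
apply: (@comp_clamp_lip (fun c => (1 - c ^+ 2) ^+ 3)) => // c c' cI c'I.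
have /andP[a0 a1] := sq_itv cI; have /andP[b0 b1] := sq_itv c'I.
have -> : (1 - c' ^+ 2) ^+ 3 - (1 - c ^+ 2) ^+ 3 =
  (- (c + c') * ((1 - c' ^+ 2) ^+ 2 + (1 - c' ^+ 2) * (1 - c ^+ 2) + (1 - c ^+ 2) ^+ 2)) * (c' - c).
  by ring.
rewrite normrM ler_wpM2r//.
set a := 1 - c ^+ 2 in a0 a1 *; set b := 1 - c' ^+ 2 in b0 b1 *.
have h1 : 0 <= b ^+ 2 + b * a + a ^+ 2 <= 3.
  by have ? := sqr_ge0 a; have ? := sqr_ge0 b; apply/andP; split; nra.
move: h1; set e := b ^+ 2 + b * a + a ^+ 2 => /andP[? ?]; rewrite ler_norml; apply/andP; split; nra.
Qed.

Lemma bump1'_lip s t : `|bump1' s - bump1' t| <= 30 * `|s - t|.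
Proof.
apply: (@comp_clamp_lip (fun c => -6 * c * (1 - c ^+ 2) ^+ 2)) => // c c' cI c'I.
have /andP[a0 a1] := sq_itv cI; have /andP[b0 b1] := sq_itv c'I.
have -> : -6 * c' * (1 - c' ^+ 2) ^+ 2 - -6 * c * (1 - c ^+ 2) ^+ 2 =
  (-6 * (1 - c' ^+ 2) ^+ 2 + 6 * c * (c + c') * ((1 - c' ^+ 2) + (1 - c ^+ 2))) * (c' - c).
  by ring.
rewrite normrM ler_wpM2r//.
set a := 1 - c ^+ 2 in a0 a1 *; set b := 1 - c' ^+ 2 in b0 b1 *.
have h1 : 0 <= b ^+ 2 <= 1 by have ? := sqr_ge0 b; apply/andP; split; nra.
have h2 : -2 <= c * (c + c') <= 2 by apply/andP; split; nra.
rewrite -[6 * c * _]mulrA; move: h2; set e := c * _ => /andP[? ?].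
rewrite -[6 * e * _]mulrA.
have h3 : -4 <= e * (b + a) <= 4 by apply/andP; split; nra.
by rewrite ler_norml; move: h1 h3 => /andP[? ?] /andP[? ?]; apply/andP; split; lra.
Qed.

Lemma bump1''_lip s t : `|bump1'' s - bump1'' t| <= 120 * `|s - t|.
Proof.
apply: (@comp_clamp_lip
  (fun c => -6 * (1 - c ^+ 2) ^+ 2 + 24 * c ^+ 2 * (1 - c ^+ 2))) => // c c' cI c'I.
have /andP[a0 a1] := sq_itv cI; have /andP[b0 b1] := sq_itv c'I.
have -> : -6 * (1 - c' ^+ 2) ^+ 2 + 24 * c' ^+ 2 * (1 - c' ^+ 2) -
  (-6 * (1 - c ^+ 2) ^+ 2 + 24 * c ^+ 2 * (1 - c ^+ 2)) =
  ((c + c') * (30 * ((1 - c' ^+ 2) + (1 - c ^+ 2)) - 24)) * (c' - c).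
  by ring.
rewrite normrM ler_wpM2r// ler_norml; apply/andP; split; nra.
Qed.

Lemma bump1'_bound s : `|bump1' s| <= 6.
Proof.
have /andP[c0 c1] := clamp_itv s; have /andP[a0 a1] := sq_itv (clamp_itv s).
rewrite /bump1'; set c := clamp s in c0 c1 a0 a1 *; set a := 1 - c ^+ 2 in a0 a1 *.
have h1 : 0 <= a ^+ 2 <= 1 by have ? := sqr_ge0 a; apply/andP; split; nra.
by rewrite ler_norml; apply/andP; split; nra.
Qed.

Lemma bump1''_bound s : `|bump1'' s| <= 30.
Proof.
have /andP[c0 c1] := clamp_itv s; have /andP[a0 a1] := sq_itv (clamp_itv s).
rewrite /bump1''; set c := clamp s in c0 c1 a0 a1 *.
have -> : c ^+ 2 = 1 - (1 - c ^+ 2) by ring.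
set a := 1 - c ^+ 2 in a0 a1 *.
by rewrite subKr ler_norml; apply/andP; split; nra.
Qed.

End bump_line.

Section bump.
Context {R : realType} {d : nat}.
Local Notation V := 'rV[R]_d.
Implicit Types (x y c v : V) (rho : R).

Let coord_lip (F : R -> R) i (a rho K B : R) : 0 < rho -> 0 <= K ->
  (forall s t, `|F s - F t| <= K * `|s - t|) -> (forall s, `|F s| <= B) ->
  UCb (fun x => F ((x ord0 i - a) / rho)).
Proof.
move=> rho0 K0 lF bF; apply/UCbP; split; first by exists B.
move=> e e0; exists (e * rho / (K + 1)) => [|x h hr].
  by rewrite divr_gt0 ?mulr_gt0// ltr_wpDl.
rewrite (le_trans (lF _ _))//.
have -> : (((x + h) ord0 i - a) / rho - (x ord0 i - a) / rho) = h ord0 i / rho.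
  by rewrite mxE; field; rewrite gt_eqF.
rewrite normrM normfV (gtr0_norm rho0) mulrA ler_pdivrMr//.
have hi := le_lt_trans (normrV_coord h i) hr.
apply: le_trans (_ : (K + 1) * `|h ord0 i| <= _); first by rewrite ler_wpM2r// lerDl.
by move: hi; rewrite ltr_pdivlMr ?ltr_wpDl// mulrC => /ltW.
Qed.

Let coord_derive (F F1 : R -> R) i (a rho C : R) v : 0 < rho -> 0 <= C ->
  (forall s h, `|F (s + h) - F s - h * F1 s| <= C * h ^+ 2) ->
  unif_derive v (fun x => F ((x ord0 i - a) / rho))
    (fun x => v ord0 i / rho * F1 ((x ord0 i - a) / rho)).
Proof.
move=> rho0 C0 H e e0; set w := v ord0 i / rho.
have p : 0 < C * w ^+ 2 + 1 by rewrite ltr_wpDl// mulr_ge0// sqr_ge0.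
exists (e / (C * w ^+ 2 + 1)) => [|x h hr]; first exact: divr_gt0.
have -> : ((x + h *: v) ord0 i - a) / rho = (x ord0 i - a) / rho + h * w.
  by rewrite /w !mxE; field; rewrite gt_eqF.
rewrite mulrA; apply: le_trans (H _ _) _.
have -> : C * (h * w) ^+ 2 = (C * w ^+ 2 * `|h|) * `|h|.
  rewrite exprMn -(real_normK (num_real h)); ring.
rewrite ler_wpM2r//; apply: le_trans (_ : (C * w ^+ 2 + 1) * `|h| <= _).
  by rewrite ler_wpM2r// lerDl.
by rewrite mulrC -ler_pdivlMr// ltW.
Qed.

Let UCb2_coord i (a rho : R) : 0 < rho ->
  UCb2 (fun x => bump1 ((x ord0 i - a) / rho)).
Proof.
move=> rho0; apply/UCb2P; split.
  apply: (@coord_lip _ _ _ _ 6 1) => //; first exact: bump1_lip.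
  by move=> s; have /andP[? ?] := bump1_itv s; rewrite ger0_norm.
pose w (j : 'I_d) : R := (delta_mx ord0 j : V) ord0 i / rho.
have U1 : UCb (fun x => bump1' ((x ord0 i - a) / rho)).
  by apply: (@coord_lip _ _ _ _ 30 6) => //; [exact: bump1'_lip|exact: bump1'_bound].
have U2 : UCb (fun x => bump1'' ((x ord0 i - a) / rho)).
  by apply: (@coord_lip _ _ _ _ 120 30) => //; [exact: bump1''_lip|exact: bump1''_bound].
exists (fun j x => w j * bump1' ((x ord0 i - a) / rho)),
  (fun j k x => w j * (w k * bump1'' ((x ord0 i - a) / rho))).
split=> [j|j|j k|j k].
- exact: UCbZ.
- by apply: (@coord_derive _ _ _ _ _ 45) => //; exact: bump1_taylor.
- by apply: UCbZ; exact: UCbZ.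
- have := @unif_derive_lin R d (delta_mx ord0 k) (w j) _ _ _ _
    (coord_derive i a (delta_mx ord0 k) rho0 (_ : 0 <= 180) bump1'_taylor)
    (unif_derive_cst _ 0).
  by move=> /(_ (ler0n _ _)); congr unif_derive; apply/funext => x; rewrite addr0.
Qed.

(** A product of one-variable bumps suits the max norm: the support is the cube of half side rho
    about c. *)
Definition cubic_bump c rho y : R := \prod_(i < d) bump1 ((y ord0 i - c ord0 i) / rho).

Lemma UCb2_cubic_bump c rho : 0 < rho -> UCb2 (cubic_bump c rho).
Proof. by move=> rho0; apply: UCb2_prod => i; exact: UCb2_coord. Qed.

Lemma bump_itv c rho y : 0 <= cubic_bump c rho y <= 1.
Proof.
apply/andP; split; first by apply: prodr_ge0 => i _; have /andP[] := bump1_itv ((y ord0 i - c ord0 i) / rho).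
by apply: prodr_ile1 => i _; exact: bump1_itv.
Qed.

Lemma bump_center c rho : cubic_bump c rho c = 1.
Proof. by rewrite /cubic_bump big1// => i _; rewrite subrr mul0r bump1_0. Qed.

Lemma bump_out c rho y : 0 < rho -> rho <= `|y - c| -> cubic_bump c rho y = 0.
Proof.
move=> rho0 h; have [i hi] : exists i, rho <= `|(y - c) ord0 i|.
  apply: contrapT => /forallNP H; move: h; rewrite leNgt => /negP; apply.
  by apply: normrV_lt => // i; rewrite ltNge; apply/negP; exact: H.
rewrite /cubic_bump (bigD1 i)//= bump1_out ?mul0r//.
by rewrite normrM normfV (gtr0_norm rho0) ler_pdivlMr// mul1r; rewrite !mxE in hi.
Qed.

Lemma bump_in c rho y : 0 < rho -> `|y - c| <= rho / 2 -> 4^-1 ^+ d <= cubic_bump c rho y.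
Proof.
move=> rho0 h; rewrite /cubic_bump -[X in _ ^+ X](card_ord d) -prodr_const.
apply: ler_prod => i _; rewrite invr_ge0 ler0n /=; apply: bump1_in.
rewrite normrM normfV (gtr0_norm rho0) ler_pdivrMr// mulrC.
by have := le_trans (normrV_coord (y - c) i) h; rewrite !mxE.
Qed.

(** The product is telescoped over its factors, each in [0, 1] and Lipschitz with constant 6 /
    rho. *)
Lemma bump_lip c rho x y : 0 < rho ->
  `|cubic_bump c rho x - cubic_bump c rho y| <= 6 * d%:R / rho * `|x - y|.
Proof.
move=> rho0; set F := fun (z : V) i => bump1 ((z ord0 i - c ord0 i) / rho).
have key (s : seq 'I_d) : `|\prod_(i <- s) F x i - \prod_(i <- s) F y i| <=
    (size s)%:R * (6 / rho * `|x - y|).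
  elim: s => [|i s IH]; first by rewrite !big_nil subrr normr0 mul0r.
  rewrite !big_cons /= -[(size s).+1]addn1 natrD mulrDl mul1r.
  set A := \prod_(i <- s) F x i in IH *; set B := \prod_(i <- s) F y i in IH *.
  have -> : F x i * A - F y i * B = F x i * (A - B) + (F x i - F y i) * B by ring.
  have Fi z j : 0 <= F z j <= 1 by exact: bump1_itv.
  rewrite (le_trans (ler_normD _ _))// lerD// normrM.
    rewrite (le_trans _ IH)// ler_piMl//.
    by have /andP[? ?] := Fi x i; rewrite ger0_norm.
  have B1 : 0 <= B <= 1.
    by rewrite prodr_ge0 ?prodr_ile1// => j _; have /andP[] := Fi y j.
  rewrite (le_trans (ler_piMr _ _))//; first by move: B1 => /andP[? ?]; rewrite ger0_norm.
  apply: (le_trans (bump1_lip _ _)).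
  have -> : (x ord0 i - c ord0 i) / rho - (y ord0 i - c ord0 i) / rho = (x - y) ord0 i / rho.
    by rewrite !mxE; field; rewrite gt_eqF.
  rewrite normrM normfV (gtr0_norm rho0) -mulrA ler_wpM2l// mulrC.
  by rewrite ler_wpM2l ?invr_ge0 ?(ltW rho0)// normrV_coord.
have := key (index_enum _); rewrite /cubic_bump.
have -> : size (index_enum 'I_d) = d by rewrite [index_enum _]unlock -enumT size_enum_ord.
move=> /le_trans; apply.
by rewrite !mulrA [d%:R * 6]mulrC.
Qed.

End bump.

(** * Convolution with compactly supported kernels *)

Section convolution.
Context {R : realType} {d : nat}.
Local Notation V := 'rV[R]_d.
Local Notation leb := (@lebesgue_rV R d).
Implicit Types (f g k : V -> R).

Lemma integral_rV_shift (f : V -> \bar R) (h : V) : measurable_fun setT f ->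
  (\int[leb]_y f (y + h)%R)%E = (\int[leb]_y f y)%E.
Proof.
have ge0 (g : V -> \bar R) : measurable_fun setT g -> (forall y, 0 <= g y)%E ->
    (\int[leb]_y g (y + h)%R)%E = (\int[leb]_y g y)%E.
  move=> mg g0.
  pose Pf := measure_function_pushforward__canonical__measure_function_Measure
    leb (measurable_shift h).
  have -> : (\int[leb]_y g y = \int[Pf]_y g y)%E.
    by apply: eq_measure_integral => A mA _; rewrite /Pf /= /pushforward lebesgue_rV_shift.
  rewrite (@ge0_integral_pushforward _ _ _ _ R _ (measurable_shift h) leb setT g)//.
move=> mf; rewrite integralE [RHS]integralE.
have -> : ((fun y => f (y + h)%R)^\+ = fun y => f^\+ (y + h)%R)%E.
  by apply/funext => y; rewrite !funeposE.
have -> : ((fun y => f (y + h)%R)^\- = fun y => f^\- (y + h)%R)%E.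
  by apply/funext => y; rewrite !funenegE.
congr (_ - _)%E; apply: ge0 => //; first exact: measurable_funepos.
exact: measurable_funeneg.
Qed.

Lemma Rintegral_rV_shift f (h : V) : measurable_fun setT f ->
  \int[leb]_y f (y + h) = \int[leb]_y f y.
Proof.
move=> mf; rewrite /Rintegral (integral_rV_shift (f := EFin \o f))//.
exact/measurable_EFinP.
Qed.

Definition L1_le k (S : R) := [/\ measurable_fun setT k, 0 <= S &
  (\int[leb]_y `|k y|%:E <= S%:E)%E].

Lemma L1_le_integrable k S : L1_le k S -> integrable_rV k.
Proof. by case=> mk S0 kS; have [] := Rintegral_rV_bound mk S0 kS. Qed.

Lemma L1_le_shift k S (h : V) : L1_le k S -> L1_le (fun y => k (y + h)) S.
Proof.
case=> mk S0 kS; split => //; first exact: measurableT_comp mk (measurable_shift h).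
rewrite (integral_rV_shift (f := fun y => `|k y|%:E))//.
by apply/measurable_EFinP; exact: measurableT_comp.
Qed.

Lemma L1_le_cube k (rho C : R) : measurable_fun setT k -> 0 <= rho -> 0 <= C ->
  (forall y, `|k y| <= C) -> (forall y, rho < `|y| -> k y = 0) ->
  L1_le k (C * (2 * rho) ^+ d).
Proof.
move=> mk r0 C0 kC kr; split => //; first by rewrite mulr_ge0// exprn_ge0// mulr_ge0.
have -> : C * (2 * rho) ^+ d = \sum_(k < 1) (if k == 0%N :> nat then C else 0) * (2 * rho) ^+ d.
  by rewrite big_ord1.
apply: (@integral_le_shells _ _ _ (fun n => if n == 0%N then C else 0) (fun=> rho)) => //.
- exact: measurableT_comp.
- by move=> k'; case: ifP.
- move=> y ky; exists 0%N; split => //.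
  by rewrite leNgt; apply: contraTN ky => /kr ->; rewrite normr0 ltxx.
move=> n; rewrite big_ord1/=; case: n => [|n].
  by rewrite big_ord0 mulr_ge0// exprn_ge0// mulr_ge0.
by rewrite big_ord_recl /= big1 ?addr0// => i _; rewrite mul0r.
Qed.

Lemma L1_mulP f k (M S : R) : measurable_fun setT f -> (forall y, `|f y| <= M) ->
  L1_le k S -> integrable_rV (fun y => f y * k y) /\ `|\int[leb]_y (f y * k y)| <= M * S.
Proof.
move=> mf fM [mk S0 kS]; have M0 : 0 <= M := le_trans (normr_ge0 _) (fM 0).
apply: Rintegral_rV_bound; [exact: measurable_funM|exact: mulr_ge0|].
apply: (@le_trans _ _ (\int[leb]_y (M%:E * `|k y|%:E))%E).
  apply: ge0_le_integral => //.
  - by apply/measurable_EFinP; apply: measurableT_comp => //; exact: measurable_funM.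
  - apply/measurable_EFinP; apply: measurable_funM => //.
    exact: measurableT_comp.
  - by move=> y _; rewrite -EFinM lee_fin normrM ler_wpM2r.
rewrite ge0_integralZl//; first by rewrite EFinM lee_wpmul2l.
by apply/measurable_EFinP; exact: measurableT_comp.
Qed.

(** This is convolution with the reflected kernel, the form in which jump integrals occur. A
    derivative passes to k with a minus sign. *)
Definition convol f k x : R := \int[leb]_y (f (x + y) * k y).

Let mfshift f (x : V) : measurable_fun setT f -> measurable_fun setT (fun y => f (x + y)).
Proof.
by move=> mf; under eq_fun do rewrite addrC; exact: measurableT_comp mf (measurable_shift x).
Qed.

Lemma convol_bound f k (M S : R) (x : V) : measurable_fun setT f -> (forall y, `|f y| <= M) ->
  L1_le k S -> integrable_rV (fun y => f (x + y) * k y) /\ `|convol f k x| <= M * S.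
Proof. by move=> mf fM kS; apply: L1_mulP => //; exact: mfshift. Qed.

Lemma integrable_rVZ (a : R) f : integrable_rV f -> integrable_rV (fun y => a * f y).
Proof. exact: integrableZl. Qed.

Lemma integrable_rVB f g : integrable_rV f -> integrable_rV g ->
  integrable_rV (fun y => f y - g y).
Proof. exact: integrableB. Qed.

Lemma RintegralB_rV f g : integrable_rV f -> integrable_rV g ->
  \int[leb]_y (f y - g y) = \int[leb]_y f y - \int[leb]_y g y.
Proof. by move=> If Ig; rewrite RintegralB. Qed.

Lemma UCb_convol f k S : UCb f -> L1_le k S -> UCb (convol f k).
Proof.
move=> Uf kS; have [M M0 fM] := UCb_bound Uf; have mf := UCb_measurable Uf.
apply/UCbP; split.
  by exists (M * S) => x; have [] := convol_bound x mf fM kS.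
have S0 : 0 <= S by case: kS.
move=> e e0; have [r r0 fr] := UCb_unif Uf (ltac:(by rewrite divr_gt0// ltr_wpDl) : 0 < e / (S + 1)).
exists r => // x h hr.
rewrite /convol -RintegralB_rV; last 2 first.
- by have [] := convol_bound (x + h) mf fM kS.
- by have [] := convol_bound x mf fM kS.
under eq_Rintegral do rewrite -mulrBl.
have mg : measurable_fun setT (fun y => f (x + h + y) - f (x + y)).
  by apply: measurable_funB; exact: mfshift.
have gM y : `|f (x + h + y) - f (x + y)| <= e / (S + 1) by rewrite addrAC fr.
have [_] := L1_mulP mg gM kS => /le_trans; apply.
rewrite mulrAC ler_pdivrMr ?ltr_wpDl// ler_wpM2l ?lerDl// ltW//.
Qed.

Lemma convol_shiftr f k (h : V) x : UCb f -> measurable_fun setT k ->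
  convol f k (x + h) = \int[leb]_y (f (x + y) * k (y - h)).
Proof.
move=> Uf mk; rewrite /convol.
rewrite -[RHS](Rintegral_rV_shift (f := fun y => f (x + y) * k (y - h)) h); last first.
  apply: measurable_funM; first by apply: mfshift; exact: UCb_measurable.
  exact: measurableT_comp mk (measurable_shift (- h)).
by apply: eq_Rintegral => y _; rewrite addrK addrAC -addrA.
Qed.

(** Once the increment of x has been moved to the kernel, the remainder is the integral of f against
    the remainder of k, which is uniformly small and lives on a slightly larger cube. *)
Lemma unif_derive_convol v f k k' (rho : R) : UCb f -> UCb k -> UCb k' -> 0 <= rho ->
  (forall y, rho < `|y| -> k y = 0) -> (forall y, rho < `|y| -> k' y = 0) ->
  unif_derive v k k' -> unif_derive v (convol f k) (fun x => - convol f k' x).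
Proof.
move=> Uf Uk Uk' rho0 sk sk' H e e0.
have [M M0 fM] := UCb_bound Uf; have mf := UCb_measurable Uf.
have [C C0 kC] := UCb_bound Uk; have [C' C'0 kC'] := UCb_bound Uk'.
have mk := UCb_measurable Uk; have mk' := UCb_measurable Uk'.
have LK := L1_le_cube mk rho0 C0 kC sk; have LK' := L1_le_cube mk' rho0 C'0 kC' sk'.
set W := M * (2 * (rho + 1)) ^+ d.
have W0 : 0 <= W by rewrite mulr_ge0// exprn_ge0// mulr_ge0// addr_ge0.
have [r r0 hr] := H (e / (W + 1)) ltac:(by rewrite divr_gt0// ltr_wpDl).
exists (Num.min r (1 / (`|v| + 1))); first by rewrite lt_min r0 divr_gt0// ltr_wpDl.
move=> x h; rewrite lt_min => /andP[h1 h2].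
have hv : `|h *: v| <= 1.
  rewrite normrZ; apply: le_trans (_ : `|h| * (`|v| + 1) <= _).
    by rewrite ler_wpM2l// lerDl.
  by rewrite -ler_pdivlMr ?ltr_wpDl// ltW.
(* The first-order remainder of k for the increment -h; since |h v| <= 1, it vanishes for |y| > rho
   + 1. *)
pose q y := k (y - h *: v) - k y + h * k' y.
have mq : measurable_fun setT q.
  apply: measurable_funD.
    by apply: measurable_funB => //; exact: measurableT_comp mk (measurable_shift _).
  by apply: measurable_funM.
have qb y : `|q y| <= e / (W + 1) * `|h|.
  have := hr y (- h); rewrite normrN scaleNr mulNr opprK; exact.
have qs y : rho + 1 < `|y| -> q y = 0.
  move=> hy; rewrite /q sk ?sk ?sk'//; [by ring|lra|lra|].
  have := ler_distD (y - h *: v) y 0; rewrite !subr0 subKr => h3; lra.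
have Lq : L1_le q (e / (W + 1) * `|h| * (2 * (rho + 1)) ^+ d).
  by apply: L1_le_cube => //; rewrite ?addr_ge0// mulr_ge0// divr_ge0 ?(ltW e0)// addr_ge0.
have -> : convol f k (x + h *: v) - convol f k x - h * (- convol f k' x) =
    \int[leb]_y (f (x + y) * q y).
  rewrite convol_shiftr// /convol.
  have I1 : integrable_rV (fun y => f (x + y) * k (y - h *: v)).
    by have [] := convol_bound x mf fM (L1_le_shift (- (h *: v)) LK).
  have [I2 _] := convol_bound x mf fM LK.
  have [I3 _] := convol_bound x mf fM LK'.
  have I3' : integrable_rV (fun y => (- h) * (f (x + y) * k' y)).
    exact: integrable_rVZ.
  have I12 : integrable_rV (fun y => f (x + y) * k (y - h *: v) - f (x + y) * k y).
    exact: integrable_rVB.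
  rewrite -RintegralB_rV// mulrN -mulNr -RintegralZl// -RintegralB_rV//.
  by apply: eq_Rintegral => y _; rewrite /q; ring.
have [_] := L1_mulP (mfshift x mf) (fun y => fM (x + y)) Lq => /le_trans; apply.
have -> : M * (e / (W + 1) * `|h| * (2 * (rho + 1)) ^+ d) = e * `|h| * (W / (W + 1)).
  by rewrite /W; field; rewrite -/W gt_eqF// ltr_wpDl.
by rewrite ler_piMr ?mulr_ge0// ?(ltW e0)// ler_pdivrMr ?ltr_wpDl// mul1r lerDl.
Qed.

(** Outside the closed cube a small enough step stays outside, so the difference quotient there is
    0. *)
Lemma unif_derive_supp v k k' (rho : R) : (forall y, rho < `|y| -> k y = 0) ->
  unif_derive v k k' -> forall y, rho < `|y| -> k' y = 0.
Proof.
move=> sk H y hy; apply/eqP; rewrite -normr_le0; apply/ler_addgt0Pr => e e0.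
rewrite add0r; have [r r0 hr] := H e e0.
pose h := Num.min (r / 2) ((`|y| - rho) / 2 / (`|v| + 1)).
have vp : 0 < `|v| + 1 by rewrite ltr_wpDl.
have h0 : 0 < h by rewrite lt_min !divr_gt0//; lra.
have hlr : `|h| < r.
  by rewrite gtr0_norm// (le_lt_trans (_ : _ <= r / 2)) ?ge_min ?lexx//; lra.
have hv : `|h *: v| <= (`|y| - rho) / 2.
  rewrite normrZ gtr0_norm//; apply: le_trans (_ : h * (`|v| + 1) <= _).
    by rewrite ler_wpM2l ?(ltW h0)// lerDl.
  by rewrite -ler_pdivlMr// ge_min lexx orbT.
have := hr y h hlr; rewrite !sk//; last first.
  have := ler_distD (y + h *: v) y 0; rewrite !subr0 opprD addrA subrr sub0r normrN; lra.
rewrite subrr sub0r normrN normrM (gtr0_norm h0) mulrC ler_pM2r//.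
Qed.

Lemma UCb2_convol f k (rho : R) : 0 <= rho -> UCb f -> UCb2 k ->
  (forall y, rho < `|y| -> k y = 0) -> UCb2 (convol f k).
Proof.
move=> rho0 Uf /UCb2P[Uk [k1 [k2 [U1 H1 U2 H2]]]] sk.
have s1 i := unif_derive_supp sk (H1 i).
have s2 i j := unif_derive_supp (s1 i) (H2 i j).
have L g : UCb g -> (forall y, rho < `|y| -> g y = 0) -> UCb (convol f g).
  move=> Ug sg; have [C C0 gC] := UCb_bound Ug.
  exact: UCb_convol Uf (L1_le_cube (UCb_measurable Ug) rho0 C0 gC sg).
apply/UCb2P; split; first exact: L.
exists (fun i x => - convol f (k1 i) x), (fun i j x => convol f (k2 i j) x).
split=> [i|i|i j|i j].
- by apply: UCbN; exact: L (U1 i) (s1 i).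
- exact: (unif_derive_convol Uf Uk (U1 i) rho0 sk (s1 i)).
- exact: L (U2 i j) (s2 i j).
- have /(unif_derive_lin (-1)) /(_ (unif_derive_cst _ 0)) :=
    unif_derive_convol Uf (U1 i) (U2 i j) rho0 (s1 i) (s2 i j) (H2 i j).
  by congr unif_derive; apply/funext => x; ring.
Qed.

(** The bump is at least 4^(-d) on the concentric cube of half the size, whose volume is rho^d. *)
Lemma bump_integral_gt0 (c : V) (rho : R) : 0 < rho ->
  integrable_rV (cubic_bump c rho) /\
  4^-1 ^+ d * rho ^+ d <= \int[leb]_y cubic_bump c rho y.
Proof.
move=> rho0; have Ub := UCb2_UCb (UCb2_cubic_bump c rho0); have mb := UCb_measurable Ub.
have b01 y : 0 <= cubic_bump c rho y <= 1 by exact: bump_itv.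
have Lb : L1_le (cubic_bump c rho) (1 * (2 * (rho + `|c|)) ^+ d).
  apply: L1_le_cube => //; rewrite ?addr_ge0// ?ltW// => y.
    by have /andP[? ?] := b01 y; rewrite ger0_norm.
  move=> hy; apply: bump_out => //; have := ler_distD c y 0; rewrite !subr0; lra.
have Ib := L1_le_integrable Lb; split=> //.
have [mq eq] := (lebesgue_rV_cube c (ltac:(lra) : 0 <= rho / 2)).
set Q := [set x : V | _] in mq eq.
rewrite -lee_fin /Rintegral fineK; last exact: integrable_fin_num.
apply: le_trans (_ : (\int[leb]_y (4^-1 ^+ d * \1_Q y)%:E <= _)%E).
  under eq_integral do rewrite EFinM.
  rewrite ge0_integralZl//.
    rewrite integral_indic// setIT.
    apply: (@le_trans _ _ ((4^-1 ^+ d)%:E * ((2 * (rho / 2)) ^+ d)%:E)%E).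
      by rewrite -EFinM lee_fin mulrCA divff// mulr1.
    by rewrite -mq; exact: lexx.
  by apply/measurable_EFinP; exact: measurable_indic.
apply: ge0_le_integral => //.
- by apply/measurable_EFinP; apply: measurable_funM.
- exact/measurable_EFinP.
- move=> y _; rewrite lee_fin indicE; case: (boolP (y \in Q)) => [/set_mem yQ|_].
    by rewrite mulr1; exact: bump_in.
  by rewrite mulr0; have /andP[] := b01 y.
Qed.

Definition mollify (rho : R) f x : R :=
  (\int[leb]_y cubic_bump 0 rho y)^-1 * convol f (cubic_bump 0 rho) x.

Lemma bump0_supp (rho : R) (y : V) : 0 < rho -> rho < `|y| -> cubic_bump 0 rho y = 0.
Proof. by move=> r0 h; apply: bump_out => //; rewrite subr0 ltW. Qed.

Lemma UCb2_mollify rho f : 0 < rho -> UCb f -> UCb2 (mollify rho f).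
Proof.
move=> r0 Uf.
have U := UCb2_convol (ltW r0) Uf (UCb2_cubic_bump (0 : V) r0) (fun y => @bump0_supp rho y r0).
apply: UCb2_ext (UCb2_lin (\int[leb]_y cubic_bump 0 rho y)^-1 U (UCb2_cst 0)) _ => x.
by rewrite addr0.
Qed.

(* [mollify] is an average over the cube of half side rho; every bound that is
   stable under averages is therefore inherited. *)
Lemma mollify_average rho f (a x : V) (c B : R) : 0 < rho -> UCb f ->
  (forall y, `|y| <= rho -> `|f (x + y) - c * f (a + y)| <= B) ->
  `|mollify rho f x - c * mollify rho f a| <= B.
Proof.
move=> r0 Uf H; have [M M0 fM] := UCb_bound Uf; have mf := UCb_measurable Uf.
have [Ib bp] := bump_integral_gt0 (0 : V) r0.
have J0 : 0 < \int[leb]_y cubic_bump 0 rho y.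
  by apply: lt_le_trans bp; rewrite mulr_gt0// exprn_gt0.
have mb := UCb_measurable (UCb2_UCb (UCb2_cubic_bump (0 : V) r0)).
have B0 : 0 <= B by apply: le_trans (H 0 _); rewrite ?normr0 // ltW.
have Lb : L1_le (cubic_bump 0 rho) (\int[leb]_y cubic_bump 0 rho y).
  split=> //; first exact: ltW.
  rewrite /Rintegral fineK; last exact: integrable_fin_num.
  rewrite le_eqVlt; apply/orP; left; apply/eqP; apply: eq_integral => y _.
  by rewrite ger0_norm//; have /andP[] := bump_itv (0 : V) rho y.
have [I1 _] := convol_bound x mf fM Lb; have [I2 _] := convol_bound a mf fM Lb.
have I2' : integrable_rV (fun y => c * (f (a + y) * cubic_bump 0 rho y)).
  exact: integrable_rVZ.
rewrite /mollify mulrCA -mulrBr normrM normfV (gtr0_norm J0) ler_pdivrMl//.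
rewrite /convol -RintegralZl// -RintegralB_rV//.
have -> : \int[leb]_y (f (x + y) * cubic_bump 0 rho y - c * (f (a + y) * cubic_bump 0 rho y)) =
   \int[leb]_y ((if `|y| <= rho then f (x + y) - c * f (a + y) else 0) * cubic_bump 0 rho y).
  apply: eq_Rintegral => y _; case: ifPn => [_|]; first by ring.
  by rewrite -ltNge => h; rewrite bump0_supp//; ring.
rewrite [leRHS]mulrC; apply: (proj2 (L1_mulP _ _ Lb)) => //.
  apply: measurable_fun_ifT => //.
  - apply: (measurable_fun_bool true); rewrite setTI.
    by have [_ mc] := lebesgue_rV_cube0 (d := d) (ltW r0); exact: mc.
  - apply: measurable_funB; first exact: mfshift.
    by apply: measurable_funM => //; exact: mfshift.
by move=> y; case: ifPn => [/H //|_]; rewrite normr0.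
Qed.

Lemma mollify_bound rho f (B : R) : 0 < rho -> UCb f -> (forall y, `|f y| <= B) ->
  forall x, `|mollify rho f x| <= B.
Proof.
move=> r0 Uf fB x; have := @mollify_average rho f 0 x 0 B r0 Uf.
by rewrite mul0r subr0; apply => y _; rewrite mul0r subr0.
Qed.

Lemma mollify_increment rho f (h x : V) (B : R) : 0 < rho -> UCb f ->
  (forall y, `|f (y + h) - f y| <= B) ->
  `|mollify rho f (x + h) - mollify rho f x| <= B.
Proof.
move=> r0 Uf fB; have := @mollify_average rho f x (x + h) 1 B r0 Uf.
by rewrite mul1r; apply => y _; rewrite mul1r addrAC.
Qed.

(** An average keeps the sup bound and, for every h, the bound on increments by h. The
    approximations therefore share each Hölder constant of f. *)
Lemma mollify_close f e : UCb f -> 0 < e -> exists2 g, UCb2 g &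
  [/\ forall x, `|g x - f x| <= e,
      forall B, (forall y, `|f y| <= B) -> forall x, `|g x| <= B &
      forall (h : V) B, (forall y, `|f (y + h) - f y| <= B) ->
        forall y, `|g (y + h) - g y| <= B].
Proof.
move=> Uf e0; have [r r0 fr] := UCb_unif Uf e0.
have r20 : 0 < r / 2 by lra.
exists (mollify (r / 2) f); first exact: UCb2_mollify.
split=> [x|B fB x|h B fB y]; [|exact: mollify_bound|exact: mollify_increment].
have [M M0 fM] := UCb_bound Uf.
have [Ib bp] := bump_integral_gt0 (0 : V) r20.
have J0 : \int[leb]_y cubic_bump 0 (r / 2) y != 0.
  by rewrite gt_eqF// (lt_le_trans _ bp)// mulr_gt0 ?exprn_gt0.
(* With c = 0, the average of f(. + x) - f x at the origin is the error at x. The radius r / 2 keeps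
   |y| strictly below the modulus r. *)
have := @mollify_average (r / 2) (fun y => f (y + x) - f x) 0 0 0 e r20.
rewrite mul0r subr0 /mollify /convol.
have -> : \int[leb]_y ((f (0 + y + x) - f x) * cubic_bump 0 (r / 2) y) =
   convol f (cubic_bump 0 (r / 2)) x - f x * \int[leb]_y cubic_bump 0 (r / 2) y.
  have Lb : L1_le (cubic_bump (0 : V) (r / 2)) (1 * (2 * (r / 2)) ^+ d).
    apply: L1_le_cube => //; [|exact: ltW| |].
    - exact: UCb_measurable (UCb2_UCb (UCb2_cubic_bump (0 : V) r20)).
    - by move=> y; have /andP[? ?] := bump_itv (0 : V) (r / 2) y; rewrite ger0_norm.
    - by move=> y; exact: bump0_supp.
  have [I1 _] := convol_bound x (UCb_measurable Uf) fM Lb.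
  have I2 : integrable_rV (fun y => f x * cubic_bump 0 (r / 2) y) := integrable_rVZ (f x) Ib.
  rewrite -RintegralZl// /convol -RintegralB_rV//.
  by apply: eq_Rintegral => y _; rewrite add0r [y + x]addrC; ring.
rewrite mulrBr mulrCA mulVf// mulr1; apply.
  by apply: UCbB; [exact: UCb_shift|exact: UCb_cst].
move=> y hy; rewrite mul0r subr0 add0r (addrC y x) fr//; lra.
Qed.

End convolution.

(** * The fractional Laplacian of a Hölder function *)

Section sup_norm.
Context {R : realType} {d : nat}.
Local Notation V := 'rV[R]_d.
Implicit Types (f : V -> R).

Lemma supnorm_leP f (M : R) : (supnorm f <= M%:E)%E <-> forall x, `|f x| <= M.
Proof.
split=> [h x|h]; last by apply: ge_ereal_sup => _ [x _ <-]; rewrite lee_fin.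
by rewrite -lee_fin (le_trans _ h)//; apply: ereal_sup_ubound; exists x.
Qed.

Lemma supnorm_ge0 f : (0 <= supnorm f)%E.
Proof.
by apply: (@le_trans _ _ `|f 0|%:E); [rewrite lee_fin|apply: ereal_sup_ubound; exists 0].
Qed.

Lemma supnorm_cvg0P (T : Type) (F : set_system T) (FF : Filter F) (u : T -> V -> R) :
  supnorm (u t) @[t --> F] --> 0%E <->
  forall e : R, 0 < e -> \forall t \near F, forall x, `|u t x| <= e.
Proof.
split=> [/fine_cvgP[fin /cvgrPdist_le h] e e0|h].
  have := h e e0; move: fin; apply: filterS2 => t ft; rewrite sub0r normrN => ht x.
  rewrite -lee_fin; apply: (@le_trans _ _ (supnorm (u t))).
    by apply: ereal_sup_ubound; exists x.
  by rewrite -(fineK ft) lee_fin (le_trans (ler_norm _)).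
apply/fine_cvgP; split.
  have := h 1 ltr01; apply: filterS => t /supnorm_leP ht.
  by rewrite ge0_fin_numE ?supnorm_ge0// (le_lt_trans ht)// ltry.
apply/cvgrPdist_le => e e0; have := h e e0; apply: filterS => t /supnorm_leP ht.
rewrite sub0r normrN ger0_norm ?fine_ge0 ?supnorm_ge0//= -lee_fin fineK//.
by rewrite ge0_fin_numE ?supnorm_ge0// (le_lt_trans ht)// ltry.
Qed.

Lemma right0_nearP (P : R -> Prop) :
  (\forall t \near 0^'+, P t) <-> exists2 r : R, 0 < r & forall t, 0 < t < r -> P t.
Proof.
split=> [|[r r0 h]].
  move=> /nbhs_ballP[r /= r0 h]; exists r => // t /andP[t0 tr]; apply: h => //.
  by rewrite -ball_normE /= sub0r normrN gtr0_norm.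
apply/nbhs_ballP; exists r => //= t; rewrite -ball_normE /= sub0r normrN => tr t0.
by apply: h; rewrite t0 (le_lt_trans (ler_norm _)).
Qed.

Lemma supnorm_right0P (u : R -> V -> R) :
  supnorm (u t) @[t --> 0^'+] --> 0%E <->
  forall e : R, 0 < e -> exists2 r, 0 < r & forall t, 0 < t < r -> forall x, `|u t x| <= e.
Proof.
split=> [/supnorm_cvg0P h e /h/right0_nearP //|h].
by apply/supnorm_cvg0P => e /h ?; apply/right0_nearP.
Qed.

End sup_norm.

Section fractional_laplacian_of_holder_functions.
Context {R : realType} {d : nat} (d_gt0 : (0 < d)%N).
Local Notation V := 'rV[R]_d.
Local Notation leb := (@lebesgue_rV R d).
Variables (beta theta : R).
Hypotheses (beta0 : 0 < beta) (beta_theta : beta < theta) (theta1 : theta <= 1).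
Implicit Types (g : V -> R).

Definition holder (H : R) g := forall x y : V, `|g (x + y) - g x| <= H * `|y| `^ theta.

Lemma measurable_frac_kernel gamma g x : UCb g -> measurable_fun setT (frac_kernel gamma g x).
Proof.
move=> Ug; have mg := UCb_measurable Ug.
rewrite (_ : frac_kernel gamma g x = fun y => (g (x + y) - g x) * ipow (d%:R + gamma) y)//.
apply: measurable_funM; last exact: measurable_ipow.
apply: measurable_funB => //.
by under eq_fun do rewrite addrC; exact: measurableT_comp mg (measurable_shift x).
Qed.

Lemma frac_lap_lt1 g x : frac_lap beta g x = - \int[leb]_y frac_kernel beta g x y.
Proof. by rewrite /frac_lap ifT//; by rewrite (lt_le_trans beta_theta). Qed.

Let exponent_ge0 : 0 <= d%:R + (beta - theta).
Proof. have d1 : (1 : R) <= d%:R by rewrite ler1n.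
move: beta0 beta_theta theta1; lra. Qed.

Let theta_beta : 0 < theta - beta. Proof. by rewrite subr_gt0. Qed.

Let beta_theta0 : beta - theta < 0. Proof. by rewrite subr_lt0. Qed.

Let theta0 : 0 <= theta. Proof. exact/ltW/(lt_trans beta0). Qed.

(** Splitting at |y| = r, the kernel is at most H |y|^(theta-d-beta) inside and 2 m |y|^(-d-beta)
    outside; these are integrable because beta < theta and beta > 0. The radius is left free, to
    balance the two terms or to make one of them small. *)
Lemma frac_lap_holder_bound : exists2 K, 0 < K & forall g (m H r : R),
  UCb g -> (forall x, `|g x| <= m) -> 0 <= H -> holder H g -> 0 < r ->
  forall x, integrable_rV (frac_kernel beta g x) /\
    `|frac_lap beta g x| <= K * (H * r `^ (theta - beta) + m * r `^ (- beta)).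
Proof.
have [K1 K10 far] := @integral_ipow_far R d beta beta0.
have [K2 K20 near] := @integral_ipow_near R d (beta - theta) beta_theta0 exponent_ge0.
exists (K2 + 2 * K1) => [|g m H r Ug gm H0 gH r0 x]; first lra.
rewrite frac_lap_lt1 normrN.
have m0 : 0 <= m := le_trans (normr_ge0 _) (gm 0).
pose A := @ipow R d (d%:R + (beta - theta)); pose B := @ipow R d (d%:R + beta).
pose D1 := [set y : V | (0 < `|y| <= r)%R]; pose D2 := [set y : V | r < `|y|].
have mc s : 0 <= s -> measurable [set y : V | `|y| <= s].
  by move=> s0; have [] := lebesgue_rV_cube0 (d := d) s0.
have mD2 : measurable D2.
  rewrite (_ : D2 = ~` [set y : V | `|y| <= r]); first by apply: measurableC; apply: mc; rewrite ltW.
  by apply/seteqP; split=> y /=; [rewrite /D2/= ltNge => /negP|move/negP; rewrite -ltNge].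
have mD1 : measurable D1.
  rewrite (_ : D1 = [set y : V | `|y| <= r] `\` [set y : V | `|y| <= 0]).
    by apply: measurableD; apply: mc; rewrite // ltW.
  apply/seteqP; split=> y /=.
    by move=> /andP[H1 H2]; split=> //; apply/negP; rewrite -ltNge.
  by move=> [H1 /negP]; rewrite -ltNge => h2; apply/andP.
have mA : measurable_fun setT (fun y => A y * \1_D1 y).
  by apply: measurable_funM; [exact: measurable_ipow|exact: measurable_indic].
have mB : measurable_fun setT (fun y => B y * \1_D2 y).
  by apply: measurable_funM; [exact: measurable_ipow|exact: measurable_indic].
have S0 : 0 <= H * (K2 * r `^ (theta - beta)) + 2 * m * (K1 * r `^ (- beta)).
  by rewrite addr_ge0// !mulr_ge0// ?powR_ge0// ltW.
have [||Ik kb] := @Rintegral_rV_bound R d (frac_kernel beta g x) _ _ S0.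
- exact: measurable_frac_kernel.
- apply: (@le_trans _ _ (\int[leb]_y (H%:E * (A y * \1_D1 y)%:E + (2 * m)%:E * (B y * \1_D2 y)%:E))%E).
    apply: ge0_le_integral => //.
    + by apply/measurable_EFinP; apply: measurableT_comp => //; exact: measurable_frac_kernel.
    + by apply: emeasurable_funD; apply: measurable_funeM; exact/measurable_EFinP.
    move=> y _; rewrite -!EFinM -EFinD lee_fin.
    have A0 := ipow_ge0 (d%:R + (beta - theta)) y; have B0 := ipow_ge0 (d%:R + beta) y.
    have -> : frac_kernel beta g x y = (g (x + y) - g x) * B y by [].
    rewrite normrM [X in _ * X]ger0_norm//.
    (* The origin belongs to neither region; the increment vanishes there. *)
    have [->|y0] := eqVneq y 0.
      have i0 D : 0 <= \1_D (0 : V) :> R by rewrite indicE.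
      rewrite addr0 subrr normr0 mul0r; apply: addr_ge0.
        exact: (mulr_ge0 H0 (mulr_ge0 (ipow_ge0 _ _) (i0 _))).
      exact: (mulr_ge0 (mulr_ge0 (ler0n _ _) m0) (mulr_ge0 (ipow_ge0 _ _) (i0 _))).
    have yp : 0 < `|y| by rewrite normr_gt0.
    have [yr|yr] := leP `|y| r.
      rewrite !indicE mem_set ?memNset; last 2 first.
      + by rewrite /D2 /=; apply/negP; rewrite -leNgt.
      + by rewrite /D1 /= yp.
      rewrite mulr1 !mulr0 addr0 -[H * A y]/(H * A y).
      apply: (@le_trans _ _ (H * enorm y `^ theta * B y)).
        rewrite ler_wpM2r//; apply: (le_trans (gH x y)); rewrite ler_wpM2l//.
        by rewrite ge0_ler_powR// ?nnegrE ?normr_ge0 ?enorm_ge0 ?normrV_le_enorm//.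
      rewrite -mulrA ler_wpM2l// /A /B /ipow.
      have ep : enorm y != 0 by rewrite gt_eqF// enorm_gt0.
      rewrite -!powRN -powRD; last by rewrite ep implybT.
      by rewrite le_eqVlt; apply/orP; left; apply/eqP; congr (_ `^ _); ring.
    rewrite !indicE memNset ?mem_set//; last by rewrite /D1 /=; apply/negP; rewrite negb_and -ltNge yr orbT.
    rewrite !mulr0 add0r mulr1 ler_wpM2r//.
    by rewrite (le_trans (ler_normB _ _))// mulrDl mul1r lerD.
  rewrite ge0_integralD//; last 4 first.
  + by move=> y _; rewrite -EFinM lee_fin !mulr_ge0// ipow_ge0.
  + by apply: measurable_funeM; exact/measurable_EFinP.
  + by move=> y _; rewrite -EFinM lee_fin !mulr_ge0// ipow_ge0.
  + by apply: measurable_funeM; exact/measurable_EFinP.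
  rewrite !ge0_integralZl//.
  + rewrite EFinD !EFinM; apply: leeD; apply: lee_wpmul2l; rewrite ?lee_fin ?mulr_ge0// -?EFinM.
      by have := near r r0; rewrite opprB.
    exact: far.
  all: try by apply/measurable_EFinP.
  all: try by move=> y _; rewrite lee_fin mulr_ge0// ipow_ge0.
  by rewrite lee_fin mulr_ge0.
split=> //; apply: (le_trans kb).
have p1 := powR_ge0 r (theta - beta); have p2 := powR_ge0 r (- beta).
rewrite mulrDr !mulrA lerD//.
  by rewrite mulrAC [_ * H]mulrC mulrAC -!mulrA ler_wpM2l//; nra.
rewrite ler_wpM2r//; nra.
Qed.

Lemma holder_bounded_integrable g H x : UCb g -> 0 <= H -> holder H g ->
  integrable_rV (frac_kernel beta g x).
Proof.
move=> Ug H0 gH; have [K K0 b] := frac_lap_holder_bound.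
have [m m0 gm] := UCb_bound Ug.
by have [] := b g m H 1 Ug gm H0 gH ltr01 x.
Qed.

Lemma frac_lapB g1 g2 H1 H2 x : UCb g1 -> UCb g2 -> 0 <= H1 -> 0 <= H2 ->
  holder H1 g1 -> holder H2 g2 ->
  frac_lap beta (fun x => g1 x - g2 x) x = frac_lap beta g1 x - frac_lap beta g2 x.
Proof.
move=> U1 U2 H10 H20 h1 h2; rewrite !frac_lap_lt1 -opprD; congr (- _).
rewrite -RintegralB_rV.
- by apply: eq_Rintegral => y _; rewrite /frac_kernel; ring.
- exact: holder_bounded_integrable h1.
- exact: holder_bounded_integrable h2.
Qed.

Lemma frac_lap_shift (gamma : R) g (h x : V) :
  frac_lap gamma (fun x => g (x + h)) x = frac_lap gamma g (x + h).
Proof.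
rewrite /frac_lap; congr (- _).
by rewrite (_ : frac_kernel gamma (fun x => g (x + h)) x = frac_kernel gamma g (x + h));
  [|apply/funext => y; rewrite /frac_kernel addrAC].
Qed.

(** For a fixed Hölder constant, r is first chosen to make the inner term at most e / 2, and then m
    to do the same for the outer term. This is the continuity behind all later limits. *)
Lemma frac_lap_small (H e : R) : 0 <= H -> 0 < e -> exists2 m, 0 < m & forall g,
  UCb g -> (forall x, `|g x| <= m) -> holder H g -> forall x, `|frac_lap beta g x| <= e.
Proof.
move=> H0 e0; have [K K0 b] := frac_lap_holder_bound.
have tb := theta_beta.
(* The target value of r^(theta-beta); H + 1 in place of H covers H = 0. *)
pose c := e / 2 / K / (H + 1); have c0 : 0 < c by rewrite !divr_gt0// ltr_wpDl.
pose r := c `^ (theta - beta)^-1; have r0 : 0 < r by rewrite powR_gt0.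
have rE : r `^ (theta - beta) = c by rewrite /r -powRrM mulVf ?powRr1 ?(ltW c0)// gt_eqF.
have q0 : 0 < r `^ (- beta) by rewrite powR_gt0.
exists (e / 2 / K / r `^ (- beta)) => [|g Ug gm gH x]; first by rewrite !divr_gt0.
have [_ /le_trans] := b g _ H r Ug gm H0 gH r0 x; apply.
rewrite rE divfK ?gt_eqF// mulrDr [K * (e / 2 / K)]mulrC divfK ?gt_eqF//.
rewrite -lerBrDr (_ : e - e / 2 = e / 2); last by field.
rewrite mulrC -ler_pdivlMr// /c mulrA ler_pdivrMr ?ltr_wpDl//.
by rewrite mulrC ler_wpM2l ?lerDl// ltW// divr_gt0// divr_gt0.
Qed.

Lemma holderB g1 g2 H1 H2 : holder H1 g1 -> holder H2 g2 ->
  holder (H1 + H2) (fun x => g1 x - g2 x).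
Proof.
move=> h1 h2 x y; have := h1 x y; have := h2 x y.
rewrite mulrDl => a2 a1.
have -> : g1 (x + y) - g2 (x + y) - (g1 x - g2 x) =
  (g1 (x + y) - g1 x) - (g2 (x + y) - g2 x) by ring.
by rewrite (le_trans (ler_normB _ _))// lerD.
Qed.

Lemma holder_shift g H (h : V) : holder H g -> holder H (fun x => g (x + h)).
Proof. by move=> gH x y; rewrite addrAC. Qed.

(** An increment of the fractional Laplacian is the fractional Laplacian of g(. + h) - g, a function
    with Hölder constant 2 H and small sup norm. *)
Lemma UCb_frac_lap g H : UCb g -> 0 <= H -> holder H g -> UCb (frac_lap beta g).
Proof.
move=> Ug H0 gH; apply/UCbP; split.
  have [K K0 b] := frac_lap_holder_bound; have [m m0 gm] := UCb_bound Ug.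
  exists (K * (H * 1 `^ (theta - beta) + m * 1 `^ (- beta))) => x.
  by have [] := b g m H 1 Ug gm H0 gH ltr01 x.
move=> e e0; have [m m0 b] := frac_lap_small (addr_ge0 H0 H0) e0.
have [r r0 gr] := UCb_unif Ug m0; exists r => // x h hr.
rewrite -frac_lap_shift -(frac_lapB (H1 := H) (H2 := H))//.
- apply: b => //; first by apply: UCbB => //; exact: UCb_shift.
  + by move=> y; exact: gr.
  + by apply: holderB => //; exact: holder_shift.
- exact: UCb_shift.
- exact: holder_shift.
Qed.

(** The mollified functions keep the constant H, so their differences with g have constant 2 H and
    sup norm tending to 0, and [frac_lap_small] applies. *)
Lemma frac_lap_closure_holder g H : UCb g -> 0 <= H -> holder H g ->
  frac_lap_closure beta g (frac_lap beta g).
Proof.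
move=> Ug H0 gH; split=> //; split; first exact: UCb_frac_lap gH.
have /choice[fn fnP] : forall n : nat, exists f, UCb2 f /\
    (forall x, `|f x - g x| <= n.+1%:R^-1) /\ holder H f.
  move=> n; have [f Uf [fg _ fH]] := mollify_close Ug (ltac:(by rewrite invr_gt0) : 0 < (n.+1%:R^-1 : R)).
  by exists f; split=> //; split=> // x y; apply: fH => z; exact: gH.
exists fn; split=> [n||]; first by have [] := fnP n.
- apply/supnorm_cvg0P => e e0; near=> n => x.
  have [_ [h _]] := fnP n; rewrite (le_trans (h x))// ltW//.
  by near: n; exact: near_infty_natSinv_lt (PosNum e0).
- apply/supnorm_cvg0P => e e0; have [m m0 b] := frac_lap_small (addr_ge0 H0 H0) e0.
  near=> n => x; have [U2 [h hH]] := fnP n; have U := UCb2_UCb U2.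
  rewrite -(frac_lapB (H1 := H) (H2 := H))//; apply: b.
  + exact: UCbB.
  + move=> y; rewrite (le_trans (h y))// ltW//.
    by near: n; exact: near_infty_natSinv_lt (PosNum m0).
  + exact: holderB.
Unshelve. all: by end_near. Qed.

End fractional_laplacian_of_holder_functions.

(** * Maximum principle and smoothing for the stable semigroup *)

Section stable_semigroup.
Context {R : realType} {d : nat}.
Local Notation V := 'rV[R]_d.
Local Notation leb := (@lebesgue_rV R d).
Implicit Types (f g w q : V -> R) (x y h : V).

(** What is retained of the law of Z. [sg_le] encodes positivity and preservation of constants
    together, and is the source of the maximum principle; [sg_shift] is what keeps [UCb2] invariant.
    Strong continuity is recovered from the generator in [sg_continuous0]. *)
Record stable_semigroup (alpha : R) (S : R -> (V -> R) -> V -> R) : Prop := {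
  sg_lin : forall (t a : R) f g x, 0 <= t -> UCb f -> UCb g ->
    S t (fun y => a * f y + g y) x = a * S t f x + S t g x ;
  sg_le : forall (t M : R) f, 0 <= t -> UCb f -> (forall x, f x <= M) ->
    forall x, S t f x <= M ;
  sg_shift : forall (t : R) f h x, 0 <= t -> UCb f ->
    S t (fun y => f (y + h)) x = S t f (x + h) ;
  sg_zero : forall f x, UCb f -> S 0 f x = f x ;
  sg_add : forall (s t : R) f x, 0 <= s -> 0 <= t -> UCb f ->
    S (s + t) f x = S s (S t f) x ;
  sg_generator : forall f, UCb2 f -> forall e : R, 0 < e -> exists2 r : R, 0 < r &
    forall t, 0 < t < r -> forall x,
      `|S t f x - f x + t * frac_lap alpha f x| <= t * e }.

Variables (alpha : R) (S : R -> (V -> R) -> V -> R).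
Hypothesis HS : stable_semigroup alpha S.

Lemma sgB (t : R) f g x : 0 <= t -> UCb f -> UCb g ->
  S t (fun y => f y - g y) x = S t f x - S t g x.
Proof.
move=> t0 Uf Ug; have := sg_lin HS (-1) x t0 Ug Uf.
by under eq_fun do rewrite mulN1r addrC; rewrite mulN1r addrC.
Qed.

Lemma sgN (t : R) f x : 0 <= t -> UCb f -> S t (fun y => - f y) x = - S t f x.
Proof.
(* Linearity with g = f and a = -2 gives the negation at once, as -2 f + f = - f. *)
move=> t0 Uf; have := sg_lin HS (-2) x t0 Uf Uf.
by rewrite (_ : (fun y => _) = fun y => - f y); [move=> ->; ring|apply/funext => y; ring].
Qed.

Lemma sg_bound (t M : R) f : 0 <= t -> UCb f -> (forall x, `|f x| <= M) ->
  forall x, `|S t f x| <= M.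
Proof.
move=> t0 Uf fM x; rewrite ler_norml; apply/andP; split; last first.
  by apply: (sg_le HS) => // y; exact: le_trans (ler_norm _) (fM y).
rewrite lerNl.
have := @sg_le _ _ HS t M (fun y => - f y) t0 (UCbN Uf) _ x.
by rewrite sgN//; apply=> y; rewrite (le_trans (ler_norm _))// normrN.
Qed.

Lemma sg_diff (t M : R) f g : 0 <= t -> UCb f -> UCb g -> (forall x, `|f x - g x| <= M) ->
  forall x, `|S t f x - S t g x| <= M.
Proof. by move=> t0 Uf Ug H x; rewrite -sgB//; apply: sg_bound => //; exact: UCbB. Qed.

Lemma UCb_sg (t : R) f : 0 <= t -> UCb f -> UCb (S t f).
Proof.
move=> t0 Uf; apply/UCbP; split.
  by have [M M0 fM] := UCb_bound Uf; exists M; exact: sg_bound.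
move=> e e0; have [r r0 fr] := UCb_unif Uf e0; exists r => // x h hr.
rewrite -(sg_shift HS)//; apply: sg_diff => //; first exact: UCb_shift.
by move=> y; exact: fr.
Qed.

(** Since S_t is linear and commutes with translations, the remainder of S_t f is S_t applied to the
    remainder of f, and the contraction property keeps its bound. *)
Lemma unif_derive_sg (t : R) v f g : 0 <= t -> UCb f -> UCb g -> unif_derive v f g ->
  unif_derive v (S t f) (S t g).
Proof.
move=> t0 Uf Ug H e /H[r r0 fr]; exists r => // x h hr.
have U1 : UCb (fun y => f (y + h *: v) - f y) by apply: UCbB => //; exact: UCb_shift.
have -> : S t f (x + h *: v) - S t f x - h * S t g x =
    S t (fun y => - h * g y + (f (y + h *: v) - f y)) x.
  rewrite (sg_lin HS)// sgB//; last exact: UCb_shift.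
  by rewrite (sg_shift HS)//; ring.
apply: sg_bound => //; first exact: UCb_lin.
by move=> y; rewrite mulNr addrC; exact: fr.
Qed.

Lemma UCb2_sg (t : R) f : 0 <= t -> UCb2 f -> UCb2 (S t f).
Proof.
move=> t0 /UCb2P[Uf [f1 [f2 [U1 H1 U2 H2]]]].
apply/UCb2P; split; first exact: UCb_sg.
exists (fun i => S t (f1 i)), (fun i j => S t (f2 i j)).
by split=> *; [exact: UCb_sg|exact: unif_derive_sg|exact: UCb_sg|exact: unif_derive_sg].
Qed.

(* The difference quotients of the semigroup determine [frac_lap] on UCb2; this
   is how its linearity is obtained also for alpha >= 1, where it is a principal
   value. *)
Lemma frac_lap_unique f g : UCb2 f ->
  (forall e, 0 < e -> exists2 r : R, 0 < r & forall t, 0 < t < r -> forall x,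
     `|S t f x - f x + t * g x| <= t * e) ->
  forall x, frac_lap alpha f x = g x.
Proof.
move=> U2 H x; apply/eqP; rewrite -subr_eq0 -normr_le0; apply/ler_addgt0Pr => e e0.
rewrite add0r; have [r r0 h1] := H (e / 2) ltac:(lra).
have [s s0 h2] := sg_generator HS U2 (ltac:(lra) : 0 < e / 2).
pose t := Num.min r s / 2.
have m0 : 0 < Num.min r s by rewrite lt_min r0.
have t0 : 0 < t by rewrite /t; lra.
have tm : t < Num.min r s by rewrite /t; lra.
move: tm; rewrite lt_min => /andP[tr ts].
have := h1 t; have := h2 t; rewrite t0 tr ts => /(_ isT x) a2 /(_ isT x) a1.
rewrite -(ler_pM2l t0) -{1}(gtr0_norm t0) -normrM.
have -> : t * (frac_lap alpha f x - g x) = (S t f x - f x + t * frac_lap alpha f x) -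
  (S t f x - f x + t * g x) by ring.
by rewrite (le_trans (ler_normB _ _))// [in leRHS](splitr e) [leRHS]mulrDr lerD.
Qed.

Lemma frac_lap_lin (a : R) f g x : UCb2 f -> UCb2 g ->
  frac_lap alpha (fun y => a * f y + g y) x = a * frac_lap alpha f x + frac_lap alpha g x.
Proof.
move=> Uf Ug; apply: (frac_lap_unique (g := fun x => a * frac_lap alpha f x + frac_lap alpha g x)).
  exact: UCb2_lin.
move=> e e0.
have ap : 0 < `|a| + 1 by rewrite ltr_wpDl.
have [r r0 h1] := sg_generator HS Uf (ltac:(rewrite !divr_gt0//) : 0 < e / 2 / (`|a| + 1)).
have [s s0 h2] := sg_generator HS Ug (ltac:(lra) : 0 < e / 2).
exists (Num.min r s); first by rewrite lt_min r0.
move=> t /andP[t0]; rewrite lt_min => /andP[tr ts] y.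
rewrite (sg_lin HS) ?(ltW t0) ?UCb2_UCb//; try exact: UCb2_UCb.
have -> : a * S t f y + S t g y - (a * f y + g y) +
    t * (a * frac_lap alpha f y + frac_lap alpha g y) =
  a * (S t f y - f y + t * frac_lap alpha f y) + (S t g y - g y + t * frac_lap alpha g y).
  by move: (S t f y) (S t g y) (frac_lap alpha f y) (frac_lap alpha g y) => *; ring.
rewrite (le_trans (ler_normD _ _))// [in leRHS](splitr e) [leRHS]mulrDr lerD//; last first.
  by apply: h2; rewrite t0.
rewrite normrM; apply: (@le_trans _ _ ((`|a| + 1) * (t * (e / 2 / (`|a| + 1))))).
  by apply: ler_pM => //; [rewrite lerDl|apply: h1; rewrite t0].
by rewrite le_eqVlt; apply/orP; left; apply/eqP; field; rewrite gt_eqF.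
Qed.

(** The difference quotients of the semigroup lie in [UCb] and converge uniformly. *)
Lemma UCb_frac_lap_UCb2 f : UCb2 f -> UCb (frac_lap alpha f).
Proof.
move=> U2; have Uf := UCb2_UCb U2; apply: UCb_limit => e e0.
have [r r0 h] := sg_generator HS U2 e0.
have t0 : 0 < r / 2 by lra.
have tr : 0 < r / 2 < r by lra.
exists (fun x => (r / 2)^-1 * (f x - S (r / 2) f x)).
  by apply: UCbZ; apply: UCbB => //; apply: UCb_sg => //; exact: ltW.
move=> x; rewrite -(ler_pM2l t0) -{1}(gtr0_norm t0) -normrM -normrN.
have -> : - (r / 2 * ((r / 2)^-1 * (f x - S (r / 2) f x) - frac_lap alpha f x)) =
  S (r / 2) f x - f x + r / 2 * frac_lap alpha f x by field; rewrite gt_eqF.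
exact: h.
Qed.

(** The difference quotients of S_t f are the images under S_t of those of f; [frac_lap_unique]
    identifies their limit. *)
Lemma frac_lap_sg (t : R) f x : 0 <= t -> UCb2 f ->
  frac_lap alpha (S t f) x = S t (frac_lap alpha f) x.
Proof.
move=> t0 U2; have Uf := UCb2_UCb U2; have Ug := UCb_frac_lap_UCb2 U2.
apply: frac_lap_unique; first exact: UCb2_sg.
move=> e e0; have [r r0 h] := sg_generator HS U2 e0; exists r => // s sr y.
have s0 : 0 <= s by case/andP: sr => /ltW.
have -> : S s (S t f) y - S t f y + s * S t (frac_lap alpha f) y =
    S t (fun z => s * frac_lap alpha f z + (S s f z - f z)) y.
  rewrite (sg_lin HS)//; last by apply: UCbB => //; exact: UCb_sg.
  rewrite sgB//; last exact: UCb_sg.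
  by rewrite -!(sg_add HS)// [t + s]addrC; ring.
apply: sg_bound => //.
  by apply: UCb_lin => //; apply: UCbB => //; exact: UCb_sg.
by move=> z; rewrite addrC; exact: h.
Qed.

(** For g in [UCb2] the generator gives S_t g - g = O(t); the contraction property extends the
    continuity to uniform limits. *)
Lemma sg_continuous0 f (e : R) : UCb f -> 0 < e -> exists2 r, 0 < r &
  forall t, 0 <= t < r -> forall x, `|S t f x - f x| <= e.
Proof.
move=> Uf e0; have [g U2 [gf _ _]] := mollify_close Uf (ltac:(lra) : 0 < e / 3).
have Ug := UCb2_UCb U2.
have [M M0 gM] := UCb_bound (UCb_frac_lap_UCb2 U2).
have [r r0 h] := sg_generator HS U2 ltr01.
exists (Num.min r (e / 3 / (M + 1))).
  by rewrite lt_min r0 !divr_gt0// ltr_wpDl.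
move=> t /andP[]; rewrite le_eqVlt => /orP[/eqP <- _ x|t0].
  by rewrite (sg_zero HS)// subrr normr0 ltW.
rewrite lt_min => /andP[tr tM] x.
have -> : S t f x - f x = (S t f x - S t g x) + (S t g x - g x) + (g x - f x) by ring.
have -> : e = e / 3 + e / 3 + e / 3 by field.
rewrite (le_trans (ler_normD _ _))// lerD//.
rewrite (le_trans (ler_normD _ _))// lerD//.
  by apply: sg_diff => //; [exact: ltW|move=> y; rewrite distrC].
have -> : S t g x - g x = (S t g x - g x + t * frac_lap alpha g x) - t * frac_lap alpha g x by ring.
rewrite (le_trans (ler_normB _ _))// normrM (gtr0_norm t0).
move: tM; rewrite ltr_pdivlMr ?ltr_wpDl// mulrDr mulr1 => tM.
have h1 : `|S t g x - g x + t * frac_lap alpha g x| <= t * 1 by apply: h; rewrite t0.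
have h2 : t * `|frac_lap alpha g x| <= t * M by rewrite ler_wpM2l// ltW.
lra.
Qed.

Lemma frac_lap_cst (gamma c : R) x : frac_lap gamma (fun=> c) x = 0.
Proof.
rewrite /frac_lap (_ : frac_kernel gamma _ x = fun=> 0); last first.
  by apply/funext => y; rewrite /frac_kernel subrr mul0r.
have I0 D : \int[leb]_(y in D) (0 : R) = 0.
  rewrite Rintegral_mkcond (_ : _ \_ _ = fun=> 0) ?Rintegral_cst ?mul0r//.
  by apply/funext => y; rewrite patchE; case: ifP.
rewrite I0; case: ifP => _; first by rewrite oppr0.
rewrite (_ : (fun e => _) = fun=> 0); last by apply/funext => e; exact: I0.
by rewrite lim_cst ?oppr0//; exact: Rhausdorff.
Qed.

(** The integrand vanishes near the origin, so the truncated integrals are constant for small e and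
    the principal value is an ordinary integral. *)
Lemma frac_lap_off0 q (rho : R) : 0 < rho -> (forall y, enorm y <= rho -> q y = 0) ->
  frac_lap alpha q 0 = - \int[leb]_y (q y * ipow (d%:R + alpha) y).
Proof.
move=> rho0 q0; rewrite /frac_lap; congr (- _).
have -> : frac_kernel alpha q 0 = fun y => q y * ipow (d%:R + alpha) y.
  by apply/funext => y; rewrite /frac_kernel add0r (q0 0) ?subr0// enorm0 ltW.
case: ifP => // _; apply: lim_near_cst; first exact: Rhausdorff.
apply/right0_nearP; exists rho => // e /andP[e0 er].
rewrite Rintegral_mkcond; apply: eq_Rintegral => y _.
rewrite patchE; case: ifPn => // /negP ny.
rewrite q0 ?mul0r// leNgt; apply/negP => ye; apply: ny; apply/mem_set => /=.
exact: lt_trans ye.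
Qed.

Section elliptic.
Variables (q : V -> R) (rho : R).
Hypotheses (rho0 : 0 < rho) (U2q : UCb2 q) (q01 : forall y, 0 <= q y <= 1)
  (qsupp : forall y, enorm y <= rho -> q y = 0).

Let k y := q y * ipow (d%:R + alpha) y.
Variable lambda : R.
Hypotheses (k_L1 : L1_le k lambda) (lambdaE : lambda = \int[leb]_y k y).

Let lambda0 : 0 <= lambda. Proof. by case: k_L1. Qed.

(* At a maximum point of w the jumps weighted by [q] already give
   [A w <= int (w(x + y) - w x) k(y) dy]. *)
Lemma max_point_bound w x : UCb2 w -> (forall y, w y <= w x) ->
  lambda * w x <= frac_lap alpha w x + \int[leb]_y (w (x + y) * k y).
Proof.
move=> U2w wmax.
pose wx y := w (y + x); have U2x : UCb2 wx by exact: UCb2_shift.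
pose phi y := wx y * q y; have U2p : UCb2 phi by exact: UCb2M.
have U2m : UCb2 (fun y => -1 * q y + 1) := UCb2_lin (-1) U2q (UCb2_cst 1).
have U2v : UCb2 (fun y => -1 * phi y + wx y) := UCb2_lin (-1) U2p U2x.
(* Here u y = (w(x + y) - w x) (1 - q y), which is nonpositive and vanishes at the origin. It is
   spelled out as a linear combination of members of [UCb2] so that [frac_lap_lin] splits it. *)
pose u y := - w x * (-1 * q y + 1) + (-1 * phi y + wx y).
have U2u : UCb2 u := UCb2_lin (- w x) U2m U2v.
have u_le0 y : u y <= 0.
  have -> : u y = (wx y - w x) * (1 - q y) by rewrite /u /phi; ring.
  have /andP[_ q1] := q01 y.
  by rewrite mulr_le0_ge0// ?subr_ge0// subr_le0 wmax.
have u0 : u 0 = 0.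
  by rewrite /u /phi /wx qsupp ?enorm0 ?(ltW rho0)// add0r; ring.
have pmp : 0 <= frac_lap alpha u 0.
  (* Since S_t u <= 0 = u 0, the difference quotients at the origin are nonpositive. *)
  apply/ler_addgt0Pr => e e0; have [r r0 h] := sg_generator HS U2u e0.
  have tr : 0 < r / 2 < r by lra.
  have := h (r / 2) tr 0; rewrite u0 subr0 ler_norml => /andP[].
  have := @sg_le _ _ HS (r / 2) 0 u ltac:(lra) (UCb2_UCb U2u) u_le0 0.
  move=> a1 a2 _; have t0 : 0 < r / 2 by lra.
  rewrite -(ler_pM2l t0) mulr0 mulrDr; lra.
have E : frac_lap alpha u 0 = frac_lap alpha w x + \int[leb]_y (w (x + y) * k y) - lambda * w x.
  rewrite /u (frac_lap_lin (- w x) 0 U2m U2v) (frac_lap_lin (-1) 0 U2q (UCb2_cst 1)).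
  rewrite (frac_lap_lin (-1) 0 U2p U2x) frac_lap_shift add0r.
  rewrite (frac_lap_off0 rho0 qsupp) -/k -lambdaE.
  rewrite (frac_lap_off0 (q := phi) rho0); last by move=> y yr; rewrite /phi qsupp// mulr0.
  rewrite frac_lap_cst.
  rewrite (_ : \int[leb]_y (phi y * _) = \int[leb]_y (w (x + y) * k y)); first by ring.
  by apply: eq_Rintegral => y _; rewrite /phi /wx /k [y + x]addrC mulrA.
by move: pmp; rewrite E subr_ge0.
Qed.

(** The supremum of w need not be attained. Adding a bump of height dl at a point where w is within
    dl of its supremum produces a function whose maximum is attained in the unit cube around this
    point. [max_point_bound] applies to it, and the bump costs at most dl (mu + C + lambda). *)
Lemma elliptic_bound w (mu a B : R) : UCb2 w -> 0 < mu ->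
  (forall x, mu * w x + frac_lap alpha w x <= a) ->
  (forall x, \int[leb]_y (w (x + y) * k y) <= B) ->
  forall x, (mu + lambda) * w x <= a + B.
Proof.
move=> U2w mu0 Ha HB x; have Uw := UCb2_UCb U2w.
pose psi : V -> R := cubic_bump 0 1; have U2p : UCb2 psi by exact: UCb2_cubic_bump.
have p01 y : 0 <= psi y <= 1 by exact: bump_itv.
have [C C0 HC] := UCb_bound (UCb_frac_lap_UCb2 U2p).
have [M M0 wM] := UCb_bound Uw.
apply/ler_addgt0Pr => e e0.
have D0 : 0 < mu + C + lambda + 1 by move: (lambda0); lra.
pose dl := e / (mu + C + lambda + 1); have dl0 : 0 < dl by exact: divr_gt0.
have [x0 Hx0] : exists x0, forall y, w y <= w x0 + dl.
  have hs : has_sup (range w).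
    split; first by exists (w 0), 0.
    by exists M => _ [y _ <-]; exact: le_trans (ler_norm _) (wM y).
  have [_ [x0 _ <-] hx0] := sup_adherent dl0 hs.
  exists x0 => y; rewrite -lerBlDr; apply: le_trans (ltW hx0); rewrite lerB//.
  by apply: ub_le_sup; [case: hs|exists y].
pose v y := dl * psi (y - x0) + w y.
have U2s : UCb2 (fun y => psi (y - x0)) := UCb2_shift (- x0) U2p.
have U2v : UCb2 v := UCb2_lin dl U2s U2w.
have [x1 _ x1max] : exists2 c : V, c \in [set y : V | `|y - x0| <= 1] &
    forall t, t \in [set y : V | `|y - x0| <= 1] -> v t <= v c.
  apply: EVT_max_rV.
  - by exists x0; rewrite /= subrr normr0.
  - rewrite (_ : [set y : V | `|y - x0| <= 1] = [set y : V | forall i, `[x0 ord0 i - 1, x0 ord0 i + 1]%classic (y ord0 i)]).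
      apply: (@rV_compact R d (fun i => `[x0 ord0 i - 1, x0 ord0 i + 1]%classic)) => i.
      exact: segment_compact.
    apply/seteqP; split=> y /= H.
      move=> i; have := le_trans (normrV_coord (y - x0) i) H; rewrite !mxE ler_norml in_itv /=.
      by move=> /andP[? ?]; apply/andP; split; lra.
    apply: normrV_le => // i; rewrite !mxE ler_norml.
    by have := H i; rewrite /= in_itv /= => /andP[? ?]; apply/andP; split; lra.
  - exact/continuous_subspaceT/UCb_continuous/UCb2_UCb.
have v0 : v x0 = dl + w x0 by rewrite /v subrr /psi bump_center mulr1.
(* Outside the cube the bump vanishes, and there v = w <= w x0 + dl = v x0. *)
have vmax y : v y <= v x1.
  have [yc|yc] := leP `|y - x0| 1; first by apply: x1max; exact/mem_set.
  apply: le_trans (_ : v x0 <= _); last by apply: x1max; apply/mem_set; rewrite /= subrr normr0.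
  by rewrite v0 /v /psi bump_out ?subr0 ?(ltW yc)// mulr0 add0r addrC.
have wv : w x <= v x1.
  apply: le_trans (vmax x); rewrite /v lerDr mulr_ge0 ?(ltW dl0)//.
  by have /andP[] := p01 (x - x0).
have := max_point_bound U2v vmax.
rewrite /v (frac_lap_lin dl x1 U2s U2w) frac_lap_shift -/v => key.
have mw := UCb_measurable Uw; have mp := UCb_measurable (UCb2_UCb U2p).
have pb y : `|psi y| <= 1 by have /andP[? ?] := p01 y; rewrite ger0_norm.
have [I1 b1] := convol_bound (x1 - x0) mp pb k_L1.
have [I2 b2] := convol_bound x1 mw wM k_L1.
have split_int : \int[leb]_y ((dl * psi (x1 + y - x0) + w (x1 + y)) * k y) =
    dl * convol psi k (x1 - x0) + \int[leb]_y (w (x1 + y) * k y).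
  rewrite /convol -RintegralZl// -RintegralD//; last exact: integrable_rVZ.
  by apply: eq_Rintegral => y _; rewrite [x1 + y - x0]addrAC; ring.
move: key; rewrite split_int => key.
have b1' := le_trans (ler_norm _) b1.
have c1 : frac_lap alpha psi (x1 - x0) <= C := le_trans (ler_norm _) (HC _).
have := Ha x1; have := HB x1 => hB ha.
have /andP[_ p1] := p01 (x1 - x0).
move: c1 b1' ha hB key.
move: (frac_lap alpha psi _) (frac_lap alpha w x1) (convol psi k _) (\int[leb]_y _).
move=> fp fw cp iw c1 b1' ha hB key.
have : (mu + lambda) * v x1 <= a + B + dl * (mu + C + lambda).
  rewrite mulrDl; apply: le_trans (lerD (lexx _) key) _.
  rewrite {1}/v.
  have i1 : dl * psi (x1 - x0) <= dl by rewrite ler_piMr// ltW.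
  have i2 : mu * (dl * psi (x1 - x0)) <= mu * dl by rewrite ler_wpM2l// ltW.
  have i3 : dl * fp <= dl * C by rewrite ler_wpM2l// ltW.
  have i4 : dl * cp <= dl * (1 * lambda) by rewrite ler_wpM2l// ltW.
  move: i4; rewrite mul1r => i4; rewrite !mulrDr [dl * mu]mulrC; lra.
have i5 : (mu + lambda) * w x <= (mu + lambda) * v x1.
  by rewrite ler_wpM2l// addr_ge0// ltW.
move=> i6; apply: (le_trans i5); apply: (le_trans i6); rewrite lerD2l.
rewrite /dl -mulrA ler_piMr ?(ltW e0)// ler_pdivrMl// mulr1 lerDl//.
Qed.

End elliptic.

End stable_semigroup.

(** * Decay of the stable semigroup by implicit Euler steps *)

Section backward_euler.
Context {R : realType} {d : nat}.
Local Notation V := 'rV[R]_d.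
Local Notation leb := (@lebesgue_rV R d).
Variables (alpha : R) (S : R -> (V -> R) -> V -> R).
Hypothesis HS : stable_semigroup alpha S.
Variables (q : V -> R) (rho : R).
Hypotheses (rho0 : 0 < rho) (U2q : UCb2 q) (q01 : forall y, 0 <= q y <= 1)
  (qsupp : forall y, enorm y <= rho -> q y = 0).
Let k y := q y * ipow (d%:R + alpha) y.
Variable lambda : R.
Hypotheses (k_L1 : L1_le k lambda) (lambdaE : lambda = \int[leb]_y k y)
  (lambda_gt0 : 0 < lambda).
Variables (w0 : V -> R) (M0 B : R).
Hypotheses (U2w : UCb2 w0) (w0M : forall x, `|w0 x| <= M0) (B0 : 0 <= B)
  (HB : forall t x, 0 <= t -> \int[leb]_y (S t w0 (x + y) * k y) <= B).

Let U0 : UCb w0 := UCb2_UCb U2w.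
Let UA : UCb (frac_lap alpha w0) := UCb_frac_lap_UCb2 HS U2w.

(** The semigroup itself satisfies the implicit Euler relation up to an error e eta, and
    [elliptic_bound] with mu = 1 / e turns this relation into a gain 1 + e lambda per step. The
    threshold e0 does not depend on s, which permits iteration. *)
Let euler_step (eta : R) : 0 < eta -> exists2 e0 : R, 0 < e0 &
  forall e s m, 0 < e < e0 -> 0 <= s -> (forall x, S s w0 x <= m) ->
  forall x, (1 + e * lambda) * S (s + e) w0 x <= m + e * (eta + B).
Proof.
move=> eta0.
have [r r0 h1] := sg_generator HS U2w (ltac:(lra) : 0 < eta / 2).
have [r' r'0 h2] := sg_continuous0 HS UA (ltac:(lra) : 0 < eta / 2).
exists (Num.min r r'); first by rewrite lt_min r0.
move=> e s m /andP[e0]; rewrite lt_min => /andP[er er'] s0 Hm x.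
have Ue : UCb (S e w0) by apply: (UCb_sg HS) => //; exact: ltW.
have UeA : UCb (S e (frac_lap alpha w0)) by apply: (UCb_sg HS) => //; exact: ltW.
have se0 : 0 <= s + e by lra.
(* S_s D is the error of the Euler relation at time s, and S_s is a contraction; hence the
   uniformity in s. *)
pose D y := e * S e (frac_lap alpha w0) y + (S e w0 y - w0 y).
have UB : UCb (fun y => S e w0 y - w0 y) := UCbB Ue U0.
have UD : UCb D := UCb_lin e UeA UB.
have Db y : `|D y| <= e * eta.
  have -> : D y = (S e w0 y - w0 y + e * frac_lap alpha w0 y) +
     e * (S e (frac_lap alpha w0) y - frac_lap alpha w0 y) by rewrite /D; ring.
  rewrite (le_trans (ler_normD _ _))// [in leRHS](splitr eta) [leRHS]mulrDr lerD//.
    by apply: h1; rewrite e0.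
  by rewrite normrM (gtr0_norm e0) ler_wpM2l ?(ltW e0)// h2// er' ltW.
have SD y : e * frac_lap alpha (S (s + e) w0) y + S (s + e) w0 y - S s w0 y <= e * eta.
  have := sg_bound HS s0 UD Db y => /(le_trans (ler_norm _)).
  rewrite (sg_lin HS e y s0 UeA UB) (sgB HS y s0 Ue U0).
  rewrite -(sg_add HS y s0 (ltW e0) UA) -(sg_add HS y s0 (ltW e0) U0).
  by rewrite (frac_lap_sg HS y se0 U2w) addrA.
have U2e : UCb2 (S (s + e) w0) := UCb2_sg HS se0 U2w.
have ei : 0 < e^-1 by rewrite invr_gt0.
have := @elliptic_bound R d alpha S HS q rho rho0 U2q q01 qsupp lambda k_L1 lambdaE
  (S (s + e) w0) e^-1 (e^-1 * m + eta) B U2e ei.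
move=> /(_ _ _ x) H.
have {H} : (e^-1 + lambda) * S (s + e) w0 x <= e^-1 * m + eta + B.
  apply: H => [y|y]; last exact: HB.
  rewrite -(ler_pM2l e0) !mulrDr !mulrA divff ?gt_eqF// !mul1r.
  by have := SD y; have := Hm y; lra.
by rewrite -(ler_pM2l e0) !mulrDr !mulrA mulrDr divff ?gt_eqF// !mul1r addrA.
Qed.

(** (eta + B) / lambda is the fixed point of the recursion given by one step, and the excess over it
    is divided by 1 + e lambda each time. *)
Let euler_iterate (eta : R) : 0 < eta -> exists2 e0 : R, 0 < e0 &
  forall e n, 0 < e < e0 -> forall x,
    S (n%:R * e) w0 x <= M0 * ((1 + e * lambda) ^+ n)^-1 + (eta + B) / lambda.
Proof.
move=> eta0; have [e0 e00 step] := euler_step eta0; exists e0 => // e n ee.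
have ep : 0 < e by case/andP: ee.
have l1 : 0 < 1 + e * lambda by rewrite addr_gt0// mulr_gt0.
have q0 : 0 <= (eta + B) / lambda by rewrite divr_ge0 ?(ltW lambda_gt0)// addr_ge0// ltW.
elim: n => [|n IH] x.
  rewrite mul0r (sg_zero HS)// expr0 invr1 mulr1.
  by rewrite (le_trans (ler_norm _))// (le_trans (w0M x))// lerDl.
have H := step e (n%:R * e) _ ee (mulr_ge0 (ler0n _ _) (ltW ep)) IH x.
have -> : n.+1%:R * e = n%:R * e + e by rewrite -natr1; ring.
rewrite -(ler_pM2l l1); apply: (le_trans H).
rewrite le_eqVlt; apply/orP; left; apply/eqP; rewrite exprS.
by field; rewrite !gt_eqF// exprn_gt0.
Qed.

Let bernoulli (x : R) m : 0 <= x -> 1 + m%:R * x <= (1 + x) ^+ m.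
Proof.
move=> x0; elim: m => [|m IH]; first by rewrite mul0r addr0 expr0.
rewrite exprS -natr1; apply: (@le_trans _ _ ((1 + x) * (1 + m%:R * x))).
  by have m0 : 0 <= m%:R :> R by []; nra.
by rewrite ler_wpM2l// addr_ge0.
Qed.

(** The time t is cut into K blocks of m + 1 steps; Bernoulli's inequality bounds the gain of each
    block below by 1 + t lambda / K. The resulting power K stands in for exp(- lambda t). *)
Lemma backward_euler_bound (t : R) (K : nat) x : 0 < t -> (0 < K)%N ->
  S t w0 x <= M0 * ((1 + t * lambda / K%:R) ^+ K)^-1 + B / lambda.
Proof.
move=> t0 K0; have KR : 0 < K%:R :> R by rewrite ltr0n.
have M00 : 0 <= M0 := le_trans (normr_ge0 _) (w0M 0).
apply/ler_addgt0Pr => e e0.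
(* The tolerance eta = e lambda contributes exactly e after division by lambda. *)
have [e1 e10 H] := euler_iterate (mulr_gt0 e0 lambda_gt0).
have [m hm] : exists m : nat, t / K%:R / e1 < m.+1%:R.
  exists (Num.Def.archi_bound (t / K%:R / e1)).
  apply: lt_le_trans (archi_boundP _) _; first by rewrite !divr_ge0// ltW.
  by rewrite ler_nat.
have mR : 0 < m.+1%:R :> R by [].
pose ee := t / K%:R / m.+1%:R.
have ee0 : 0 < ee by rewrite !divr_gt0.
have eee : 0 < ee < e1.
  by rewrite ee0 /ee ltr_pdivrMr// [e1 * _]mulrC -ltr_pdivrMr.
have := H ee (m.+1 * K)%N eee x.
have -> : (m.+1 * K)%:R * ee = t by rewrite natrM /ee; field; rewrite !gt_eqF.
move=> /le_trans; apply; rewrite mulrDl mulfK ?gt_eqF// addrA [leLHS]addrAC lerD2r lerD2r.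
rewrite ler_wpM2l// lef_pV2 ?posrE ?exprn_gt0//; last 2 first.
- by rewrite addr_gt0// mulr_gt0.
- by rewrite addr_gt0// divr_gt0// mulr_gt0.
rewrite exprM lerXn2r// ?nnegrE.
- rewrite addr_ge0 ?ler01 ?divr_ge0 ?mulr_ge0 ?ler0n ?(ltW t0) ?(ltW lambda_gt0) ?(ltW KR)//.
- by rewrite exprn_ge0// addr_ge0// mulr_ge0 ?ltW.
apply: le_trans (bernoulli _ _); last by rewrite mulr_ge0 ?ltW.
by rewrite le_eqVlt; apply/orP; left; apply/eqP; rewrite /ee; field; rewrite !gt_eqF.
Qed.

End backward_euler.

(** * A smooth piece of the jump kernel *)

Section smoothing.
Context {R : realType} {d : nat} (d_gt0 : (0 < d)%N).
Local Notation V := 'rV[R]_d.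
Local Notation leb := (@lebesgue_rV R d).
Variable alpha : R.
Hypothesis alpha02 : 0 < alpha < 2.

Let alpha0 : 0 < alpha. Proof. by case/andP: alpha02. Qed.
Let p : R := d%:R + alpha.
Let p0 : 0 < p. Proof. by rewrite ltr_wpDl. Qed.
Let dR0 : 0 < d%:R :> R. Proof. by rewrite ltr0n. Qed.

(** From t^(-p) = s^(-p) exp(- p ln(t / s)), together with exp u >= 1 + u and ln u <= u - 1. *)
Let powRN_lip_ord (a s t : R) : 0 < a -> a <= s -> s <= t ->
  0 <= s `^ (- p) - t `^ (- p) <= p * a `^ (- p) / a * (t - s).
Proof.
move=> a0 as_ st; have s0 : 0 < s by exact: lt_le_trans as_.
have t0 : 0 < t by exact: lt_le_trans st.
have le_pow x y : 0 < x -> x <= y -> y `^ (- p) <= x `^ (- p).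
  move=> x0 xy; have y0 := lt_le_trans x0 xy.
  by rewrite !powRN lef_pV2 ?posrE ?powR_gt0// ge0_ler_powR ?nnegrE ?(ltW p0) ?(ltW x0) ?(ltW y0).
rewrite subr_ge0 le_pow//=.
have E : t `^ (- p) = s `^ (- p) * expR (- p * ln (t / s)).
  rewrite /powR !gt_eqF// -expRD; congr expR.
  by rewrite lnM ?posrE ?invr_gt0// lnV ?posrE//; ring.
have h1 : ln (t / s) <= t / s - 1.
  have := @le_ln1Dx R (t / s - 1); rewrite subrKC; apply.
  by rewrite ltrBrDr addNr divr_gt0.
have h2 := expR_ge1Dx (- p * ln (t / s)).
have sp := powR_gt0 (- p) s0.
have h3 : s `^ (- p) - t `^ (- p) <= s `^ (- p) * (p * (t / s - 1)).
  rewrite E -{1}(mulr1 (s `^ (- p))) -mulrBr ler_wpM2l ?(ltW sp)//.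
  have h4 : p * ln (t / s) <= p * (t / s - 1) by rewrite ler_wpM2l// ltW.
  lra.
apply: (le_trans h3).
have -> : s `^ (- p) * (p * (t / s - 1)) = p * s `^ (- p) / s * (t - s).
  by field; rewrite gt_eqF.
rewrite ler_wpM2r ?subr_ge0// ler_pM//.
- by rewrite mulr_ge0 ?powR_ge0 ?(ltW p0).
- by rewrite invr_ge0 ltW.
- by rewrite ler_wpM2l ?(ltW p0)// le_pow.
- by rewrite lef_pV2 ?posrE.
Qed.

Let powRN_lip (a s t : R) : 0 < a -> a <= s -> a <= t ->
  `|s `^ (- p) - t `^ (- p)| <= p * a `^ (- p) / a * `|s - t|.
Proof.
move=> a0 as_ at_; have [st|/ltW ts] := leP s t.
  have /andP[h1 h2] := powRN_lip_ord a0 as_ st.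
  by rewrite ger0_norm// [`|s - t|]distrC ger0_norm ?subr_ge0.
have /andP[h1 h2] := powRN_lip_ord a0 at_ ts.
by rewrite distrC ger0_norm// [`|s - t|]ger0_norm ?subr_ge0.
Qed.

Lemma ipow_lip (a : R) (x y : V) : 0 < a -> a <= `|x| -> a <= `|y| ->
  `|ipow p x - ipow p y| <= p * a `^ (- p) / a * (d%:R * `|x - y|).
Proof.
move=> a0 ax ay; rewrite /ipow -!powRN.
apply: (le_trans (powRN_lip a0 (le_trans ax (normrV_le_enorm x)) (le_trans ay (normrV_le_enorm y)))).
rewrite ler_wpM2l ?enorm_lip// mulr_ge0 ?invr_ge0 ?(ltW a0)// mulr_ge0 ?powR_ge0 ?(ltW p0)//.
Qed.

(* A smooth part of the jump kernel, living at distance of order rho from the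
   origin. *)
Lemma jump_kernel : exists c1 C2 : R, [/\ 0 < c1, 0 < C2 & forall rho : R, 0 < rho ->
  exists q : V -> R, [/\ UCb2 q, forall y, 0 <= q y <= 1,
    forall y, enorm y <= rho -> q y = 0 &
    let k y := q y * ipow p y in let lambda := \int[leb]_y k y in
    [/\ L1_le k lambda, c1 * rho `^ (- alpha) <= lambda &
      forall h : V, `|h| <= rho / 2 ->
        L1_le (fun y => k (y - h) - k y) (C2 * (`|h| / rho) * rho `^ (- alpha))]]].
Proof.
have d30 : 0 < 3 * d%:R :> R by rewrite mulr_gt0.
(* For c1: the weight is at least (3 d rho)^(-p) on the support of q, and the integral of q is at
   least (rho / 4)^d. For C2: a Lipschitz constant of k at distance at least rho / 2, where 6 d
   comes from the bump and 2 p d from the weight, times the volume (8 rho)^d of a cube outside which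
   the difference vanishes. *)
exists ((3 * d%:R) `^ (- p) * 4^-1 ^+ d), (2 `^ p * 8 ^+ d * (6 * d%:R + 2 * p * d%:R)).
split; first by rewrite mulr_gt0 ?powR_gt0// exprn_gt0.
  by rewrite !mulr_gt0 ?powR_gt0 ?exprn_gt0// addr_gt0 ?mulr_gt0.
(* The centre has max norm 2 rho, so the cube of half side rho around it lies in rho <= |y| <= 3
   rho. *)
move=> rho rho0; pose c : V := \row_i (2 * rho).
have cn : `|c| = 2 * rho.
  apply/eqP; rewrite eq_le; apply/andP; split.
    by apply: normrV_le => [|i]; rewrite ?mxE ?ger0_norm// mulr_ge0// ltW.
  have := normrV_coord c (Ordinal d_gt0); rewrite mxE ger0_norm// mulr_ge0// ltW//.
pose q := cubic_bump c rho; have U2q : UCb2 q by exact: UCb2_cubic_bump.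
have Uq := UCb2_UCb U2q; have mq := UCb_measurable Uq.
have q01 y : 0 <= q y <= 1 by exact: bump_itv.
have q_lo y : `|y| <= rho -> q y = 0.
  move=> yr; apply: bump_out => //.
  by have := ler_distD y c 0; rewrite !subr0 cn distrC; lra.
have q_hi y : 3 * rho <= `|y| -> q y = 0.
  move=> yr; apply: bump_out => //.
  by have := ler_distD c y 0; rewrite !subr0 cn; lra.
exists q; split=> //; first by move=> y yr; apply: q_lo; exact: le_trans (normrV_le_enorm y) yr.
move=> k lambda.
have qn y : `|q y| <= 1 by have /andP[? ?] := q01 y; rewrite ger0_norm.
have mk : measurable_fun setT k by apply: measurable_funM => //; exact: measurable_ipow.
have k0 y : 0 <= k y by rewrite mulr_ge0 ?ipow_ge0//; have /andP[] := q01 y.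
have kb y : `|k y| <= rho `^ (- p).
  have [yr|yr] := leP `|y| rho; first by rewrite /k q_lo// mul0r normr0 powR_ge0.
  rewrite normrM [X in _ * X]ger0_norm ?ipow_ge0//.
  rewrite (le_trans (ler_piMl _ _)) ?ipow_ge0//.
  by apply: ipow_le => //; exact: ltW.
have k_hi y : 3 * rho < `|y| -> k y = 0 by move=> yr; rewrite /k q_hi ?mul0r// ltW.
have r3 : 0 <= 3 * rho by rewrite mulr_ge0// ltW.
have Ik := L1_le_integrable (L1_le_cube mk r3 (powR_ge0 _ _) kb k_hi).
have l0 : 0 <= lambda by apply: Rintegral_ge0 => y _; exact: k0.
split.
- split=> //; rewrite /lambda /Rintegral fineK; last exact: integrable_fin_num.
  rewrite le_eqVlt; apply/orP; left; apply/eqP; apply: eq_integral => y _.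
  by rewrite ger0_norm.
- have [Iq qlow] := bump_integral_gt0 c rho0.
  have dr0 : 0 < 3 * d%:R * rho by rewrite mulr_gt0.
  apply: (@le_trans _ _ ((3 * d%:R * rho) `^ (- p) * \int[leb]_y q y)).
    apply: le_trans (ler_wpM2l (powR_ge0 _ _) qlow).
    rewrite (powRM _ (ltW d30) (ltW rho0)) -!mulrA ler_wpM2l ?powR_ge0//.
    rewrite mulrCA ler_wpM2l ?exprn_ge0//.
    rewrite /p opprD powRD; last by rewrite (gt_eqF rho0) implybT.
    rewrite (powRN rho d%:R) powR_mulrn ?(ltW rho0)// mulrAC mulVf ?mul1r//.
    by rewrite expf_neq0// gt_eqF.
  rewrite -RintegralZl//; apply: le_Rintegral => //; first exact: integrable_rVZ.
  move=> y _; have /andP[qy0 qy1] := q01 y.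
  have [yr|yr] := leP `|y| rho; first by rewrite /k q_lo// mulr0 mul0r.
  have [yr3|yr3] := leP (3 * rho) `|y|; first by rewrite /k q_hi// mulr0 mul0r.
  rewrite mulrC ler_wpM2l// /ipow powRN lef_pV2 ?posrE ?powR_gt0//; last first.
    by rewrite (lt_le_trans _ (normrV_le_enorm y))// (lt_trans rho0).
  rewrite ge0_ler_powR ?nnegrE ?(ltW p0) ?enorm_ge0 ?(ltW dr0)//.
  apply: (le_trans (enorm_le y)); rewrite -mulrA mulrCA ler_wpM2l// ltW//.
move=> h hr; set L := (rho / 2) `^ (- p) / rho * (6 * d%:R + 2 * p * d%:R).
have r2 : 0 < rho / 2 by lra.
have L0 : 0 <= L.
  by rewrite mulr_ge0 ?divr_ge0 ?powR_ge0 ?(ltW rho0)// addr_ge0 ?mulr_ge0 ?ltW.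
have -> : 2 `^ p * 8 ^+ d * (6 * d%:R + 2 * p * d%:R) * (`|h| / rho) * rho `^ (- alpha) =
   L * `|h| * (2 * (4 * rho)) ^+ d.
  have -> : 2 * (4 * rho) = 8 * rho by ring.
  rewrite exprMn /L.
  have -> : (rho / 2) `^ (- p) = 2 `^ p * rho `^ (- alpha) / rho ^+ d.
    rewrite powRM ?invr_ge0 ?(ltW rho0)// mulrC.
    rewrite -powR_inv1// -powRrM mulN1r opprK -mulrA; congr (_ * _).
    rewrite /p opprD powRD; last by rewrite (gt_eqF rho0) implybT.
    by rewrite (powRN rho d%:R) powR_mulrn ?(ltW rho0)// mulrC.
  by field; rewrite expf_neq0 ?gt_eqF.
have distL y : `|y| - `|h| <= `|y - h| := lerB_dist y h.
have distR y : `|y - h| <= `|y| + `|h| := ler_normB y h.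
apply: L1_le_cube.
- exact: (measurable_funB (measurableT_comp mk (measurable_shift (- h))) mk).
- by rewrite mulr_ge0// ltW.
- exact: mulr_ge0.
- move=> y; have dl := distL y; have dr := distR y.
  (* If both points have norm at most rho, both terms vanish; otherwise |h| <= rho / 2 puts both at
     distance at least rho / 2. *)
  suff core : rho / 2 <= `|y| -> rho / 2 <= `|y - h| -> `|k (y - h) - k y| <= L * `|h|.
    have [y1|y1] := leP `|y| rho; have [y2|y2] := leP `|y - h| rho; try by apply: core; lra.
    by rewrite /k !q_lo// !mul0r subrr normr0 mulr_ge0.
  move=> a1 a2.
  have -> : k (y - h) - k y = (q (y - h) - q y) * ipow p (y - h) +
         q y * (ipow p (y - h) - ipow p y) by rewrite /k; ring.
  have yh : y - h - y = - h by rewrite addrAC subrr add0r.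
  have e1 := bump_lip c (y - h) y rho0; rewrite yh normrN -/q in e1.
  have e2 := ipow_lip r2 a2 a1; rewrite yh normrN in e2.
  have e3 : ipow p (y - h) <= (rho / 2) `^ (- p) by apply: ipow_le => //; exact: ltW.
  rewrite (le_trans (ler_normD _ _))// !normrM [X in _ * X + _]ger0_norm ?ipow_ge0//.
  apply: (@le_trans _ _ (6 * d%:R / rho * `|h| * (rho / 2) `^ (- p) +
          1 * (p * (rho / 2) `^ (- p) / (rho / 2) * (d%:R * `|h|)))).
    by apply: lerD; apply: ler_pM => //; exact: ipow_ge0.
  by rewrite /L le_eqVlt; apply/orP; left; apply/eqP; field; rewrite gt_eqF.
- move=> y yr; have dl := distL y; rewrite !k_hi ?subrr//; lra.
Qed.

End smoothing.

(** * Hölder smoothing by the stable semigroup *)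

Section holder_smoothing.
Context {R : realType} {d : nat} (d_gt0 : (0 < d)%N).
Local Notation V := 'rV[R]_d.
Local Notation leb := (@lebesgue_rV R d).
Variable alpha : R.
Hypothesis alpha02 : 0 < alpha < 2.

(** Put v = |h|^(alpha/2) t^(-1/2) and rho = |h| / v. The kernel term is then of order (|h| / rho) F
    = v F, while t rho^(-alpha) = v^(-(2-alpha)), so that the decay factor is of order v^(K
    (2-alpha)). For v < 1 this is at most v as soon as K (2-alpha) >= 1, a choice that alpha < 2
    permits. *)
Lemma sg_smoothing : exists2 C : R, 0 < C & forall S, stable_semigroup alpha S ->
  forall (f : V -> R) (F t : R) (x h : V), UCb2 f -> (forall y, `|f y| <= F) -> 0 < t ->
  `|S t f (x + h) - S t f x| <= C * F * (`|h| `^ (alpha / 2) * t `^ (- 2^-1)).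
Proof.
have [c1 [C2 [c10 C20 HK]]] := jump_kernel d_gt0 alpha02.
have a2 : 0 < 2 - alpha by case/andP: alpha02; lra.
have [K K0 HKa] : exists2 K : nat, (0 < K)%N & 1 <= K%:R * (2 - alpha).
  exists (Num.Def.archi_bound (2 - alpha)^-1).+1 => //.
  rewrite -ler_pdivrMr// mul1r (le_trans (ltW (archi_boundP _)))//.
    by rewrite invr_ge0 ltW.
  by rewrite ler_nat.
have KR : 0 < K%:R :> R by rewrite ltr0n.
set D := 2 * (K%:R / c1) ^+ K + C2 / c1.
have D0 : 0 < D by rewrite addr_gt0 ?mulr_gt0 ?exprn_gt0 ?divr_gt0 ?invr_gt0.
exists (4 + D) => [|S HS]; first by rewrite addr_gt0.
suff one f F t x h : UCb2 f -> (forall y, `|f y| <= F) -> 0 < t ->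
    S t f (x + h) - S t f x <= (4 + D) * F * (`|h| `^ (alpha / 2) * t `^ (- 2^-1)).
  move=> f F t x h U2 fF t0; rewrite ler_norml; apply/andP; split; last exact: one.
  have Uf := UCb2_UCb U2.
  have nF y : `|- f y| <= F by rewrite normrN.
  have := one _ F t x h (UCb2N U2) nF t0; rewrite !(sgN HS _ (ltW t0) Uf); lra.
move=> U2 fF t0; have Uf := UCb2_UCb U2.
have F0 : 0 <= F := le_trans (normr_ge0 _) (fF 0).
have [->|h0] := eqVneq h 0.
  rewrite addr0 subrr; apply: mulr_ge0; last by rewrite mulr_ge0 ?powR_ge0.
  by apply: mulr_ge0 => //; lra.
have hp : 0 < `|h| by rewrite normr_gt0.
set v := `|h| `^ (alpha / 2) * t `^ (- 2^-1).
have v0 : 0 < v by rewrite mulr_gt0 ?powR_gt0.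
have Sb y := sg_bound HS (ltW t0) Uf fF y.
(* For v >= 1/2 the trivial bound 2 F <= 4 F v explains the 4 in the constant; v < 1/2 is what gives
   |h| <= rho / 2 below. *)
have [vbig|vsmall] := leP 2^-1 v.
  have : S t f (x + h) - S t f x <= 2 * F.
    rewrite (le_trans (ler_norm _))// (le_trans (ler_normB _ _))// mulrDl mul1r.
    by rewrite lerD.
  move=> /le_trans; apply; have DF : 0 <= D * F * v.
    exact: mulr_ge0 (mulr_ge0 (ltW D0) F0) (ltW v0).
  have h4 : 2 * F <= 4 * F * v by nra.
  rewrite [leRHS](_ : _ = 4 * F * v + D * F * v); [lra|ring].
pose rho := `|h| / v; have rho0 : 0 < rho by rewrite divr_gt0.
have hrho : `|h| / rho = v by rewrite /rho; field; rewrite !gt_eqF.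
have hr2 : `|h| <= rho / 2.
  by rewrite -hrho ltr_pdivrMr// in vsmall; lra.
have trho : t * rho `^ (- alpha) = v `^ (- (2 - alpha)).
  have v2 : v `^ (-2) = `|h| `^ (- alpha) * t.
    rewrite /v powRM ?powR_ge0// -!powRrM.
    rewrite (_ : alpha / 2 * -2 = - alpha); last by field.
    by rewrite (_ : - 2^-1 * -2 = 1) ?powRr1 ?(ltW t0)//; field.
  rewrite opprB addrC powRD; last by rewrite (gt_eqF v0) implybT.
  rewrite v2 /rho powRM ?invr_ge0 ?(ltW hp) ?(ltW v0)//.
  by rewrite -(powR_inv1 (ltW v0)) -powRrM mulN1r opprK; ring.
have [q [U2q q01 qsupp []]] := HK rho rho0.
set k := fun y => q y * ipow (d%:R + alpha) y; set lambda := \int[leb]_y k y => kL1 lam_lo kshift.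
have rp : 0 < rho `^ (- alpha) by rewrite powR_gt0.
have lam0 : 0 < lambda by apply: lt_le_trans lam_lo; rewrite mulr_gt0.
pose w0 y := f (y + h) - f y.
have Ufh := UCb_shift h Uf.
have U2w : UCb2 w0 := UCb2B (UCb2_shift h U2) U2.
have w0M y : `|w0 y| <= 2 * F.
  by rewrite (le_trans (ler_normB _ _))// mulrDl mul1r lerD.
have Sw s y : 0 <= s -> S s w0 y = S s f (y + h) - S s f y.
  by move=> s0; rewrite (sgB HS y s0 Ufh Uf) (sg_shift HS).
set l := C2 * (`|h| / rho) * rho `^ (- alpha).
have l0 : 0 <= l by rewrite !mulr_ge0 ?(ltW C20) ?(ltW rp) ?invr_ge0 ?(ltW rho0).
have HB s y : 0 <= s -> \int[leb]_z (S s w0 (y + z) * k z) <= F * l.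
  move=> s0; have Us := UCb_sg HS s0 Uf; have ms := UCb_measurable Us.
  have sF := sg_bound HS s0 Uf fF.
  have mk : measurable_fun setT k by case: kL1.
  have [I1 _] := convol_bound (y + h) ms sF kL1.
  have [I2 _] := convol_bound y ms sF kL1.
  have [I3 _] := convol_bound y ms sF (L1_le_shift (- h) kL1).
  have [I4 b4] := convol_bound y ms sF (kshift h hr2).
  apply: le_trans (le_trans (ler_norm _) b4).
  rewrite le_eqVlt; apply/orP; left; apply/eqP.
  transitivity (convol (S s f) k (y + h) - convol (S s f) k y).
    rewrite /convol -(RintegralB_rV I1 I2); apply: eq_Rintegral => z _.
    by rewrite Sw// mulrBl [y + z + h]addrAC.
  rewrite (convol_shiftr _ _ Us mk) /convol -(RintegralB_rV I3 I2); apply: eq_Rintegral => z _.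
  by rewrite mulrBr.
have := backward_euler_bound HS rho0 U2q q01 qsupp kL1 erefl lam0 U2w w0M
  (mulr_ge0 F0 l0) HB x t0 K0.
rewrite Sw ?(ltW t0)// => /le_trans; apply.
have b1 : F * l / lambda <= C2 / c1 * F * v.
  rewrite ler_pdivrMr// /l hrho.
  apply: (@le_trans _ _ (C2 / c1 * F * v * (c1 * rho `^ (- alpha)))).
    by rewrite le_eqVlt; apply/orP; left; apply/eqP; field; rewrite gt_eqF.
  rewrite ler_wpM2l//; apply: mulr_ge0 (ltW v0); apply: mulr_ge0 F0.
  by rewrite divr_ge0 ?(ltW C20) ?(ltW c10).
have tl : c1 * v `^ (- (2 - alpha)) <= t * lambda.
  by rewrite -trho mulrCA ler_wpM2l// ltW.
have b2 : ((1 + t * lambda / K%:R) ^+ K)^-1 <= (K%:R / c1) ^+ K * v.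
  have vv : v^-1 <= (v `^ (- (2 - alpha))) ^+ K.
    rewrite -powR_mulrn ?powR_ge0// -powRrM -(powR_inv1 (ltW v0)).
    have lnv : ln v <= 0 by rewrite ln_le0//; lra.
    rewrite /powR gt_eqF// ler_expR.
    have z0 : 0 <= (K%:R * (2 - alpha) - 1) * (- ln v) by rewrite mulr_ge0 ?subr_ge0 ?oppr_ge0.
    by rewrite -subr_ge0; move: z0; congr (0 <= _); ring.
  have y0 : 0 < c1 / K%:R * v `^ (- (2 - alpha)) by rewrite !mulr_gt0 ?powR_gt0 ?invr_gt0.
  have z0 : c1 / K%:R * v `^ (- (2 - alpha)) <= 1 + t * lambda / K%:R.
    by rewrite mulrAC; apply: le_trans (_ : t * lambda / K%:R <= _);
      [rewrite ler_wpM2r// invr_ge0 ltW|rewrite lerDr].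
  have e1 : (c1 / K%:R * v `^ (- (2 - alpha))) ^+ K <= (1 + t * lambda / K%:R) ^+ K.
    by rewrite lerXn2r// nnegrE ltW// (lt_le_trans y0).
  apply: (@le_trans _ _ ((c1 / K%:R * v `^ (- (2 - alpha))) ^+ K)^-1).
    by rewrite lef_pV2 ?posrE ?exprn_gt0// (lt_le_trans y0).
  rewrite exprMn invfM -exprVn invf_div ler_wpM2l ?exprn_ge0 ?divr_ge0 ?(ltW c10)//.
  rewrite -[leRHS]invrK lef_pV2 ?posrE ?invr_gt0 ?exprn_gt0 ?powR_gt0//.
have b3 : 2 * F * ((1 + t * lambda / K%:R) ^+ K)^-1 <= 2 * F * ((K%:R / c1) ^+ K * v).
  by rewrite ler_wpM2l// mulr_ge0.
apply: (le_trans (lerD b3 b1)); rewrite /D.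
have Fv : 0 <= F * v by rewrite mulr_ge0// ltW.
have -> : (4 + (2 * (K%:R / c1) ^+ K + C2 / c1)) * F * v =
  2 * F * ((K%:R / c1) ^+ K * v) + C2 / c1 * F * v + 4 * (F * v) by ring.
by rewrite lerDl mulr_ge0.
Qed.

End holder_smoothing.

(** * Perturbation of the stable semigroup *)

Section mean_value.
Context {R : realType}.
Implicit Types (phi psi : R -> R) (s t k : R).

Let nbhs0P (s r : R) : 0 < r -> \forall y \near s, `|y - s| < r.
Proof.
move=> r0; apply/nbhs_ballP; exists r => //= y.
by rewrite -ball_normE /= distrC.
Qed.

Lemma two_sided_derive phi (l s a b : R) : a < s -> s < b ->
  (forall e : R, 0 < e -> exists2 r : R, 0 < r & forall k, 0 < k < r -> s + k <= b ->
     `|phi (s + k) - phi s - k * l| <= e * k) ->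
  (forall e : R, 0 < e -> exists2 r : R, 0 < r & forall k, 0 < k < r -> a <= s - k ->
     `|phi s - phi (s - k) - k * l| <= e * k) ->
  is_derive s (1 : R) phi l.
Proof.
move=> as_ sb HR HL.
have cvgf : h^-1 *: ((phi \o shift s) (h *: (1 : R)) - phi s) @[h --> 0^'] --> l.
  apply/cvgrPdist_le => e e0; have [r r0 hr] := HR e e0; have [q q0 hq] := HL e e0.
  near=> h.
  have h0 : h != 0 by near: h; exact: nbhs_dnbhs_neq.
  have hm : `|h| < Num.min (Num.min r q) (Num.min (b - s) (s - a)).
    near: h; apply: nbhs_dnbhs.
    have m0 : 0 < Num.min (Num.min r q) (Num.min (b - s) (s - a)).
      by rewrite !lt_min r0 q0 !subr_gt0 as_ sb.
    by apply: filterS (nbhs0P 0 m0) => y; rewrite subr0.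
  move: hm; rewrite !lt_min => /andP[/andP[hr1 hq1] /andP[hb ha]].
  rewrite -(ler_pM2r (_ : 0 < `|h|)) ?normr_gt0// -normrM.
  rewrite /= [h *: 1]mulr1 [h + s]addrC.
  have -> : (l - h^-1 *: (phi (s + h) - phi s)) * h = - (phi (s + h) - phi s - h * l).
    by rewrite mulrBl opprB mulrAC mulVf// mul1r [l * h]mulrC.
  rewrite normrN; have [hp|hn] := ltP 0 h.
    rewrite (gtr0_norm hp) in hr1 hb *; apply: hr; [by rewrite hp|lra].
  have hn0 : h < 0 by rewrite lt_neqAle h0.
  rewrite (ltr0_norm hn0) in hq1 ha *.
  have := hq (- h); rewrite opprK => /(_ ltac:(lra) ltac:(lra)).
  by rewrite -normrN; congr (`| _ | <= _); ring.
by split; [apply/cvg_ex; exists l|exact/cvg_lim].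
Unshelve. all: by end_near. Qed.

Let is_derive_cmp (t s : R) : 0 < s < t ->
  is_derive s (1 : R) (fun s => Num.sqrt s - Num.sqrt (t - s))
    ((2 * Num.sqrt s)^-1 + (2 * Num.sqrt (t - s))^-1).
Proof.
move=> /andP[s0 st].
have d1 := is_derive1_sqrt s0.
have ts : 0 < t - s by rewrite subr_gt0.
have d2 := is_derive1_sqrt ts.
have d3 : is_derive s (1 : R) (fun s => t - s) (- 1).
  by have := is_deriveB (is_derive_cst t s (1 : R)) (is_derive_id s (1 : R)); rewrite sub0r.
have d4 : is_derive s (1 : R) (fun s => Num.sqrt (t - s)) (- (2 * Num.sqrt (t - s))^-1).
  have := @is_derive1_comp R Num.sqrt (fun s => t - s) s _ _ d2 d3.
  by rewrite mulrN1.
have := is_deriveB d1 d4; rewrite opprK; exact.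
Qed.

(* Equivalent to [sqrt t <= sqrt s + sqrt (t - s)]; it makes the comparison
   function elementary instead of an arcsine. *)
Let cmp_bound (s t : R) : 0 < s < t ->
  (Num.sqrt s * Num.sqrt (t - s))^-1 <=
  2 / Num.sqrt t * ((2 * Num.sqrt s)^-1 + (2 * Num.sqrt (t - s))^-1).
Proof.
move=> /andP[s0 st]; have ts : 0 < t - s by rewrite subr_gt0.
have t0 : 0 < t := lt_trans s0 st.
have p1 : 0 < Num.sqrt s by rewrite sqrtr_gt0.
have p2 : 0 < Num.sqrt (t - s) by rewrite sqrtr_gt0.
have p3 : 0 < Num.sqrt t by rewrite sqrtr_gt0.
have sub : Num.sqrt t <= Num.sqrt s + Num.sqrt (t - s).
  have h0 : 0 <= Num.sqrt s * Num.sqrt (t - s) by rewrite mulr_ge0// ltW.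
  rewrite -(@ler_pXn2r _ 2) ?nnegrE ?(ltW p3) ?addr_ge0 ?(ltW p1) ?(ltW p2)//.
  rewrite sqrrD (sqr_sqrtr (ltW s0)) (sqr_sqrtr (ltW ts)) (sqr_sqrtr (ltW t0)) mulr2n; lra.
have -> : 2 / Num.sqrt t * ((2 * Num.sqrt s)^-1 + (2 * Num.sqrt (t - s))^-1) =
  (Num.sqrt s * Num.sqrt (t - s))^-1 * ((Num.sqrt s + Num.sqrt (t - s)) / Num.sqrt t).
  by field; rewrite !gt_eqF.
by rewrite ler_peMr ?invr_ge0 ?mulr_ge0 ?(ltW p1) ?(ltW p2)// ler_pdivlMr// mul1r.
Qed.

(** Subtracting G(s) = (2 B / sqrt t) (sqrt s - sqrt(t-s)) leaves a nonincreasing function, and G t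
    - G 0 = 4 B. *)
Let one_sided phi phi' (t B : R) : 0 < t ->
  (forall s, 0 < s < t -> is_derive s (1 : R) phi (phi' s)) ->
  phi s @[s --> 0^'+] --> phi 0 -> phi s @[s --> t^'-] --> phi t ->
  (forall s, 0 < s < t -> phi' s <= B / (Num.sqrt s * Num.sqrt (t - s))) -> 0 <= B ->
  phi t - phi 0 <= 4 * B.
Proof.
move=> t0 dphi cr cl Hb B0.
have p3 : 0 < Num.sqrt t by rewrite sqrtr_gt0.
pose G s := 2 * B / Num.sqrt t * (Num.sqrt s - Num.sqrt (t - s)).
pose chi s := phi s - G s.
have dG s : 0 < s < t -> is_derive s (1 : R) G
    (2 * B / Num.sqrt t * ((2 * Num.sqrt s)^-1 + (2 * Num.sqrt (t - s))^-1)).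
  by move=> st; have := is_deriveZ (2 * B / Num.sqrt t) (is_derive_cmp st).
have dchi s : 0 < s < t -> is_derive s (1 : R) chi (phi' s -
    2 * B / Num.sqrt t * ((2 * Num.sqrt s)^-1 + (2 * Num.sqrt (t - s))^-1)).
  by move=> st; exact: (is_deriveB (dphi s st) (dG s st)).
have cG : continuous G.
  move=> s; apply: cvgM; first exact: cvg_cst.
  apply: cvgB; first exact: sqrt_continuous.
  apply: (@cvg_comp _ _ _ (fun s => t - s) Num.sqrt); last exact: sqrt_continuous.
  by apply: cvgB; [exact: cvg_cst|exact: cvg_id].
have : chi t <= chi 0.
  apply: (@ler0_derive1_nincr R chi 0 t) => //; last exact: ltW.
  - by move=> s; rewrite in_itv /= => st; have [] := dchi s st.
  - move=> s; rewrite in_itv /= => st; have dc := dchi s st.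
    rewrite derive1E (@derive_val _ _ _ _ _ _ _ dc) subr_le0.
    apply: (le_trans (Hb s st)); rewrite [2 * B]mulrC -!mulrA ler_wpM2l//.
    by have := cmp_bound st; rewrite -!mulrA.
  - apply/continuous_within_itvP => //; split.
    + move=> s; rewrite in_itv /= => st.
      by have [df _] := dchi s st; apply/differentiable_continuous/derivable1_diffP.
    + by apply: cvgB => //; apply: cvg_at_right_filter; exact: cG.
    + by apply: cvgB => //; apply: cvg_at_left_filter; exact: cG.
rewrite /chi /G subr0 subrr sqrtr0 !subr0 sub0r => h.
have e1 : 2 * B / Num.sqrt t * Num.sqrt t = 2 * B by rewrite divfK// gt_eqF.
by move: h; rewrite mulrN e1; lra.
Qed.

(** The integral of 1 / (sqrt s sqrt(t-s)) over (0, t) is pi for every t; the comparison function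
    gives 4 instead. At the end points the one-sided estimates serve only for continuity. *)
Lemma difference_bound phi phi' (t B : R) : 0 < t -> 0 <= B ->
  (forall s, 0 <= s < t -> forall e : R, 0 < e -> exists2 r : R, 0 < r &
     forall k, 0 < k < r -> s + k <= t -> `|phi (s + k) - phi s - k * phi' s| <= e * k) ->
  (forall s, 0 < s <= t -> forall e : R, 0 < e -> exists2 r : R, 0 < r &
     forall k, 0 < k < r -> 0 <= s - k -> `|phi s - phi (s - k) - k * phi' s| <= e * k) ->
  (forall s, 0 < s < t -> `|phi' s| <= B / (Num.sqrt s * Num.sqrt (t - s))) ->
  `|phi t - phi 0| <= 4 * B.
Proof.
move=> t0 B0 HR HL Hb.
have dphi s : 0 < s < t -> is_derive s (1 : R) phi (phi' s).
  move=> /andP[s0 st]; apply: (@two_sided_derive _ _ _ 0 t) => //.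
  - by apply: HR; rewrite (ltW s0).
  - by apply: HL; rewrite s0 ltW.
have small (e l : R) : 0 < e -> exists2 r, 0 < r & forall k, 0 < k < r -> (1 + `|l|) * k <= e.
  move=> e0; have p : 0 < 1 + `|l| by rewrite ltr_pwDl.
  exists (e / (1 + `|l|)) => [|k /andP[k0 kr]]; first exact: divr_gt0.
  by move: kr; rewrite ltr_pdivlMr// mulrC => /ltW.
have cr : phi s @[s --> 0^'+] --> phi 0.
  apply/cvgrPdist_le => e e0.
  have [r r0 h] := HR 0 ltac:(by rewrite lexx) 1 ltr01.
  have [q q0 hq] := small e (phi' 0) e0.
  apply/right0_nearP; exists (Num.min t (Num.min r q)); first by rewrite !lt_min t0 r0.
  move=> k /andP[k0]; rewrite !lt_min => /and3P[kt kr kq].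
  have := h k; rewrite k0 kr add0r (ltW kt) => /(_ isT isT) h1.
  rewrite distrC; apply: le_trans (hq k _); last by rewrite k0.
  have -> : phi k - phi 0 = (phi k - phi 0 - k * phi' 0) + k * phi' 0 by ring.
  by rewrite (le_trans (ler_normD _ _))// [leRHS]mulrDl lerD// normrM (gtr0_norm k0) mulrC.
have cl : phi s @[s --> t^'-] --> phi t.
  apply/cvgrPdist_le => e e0.
  have [r r0 h] := HL t ltac:(by rewrite t0 lexx) 1 ltr01.
  have [q q0 hq] := small e (phi' t) e0.
  apply/nbhs_ballP; exists (Num.min t (Num.min r q)); first by rewrite /= !lt_min t0 r0.
  move=> s /=; rewrite -ball_normE /= => sr st.
  have k0 : 0 < t - s by rewrite subr_gt0.
  move: sr; rewrite (gtr0_norm k0) !lt_min => /and3P[kt kr kq].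
  have := h (t - s); rewrite k0 kr subKr => /(_ isT ltac:(lra)) h1.
  apply: le_trans (hq (t - s) _); last by rewrite k0.
  have -> : phi t - phi s = (phi t - phi s - (t - s) * phi' t) + (t - s) * phi' t by ring.
  by rewrite (le_trans (ler_normD _ _))// [leRHS]mulrDl lerD// normrM (gtr0_norm k0) mulrC.
rewrite ler_norml; apply/andP; split; last first.
  apply: (@one_sided _ phi') => // s st; exact: le_trans (ler_norm _) (Hb s st).
rewrite lerNl opprB.
have := @one_sided (fun s => - phi s) (fun s => - phi' s) t B t0.
rewrite opprK addrC; apply => //.
- by move=> s st; exact: (is_deriveN (dphi s st)).
- exact: cvgN.
- exact: cvgN.
- by move=> s st; apply: le_trans (Hb s st); rewrite -normrN ler_norm.
Qed.

End mean_value.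

(** * Duhamel formula *)

Section perturbation.
Context {R : realType} {d : nat}.
Local Notation V := 'rV[R]_d.
Implicit Types (f g v : V -> R) (x y h : V).

(** What the perturbation uses of P. In contrast to S, no commutation with translations is assumed;
    the generator is described on [UCb2], which P may leave. *)
Record contraction_semigroup (L : (V -> R) -> V -> R) (P : R -> (V -> R) -> V -> R) : Prop := {
  ct_UCb : forall (t : R) f, 0 <= t -> UCb f -> UCb (P t f) ;
  ct_lin : forall (t a : R) f g x, 0 <= t -> UCb f -> UCb g ->
    P t (fun y => a * f y + g y) x = a * P t f x + P t g x ;
  ct_bound : forall (t M : R) f, 0 <= t -> UCb f -> (forall x, `|f x| <= M) ->
    forall x, `|P t f x| <= M ;
  ct_zero : forall f, UCb f -> P 0 f = f ;
  ct_add : forall (s t : R) f, 0 <= s -> 0 <= t -> UCb f -> P (s + t) f = P s (P t f) ;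
  ct_continuous : forall f, UCb f -> forall e : R, 0 < e -> exists2 r : R, 0 < r &
    forall t, 0 < t < r -> forall x, `|P t f x - f x| <= e ;
  ct_generator_UCb : forall f, UCb2 f -> UCb (L f) ;
  ct_generator : forall f, UCb2 f -> forall e : R, 0 < e -> exists2 r : R, 0 < r &
    forall t, 0 < t < r -> forall x, `|P t f x - f x - t * L f x| <= t * e }.

Variables (alpha : R) (L : (V -> R) -> V -> R) (S P : R -> (V -> R) -> V -> R).
Hypotheses (HS : stable_semigroup alpha S) (HP : contraction_semigroup L P).

Lemma ctB (t : R) f g x : 0 <= t -> UCb f -> UCb g ->
  P t (fun y => f y - g y) x = P t f x - P t g x.
Proof.
move=> t0 Uf Ug; have := ct_lin HP (-1) x t0 Ug Uf.
by under eq_fun do rewrite mulN1r addrC; rewrite mulN1r addrC.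
Qed.

Let A f x := - frac_lap alpha f x.
(** For the generator of the equation this is |b|^beta (-Delta)^(beta/2) f. *)
Let G f x := A f x - L f x.

Let UA f : UCb2 f -> UCb (A f).
Proof. by move=> U2; exact: UCbN (UCb_frac_lap_UCb2 HS U2). Qed.

Let UG f : UCb2 f -> UCb (G f).
Proof. by move=> U2; exact: UCbB (UA U2) (ct_generator_UCb HP U2). Qed.

Let sg_gen f : UCb2 f -> forall e : R, 0 < e -> exists2 r : R, 0 < r &
    forall t, 0 < t < r -> forall x, `|S t f x - f x - t * A f x| <= t * e.
Proof.
move=> U2 e /(sg_generator HS U2)[r r0 h]; exists r => // t tr x.
by rewrite /A mulrN opprK; exact: h.
Qed.

Let sg_A (t : R) f x : 0 <= t -> UCb2 f -> A (S t f) x = S t (A f) x.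
Proof.
move=> t0 U2; have UF := UCb_frac_lap_UCb2 HS U2.
by rewrite /A (frac_lap_sg HS x t0 U2) -(sgN HS x t0 UF).
Qed.

(* One-sided difference quotients of s |-> P_(t-s) (S_s f). The generator of P
   is only ever applied to S_s f, which stays in UCb2, whereas P_s f may not. *)
Lemma duhamel_right f (s t e : R) : UCb2 f -> 0 <= s -> s < t -> 0 < e ->
  exists2 r : R, 0 < r & forall k, 0 < k < r -> s + k <= t -> forall x,
    `|P (t - (s + k)) (S (s + k) f) x - P (t - s) (S s f) x - k * P (t - s) (G (S s f)) x|
      <= e * k.
Proof.
move=> U2 s0 st e0; have Uf := UCb2_UCb U2.
have e3 : 0 < e / 3 by lra.
set v := S s f; have U2v : UCb2 v := UCb2_sg HS s0 U2; have Uv := UCb2_UCb U2v.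
have UGv := UG U2v.
have [r1 r10 h1] := sg_gen U2v e3; have [r2 r20 h2] := ct_generator HP U2v e3.
have [r3 r30 h3] := ct_continuous HP UGv e3.
exists (Num.min r1 (Num.min r2 r3)); first by rewrite !lt_min r10 r20.
move=> k /andP[k0]; rewrite !lt_min => /and3P[k1 k2 k3] skt x.
have tau0 : 0 <= t - (s + k) by rewrite subr_ge0.
have k0' := ltW k0.
have -> : S (s + k) f = S k v by apply/funext => y; rewrite addrC (sg_add HS).
have -> : t - s = (t - (s + k)) + k by ring.
have USk := UCb_sg HS k0' Uv; have UPk := ct_UCb HP k0' Uv.
have UPG := ct_UCb HP k0' UGv.
rewrite !(ct_add HP tau0 k0')//.
have -> : P (t - (s + k)) (S k v) x - P (t - (s + k)) (P k v) x -
    k * P (t - (s + k)) (P k (G v)) x =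
  P (t - (s + k)) (fun y => - k * P k (G v) y + (S k v y - P k v y)) x.
  by rewrite (ct_lin HP (- k) x tau0 UPG (UCbB USk UPk)) (ctB x tau0 USk UPk); ring.
apply: (ct_bound HP tau0 (UCb_lin (- k) UPG (UCbB USk UPk))) => y.
have -> : - k * P k (G v) y + (S k v y - P k v y) =
  (S k v y - v y - k * A v y) - (P k v y - v y - k * L v y) - k * (P k (G v) y - G v y).
  by rewrite /G; ring.
have a1 := h1 k ltac:(by rewrite k0) y; have a2 := h2 k ltac:(by rewrite k0) y.
have a3 := h3 k ltac:(by rewrite k0) y.
rewrite (le_trans (ler_normB _ _))//.
have b1 := ler_normB (S k v y - v y - k * A v y) (P k v y - v y - k * L v y).
have b3 : `|k * (P k (G v) y - G v y)| <= k * (e / 3) by rewrite normrM (gtr0_norm k0) ler_wpM2l.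
lra.
Qed.

(** Here u = S_(s-k) f varies with k, and the generator estimate for P has no rate uniform over such
    functions. It is transferred to the fixed v = S_s f by writing u = v - k A v - z0 with z0 of
    order e k. *)
Lemma duhamel_left f (s t e : R) : UCb2 f -> 0 < s -> s <= t -> 0 < e ->
  exists2 r : R, 0 < r & forall k, 0 < k < r -> 0 <= s - k -> forall x,
    `|P (t - s) (S s f) x - P (t - (s - k)) (S (s - k) f) x - k * P (t - s) (G (S s f)) x|
      <= e * k.
Proof.
move=> U2 s0 st e0; have Uf := UCb2_UCb U2.
have e6 : 0 < e / 8 by lra.
have UAf := UA U2; have s0' := ltW s0.
set v := S s f; have U2v : UCb2 v := UCb2_sg HS s0' U2; have Uv := UCb2_UCb U2v.
have UGv := UG U2v; have UAv := UA U2v.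
have [r1 r10 h1] := sg_gen U2 e6; have [r2 r20 h2] := ct_generator HP U2v e6.
have [r3 r30 h3] := ct_continuous HP UAv e6.
have [r4 r40 h4] := sg_continuous0 HS UAf e6.
exists (Num.min (Num.min r1 r4) (Num.min r2 r3)); first by rewrite !lt_min r10 r20 r40.
move=> k /andP[k0]; rewrite !lt_min => /andP[/andP[k1 k4] /andP[k2 k3]] sk x.
have ts : 0 <= t - s by rewrite subr_ge0.
have k0' := ltW k0.
set u := S (s - k) f; have Uu : UCb u := UCb_sg HS sk Uf.
have -> : t - (s - k) = t - s + k by ring.
have USk := UCb_sg HS k0' Uf; have USA := UCb_sg HS k0' UAf.
have UPu := ct_UCb HP k0' Uu.
rewrite (ct_add HP ts k0' Uu).
have -> : P (t - s) v x - P (t - s) (P k u) x - k * P (t - s) (G v) x =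
  P (t - s) (fun y => - k * G v y + (v y - P k u y)) x.
  by rewrite (ct_lin HP (- k) x ts UGv (UCbB Uv UPu)) (ctB x ts Uv UPu); ring.
apply: (ct_bound HP ts (UCb_lin (- k) UGv (UCbB Uv UPu))) => y.
have vE z : v z = S (s - k) (S k f) z by rewrite -(sg_add HS z sk k0' Uf) subrK.
have AE z : A v z = S (s - k) (S k (A f)) z.
  by rewrite (sg_A z s0' U2) -(sg_add HS z sk k0' UAf) subrK.
pose z0 w := - k * A v w + (v w - u w).
have UvU : UCb (fun w => v w - u w) := UCbB Uv Uu.
have Uz : UCb z0 := UCb_lin (- k) UAv UvU.
have zb w : `|z0 w| <= 2 * (e / 8) * k.
  (* z0 is the image under S_(s-k) of q, the remainder at time 0; hence its bound does not involve s
     - k. *)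
  pose q w := (S k f w - f w) - k * S k (A f) w.
  have Uq : UCb q := UCbB (UCbB USk Uf) (UCbZ k USA).
  have -> : z0 w = S (s - k) q w.
    rewrite (sgB HS w sk (UCbB USk Uf) (UCbZ k USA)) (sgB HS w sk USk Uf) /z0 AE vE.
    have := sg_lin HS k w sk USA (UCb_cst 0); under eq_fun do rewrite addr0.
    move=> ->.
    have -> : S (s - k) (fun=> 0) w = 0.
      by have := sgB HS w sk (UCb_cst 0) (UCb_cst 0); rewrite !subrr.
    by rewrite /u; ring.
  apply: (sg_bound HS sk Uq) => z.
  have -> : q z = (S k f z - f z - k * A f z) - k * (S k (A f) z - A f z) by rewrite /q; ring.
  have a1 := h1 k ltac:(by rewrite k0) z; have a4 := h4 k ltac:(by rewrite k0') z.
  rewrite (le_trans (ler_normB _ _))// normrM (gtr0_norm k0).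
  have := ler_wpM2l k0' a4; lra.
have PE : P k u y = P k v y - (P k z0 y + k * P k (A v) y).
  have := ctB y k0' Uv UvU; rewrite (_ : (fun _ => _) = u); last first.
    by apply/funext => w; ring.
  move=> ->; congr (_ - _).
  have := ct_lin HP (- k) y k0' UAv UvU; rewrite -/z0 => ->; ring.
have -> : - k * G v y + (v y - P k u y) =
  z0 y - (P k v y - v y - k * L v y) + (P k z0 y - z0 y) + k * (P k (A v) y - A v y)
  by rewrite PE /G; ring.
have a2 := h2 k ltac:(by rewrite k0) y; have a3 := h3 k ltac:(by rewrite k0) y.
have Pz := ct_bound HP k0' Uz zb y; have zy := zb y.
have b1 := ler_normD (z0 y - (P k v y - v y - k * L v y) + (P k z0 y - z0 y)) (k * (P k (A v) y - A v y)).
have b2 := ler_normD (z0 y - (P k v y - v y - k * L v y)) (P k z0 y - z0 y).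
have b3 := ler_normB (z0 y) (P k v y - v y - k * L v y).
have b4 := ler_normB (P k z0 y) (z0 y).
have b5 : `|k * (P k (A v) y - A v y)| <= k * (e / 8) by rewrite normrM (gtr0_norm k0) ler_wpM2l.
lra.
Qed.

End perturbation.

(** * Transfer of the Hölder estimate to the perturbed semigroup *)

Section regularization.
Context {R : realType} {d : nat} (d_gt0 : (0 < d)%N).
Local Notation V := 'rV[R]_d.
Implicit Types (f g : V -> R) (x y h : V).
Variables alpha beta : R.
Hypotheses (alpha02 : 0 < alpha < 2) (beta_lt : 0 < beta < alpha / 2).

Let beta0 : 0 < beta. Proof. by case/andP: beta_lt. Qed.
Let beta_theta : beta < alpha / 2. Proof. by case/andP: beta_lt. Qed.
Let theta1 : alpha / 2 <= 1. Proof. by case/andP: alpha02 => _ ?; rewrite ler_pdivrMr// mul1r ltW. Qed.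

Lemma powRN12_sqrt (t : R) : 0 <= t -> t `^ (- 2^-1) = (Num.sqrt t)^-1.
Proof. by move=> t0; rewrite powRN powR12_sqrt. Qed.

(* [frac_lap_holder_bound] with the radius s^(1/(2 beta)). *)
Lemma frac_lap_sqrt_bound (C : R) : 0 <= C -> exists2 K, 0 < K & forall g (F s : R),
  UCb g -> (forall x, `|g x| <= F) -> 0 < s <= 1 ->
  holder (alpha / 2) (C * F / Num.sqrt s) g ->
  forall x, `|frac_lap beta g x| <= K * F / Num.sqrt s.
Proof.
move=> C0; have [K K0 b] := @frac_lap_holder_bound R d d_gt0 beta (alpha / 2) beta0 beta_theta theta1.
exists (K * (C + 1)) => [|g F s Ug gF /andP[s0 s1] gH x].
  by rewrite mulr_gt0// ltr_wpDl.
have F0 : 0 <= F := le_trans (normr_ge0 _) (gF 0).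
have sq0 : 0 < Num.sqrt s by rewrite sqrtr_gt0.
have b2 : 0 < 2 * beta by rewrite mulr_gt0.
pose r := s `^ (2 * beta)^-1; have r0 : 0 < r by rewrite powR_gt0.
have H0 : 0 <= C * F / Num.sqrt s by rewrite !mulr_ge0 ?invr_ge0 ?(ltW sq0).
have [_ /le_trans] := b g F _ r Ug gF H0 gH r0 x; apply.
have -> : r `^ (- beta) = (Num.sqrt s)^-1.
  rewrite /r -powRrM -powRN12_sqrt ?(ltW s0)//; congr (_ `^ _).
  by field; rewrite gt_eqF.
have r1 : r `^ (alpha / 2 - beta) <= 1.
  rewrite /r -powRrM -[leRHS](powRr0 s); apply: ger_powR; first by rewrite s0.
  by rewrite mulr_ge0 ?invr_ge0 ?(ltW b2)// subr_ge0 ltW.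
have -> : K * (C + 1) * F / Num.sqrt s =
  K * (C * F / Num.sqrt s * 1 + F / Num.sqrt s) by ring.
by rewrite ler_wpM2l ?(ltW K0)// lerD2r ler_wpM2l.
Qed.

(** The constants precede b, T and the semigroups, so they depend on b in no way; b enters only
    through the condition on T. Both conclusions are stated together because the second constant is
    chosen for Hölder functions of constant 2 C F / sqrt s. *)
Lemma holder_regularization : exists C C3 : R, [/\ 0 < C, 0 < C3,
  forall g (F s : R), UCb g -> (forall x, `|g x| <= F) -> 0 < s <= 1 ->
    holder (alpha / 2) (2 * C * F / Num.sqrt s) g ->
    forall x, `|frac_lap beta g x| <= C3 * F / Num.sqrt s &
  forall (b : V -> R) (cbar T : R) (S P : R -> (V -> R) -> V -> R),
    stable_semigroup alpha S -> contraction_semigroup (sde_generator alpha beta b) P ->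
    (forall x, `|b x| `^ beta <= cbar) -> 0 < T <= 1 -> Num.sqrt T * (8 * cbar * C3) <= 1 ->
    forall f (F t : R), UCb f -> (forall x, `|f x| <= F) -> 0 < t <= T ->
      holder (alpha / 2) (2 * C * F / Num.sqrt t) (P t f)].
Proof.
have [C C0 smooth] := sg_smoothing d_gt0 alpha02.
have C20 : 0 <= 2 * C by rewrite mulr_ge0// ltW.
have [K K0 lapK] := frac_lap_sqrt_bound C20.
exists C, K; split=> // b cbar T S P HS HP bc /andP[T0 T1] HT f0 F0 t0 Uf0 f0F t0T x0 h.
have cbar0 : 0 <= cbar by apply: le_trans (bc 0); exact: powR_ge0.
set Hh := `|h| `^ (alpha / 2).
have Hh0 : 0 <= Hh by exact: powR_ge0.
(* The trivial bound m = 2 on the increments of P_s is improved by the Duhamel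
   formula, which turns a bound m into C |h|^(alpha/2) + m / 2; no regularity of
   P_s f is needed to start. *)
pose Q (m : R) := forall g (F s : R) y, UCb g -> (forall x, `|g x| <= F) -> 0 < s <= T ->
  `|P s g (y + h) - P s g y| <= m * F / Num.sqrt s.
have Q2 : Q 2.
  move=> g F s y Ug gF /andP[s0 sT].
  have F_0 : 0 <= F := le_trans (normr_ge0 _) (gF 0).
  have Pb := ct_bound HP (ltW s0) Ug gF.
  have sq0 : 0 < Num.sqrt s by rewrite sqrtr_gt0.
  have sq1 : Num.sqrt s <= 1 by rewrite -sqrtr1 ler_sqrt ?(le_trans sT)// ltW.
  rewrite (le_trans (ler_normB _ _))// ler_pdivlMr// mulrC.
  apply: (@le_trans _ _ (1 * (2 * F))); last by rewrite mul1r.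
  by rewrite ler_pM ?addr_ge0 ?(ltW sq0)// mulrDl mul1r lerD.
have Qstep m : 0 <= m -> Q m -> Q (C * Hh + m / 2).
  move=> m0 Qm.
  have smoothcase g F t y : UCb2 g -> (forall x, `|g x| <= F) -> 0 < t <= T ->
      `|P t g (y + h) - P t g y| <= (C * Hh + m / 2) * F / Num.sqrt t.
    move=> U2 gF /andP[tp tT]; have Ug := UCb2_UCb U2.
    have F_0 : 0 <= F := le_trans (normr_ge0 _) (gF 0).
    have sqt : 0 < Num.sqrt t by rewrite sqrtr_gt0.
    (* phi runs from the increment of P_t g at s = 0 to that of S_t g at s = t. *)
    pose phi s := P (t - s) (S s g) (y + h) - P (t - s) (S s g) y.
    pose Gs s x := (- frac_lap alpha (S s g) x) - sde_generator alpha beta b (S s g) x.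
    pose phi' s := P (t - s) (Gs s) (y + h) - P (t - s) (Gs s) y.
    have GsE s x : Gs s x = `|b x| `^ beta * frac_lap beta (S s g) x.
      rewrite /Gs /sde_generator.
      by move: (frac_lap alpha _ _) (_ * frac_lap beta _ _) => X W; ring.
    have UGs s : 0 <= s -> UCb (Gs s).
      move=> s0; have U2s := UCb2_sg HS s0 U2.
      exact: UCbB (UCbN (UCb_frac_lap_UCb2 HS U2s)) (ct_generator_UCb HP U2s).
    have Gb s x : 0 < s <= 1 -> `|Gs s x| <= cbar * (K * F / Num.sqrt s).
      move=> s01; have /andP[s0 s1] := s01.
      rewrite GsE normrM [X in X * _]ger0_norm ?powR_ge0//.
      apply: ler_pM; rewrite ?powR_ge0//.
      have Us := UCb_sg HS (ltW s0) Ug; have sF := sg_bound HS (ltW s0) Ug gF.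
      apply: (lapK _ _ _ Us sF s01) => z k; have := smooth S HS g F s z k U2 gF s0 => /le_trans; apply.
      rewrite powRN12_sqrt ?(ltW s0)//.
      have e0 : 0 <= C * F * (`|k| `^ (alpha / 2) / Num.sqrt s).
        by rewrite !mulr_ge0 ?powR_ge0 ?invr_ge0 ?sqrtr_ge0 ?(ltW C0).
      rewrite (_ : 2 * C * F / Num.sqrt s * _ = 2 * (C * F * (`|k| `^ (alpha / 2) / Num.sqrt s))).
        lra.
      by ring.
    (* [Q m] at time t - s is applied to [Gs s], whose sup norm is at most cbar K F / sqrt s; this
       bounds phi' by B / (sqrt s sqrt(t-s)). *)
    pose B := m * (cbar * (K * F)).
    have B0 : 0 <= B by rewrite !mulr_ge0 ?(ltW K0).
    have key : `|phi t - phi 0| <= 4 * B.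
      apply: (@difference_bound R phi phi' t B tp B0).
      - move=> s /andP[s0 st] e e0; have e2 : 0 < e / 2 by lra.
        have [r r0 hr] := duhamel_right HS HP U2 s0 st e2; exists r => // k kr sk.
        have h1 := hr k kr sk (y + h); have h2 := hr k kr sk y.
        have -> : phi (s + k) - phi s - k * phi' s =
          (P (t - (s + k)) (S (s + k) g) (y + h) - P (t - s) (S s g) (y + h) -
             k * P (t - s) (Gs s) (y + h)) -
          (P (t - (s + k)) (S (s + k) g) y - P (t - s) (S s g) y -
             k * P (t - s) (Gs s) y) by rewrite /phi /phi'; ring.
        rewrite (le_trans (ler_normB _ _))// (_ : e * k = e / 2 * k + e / 2 * k).
          exact: lerD.
        by field.
      - move=> s /andP[s0 st] e e0; have e2 : 0 < e / 2 by lra.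
        have [r r0 hr] := duhamel_left HS HP U2 s0 st e2; exists r => // k kr sk.
        have h1 := hr k kr sk (y + h); have h2 := hr k kr sk y.
        have -> : phi s - phi (s - k) - k * phi' s =
          (P (t - s) (S s g) (y + h) - P (t - (s - k)) (S (s - k) g) (y + h) -
             k * P (t - s) (Gs s) (y + h)) -
          (P (t - s) (S s g) y - P (t - (s - k)) (S (s - k) g) y -
             k * P (t - s) (Gs s) y) by rewrite /phi /phi'; ring.
        rewrite (le_trans (ler_normB _ _))// (_ : e * k = e / 2 * k + e / 2 * k).
          exact: lerD.
        by field.
      - move=> s /andP[s0 st].
        have s01 : 0 < s <= 1 by rewrite s0 (le_trans (ltW st))// (le_trans tT).
        have tsT : 0 < t - s <= T by apply/andP; split; lra.
        have := Qm (Gs s) _ (t - s) y (UGs s (ltW s0)) (fun x => Gb s x s01) tsT.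
        move=> /le_trans; apply; rewrite le_eqVlt; apply/orP; left; apply/eqP.
        rewrite /B; field; rewrite !gt_eqF ?sqrtr_gt0//.
        by case/andP: tsT.
    have p0 : phi 0 = P t g (y + h) - P t g y.
      have E : S 0 g = g by apply/funext => z; rewrite (sg_zero HS).
      by rewrite /phi subr0 E.
    have pt : phi t = S t g (y + h) - S t g y.
      have USt := UCb_sg HS (ltW tp) Ug.
      by rewrite /phi subrr (ct_zero HP USt).
    have sm := smooth S HS g F t y h U2 gF tp; rewrite -/Hh powRN12_sqrt ?(ltW tp)// in sm.
    rewrite -p0 -[phi 0](subKr (phi t)) (le_trans (ler_normB _ _))//.
    have -> : (C * Hh + m / 2) * F / Num.sqrt t = C * F * (Hh / Num.sqrt t) + m / 2 * F / Num.sqrt t.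
      by ring.
    apply: lerD; first by rewrite pt.
    (* The smallness of T enters here: 4 B sqrt t <= (m / 2) F. The 8 in the condition on T is this
       4 times 2. *)
    apply: (le_trans key); rewrite ler_pdivlMr//.
    have sqtT : Num.sqrt t <= Num.sqrt T by rewrite ler_sqrt ?(ltW T0).
    have W0 : 0 <= 8 * cbar * K by rewrite !mulr_ge0 ?(ltW K0).
    have e1 : Num.sqrt t * (8 * cbar * K) <= 1.
      by apply: le_trans HT; rewrite ler_wpM2r.
    have mF : 0 <= m / 2 * F by rewrite !mulr_ge0.
    have := ler_wpM2l mF e1; rewrite mulr1; apply: le_trans.
    by rewrite le_eqVlt; apply/orP; left; apply/eqP; rewrite /B; field.
  (* For g in [UCb] the inequality follows by mollification, which does not increase the bound F. *)
  move=> g F s y Ug gF sT; have /andP[s0 _] := sT.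
  apply/ler_addgt0Pr => e e0; have e2 : 0 < e / 2 by lra.
  have [g' U2 [g'g g'F _]] := mollify_close Ug e2; have Ug' := UCb2_UCb U2.
  have close z : `|P s g z - P s g' z| <= e / 2.
    rewrite -(ctB HP z (ltW s0) Ug Ug').
    by apply: (ct_bound HP (ltW s0) (UCbB Ug Ug')) => w; rewrite distrC.
  have := smoothcase g' F s y U2 (g'F F gF) sT => h1.
  have c1 := close (y + h); have c2 := close y.
  have -> : P s g (y + h) - P s g y = (P s g' (y + h) - P s g' y) +
    ((P s g (y + h) - P s g' (y + h)) - (P s g y - P s g' y)) by ring.
  rewrite (le_trans (ler_normD _ _))// lerD//.
  rewrite (le_trans (ler_normB _ _))//; lra.
have A0 : 0 <= 2 * (C * Hh) by rewrite !mulr_ge0// ltW.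
(* 2 C |h|^(alpha/2) is the fixed point of m -> C |h|^(alpha/2) + m / 2, whence the factor 2 in the
   Hölder constant. *)
have Qn n : Q (2 * (C * Hh) + 2 * 2^-1 ^+ n).
  elim: n => [|n IH].
    rewrite expr0 mulr1 => g F s y Ug gF sT.
    have F_0 : 0 <= F := le_trans (normr_ge0 _) (gF 0).
    apply: (le_trans (Q2 g F s y Ug gF sT)).
    by rewrite -!mulrA ler_wpM2r ?lerDr// mulr_ge0 ?invr_ge0 ?sqrtr_ge0.
  have m0 : 0 <= 2 * (C * Hh) + 2 * 2^-1 ^+ n by rewrite addr_ge0// mulr_ge0// exprn_ge0.
  by have := Qstep _ m0 IH; congr Q; rewrite exprS; field.
have F_0 : 0 <= F0 := le_trans (normr_ge0 _) (f0F 0).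
have sq0 : 0 < Num.sqrt t0 by rewrite sqrtr_gt0; case/andP: t0T.
apply/ler_addgt0Pr => e e0.
have [n hn] := exp2_gt (2 * F0 / Num.sqrt t0 / e).
have := Qn n.+1 f0 F0 t0 x0 Uf0 f0F t0T => /le_trans; apply.
rewrite mulrDl mulrDl; apply: lerD.
  by rewrite le_eqVlt; apply/orP; left; apply/eqP; ring.
rewrite exprVn (_ : 2 * _ * F0 / Num.sqrt t0 = 2 * F0 / Num.sqrt t0 / 2 ^+ n.+1); last by ring.
rewrite ler_pdivrMr ?exprn_gt0// [e * _]mulrC -ler_pdivrMr//; exact: ltW.
Qed.

End regularization.

(** * The semigroups of the processes *)

Section bounded_random_variables.
Context {R : realType} {disp : measure_display} {Omega : measurableType disp}.
Variable P : probability Omega R.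
Implicit Types X Y : Omega -> R.

Lemma bounded_integrable X (M : R) : measurable_fun setT X -> (forall w, `|X w| <= M) ->
  P.-integrable setT (EFin \o X).
Proof.
move=> mX XM; apply: measurable_bounded_integrable => //.
  by apply: le_lt_trans (ltry 1); exact: (probability_le1 P measurableT).
exists M; split; first exact: num_real.
by move=> N MN w _; rewrite /= (le_trans (XM w))// ltW.
Qed.

Lemma mean_cst (c : R) : \int[P]_w c = c.
Proof.
rewrite (Rintegral_cst P measurableT c) (_ : fine _ = 1) ?mulr1//.
transitivity (fine (1%E : \bar R)) => //; congr fine; exact: probability_setT.
Qed.

Lemma mean_le X (a b : R) : measurable_fun setT X -> (forall w, a <= X w <= b) ->
  \int[P]_w X w <= b.
Proof.
move=> mX Xb; rewrite -[leRHS]mean_cst; apply: le_Rintegral => //.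
- apply: (bounded_integrable (M := Num.max `|a| `|b|)) => // w.
  have /andP[h1 h2] := Xb w; have ha := ler_norm (- a); have hb := ler_norm b.
  rewrite normrN in ha; rewrite ler_norml lerNl !le_max.
  by apply/andP; split; apply/orP; [left|right]; lra.
- by apply: (bounded_integrable (M := `|b|)).
- by move=> w _; have /andP[] := Xb w.
Qed.

Lemma mean_bound X (M : R) : measurable_fun setT X -> (forall w, `|X w| <= M) ->
  `|\int[P]_w X w| <= M.
Proof.
move=> mX XM; apply: (le_trans (le_normr_Rintegral measurableT (bounded_integrable mX XM))).
apply: (@mean_le _ 0) => [|w]; first exact: measurableT_comp.
by rewrite normr_ge0 XM.
Qed.

Lemma mean_lin (a : R) X Y (M N : R) : measurable_fun setT X -> measurable_fun setT Y ->
  (forall w, `|X w| <= M) -> (forall w, `|Y w| <= N) ->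
  \int[P]_w (a * X w + Y w) = a * \int[P]_w X w + \int[P]_w Y w.
Proof.
move=> mX mY XM YN; have IX := bounded_integrable mX XM.
have IY := bounded_integrable mY YN.
rewrite -RintegralZl//; apply: RintegralD => //.
exact: (integrableZl measurableT a IX).
Qed.

End bounded_random_variables.

Section independence.
Context {R : realType} {disp : measure_display} {Omega : measurableType disp}.
Context {d1 : measure_display} {T1 : measurableType d1}.
Variable P : probability Omega R.

(** Independence makes the joint law agree with the product law on rectangles, hence everywhere, and
    Fubini's theorem applies. *)
Lemma mean_independent_pair (X Y : Omega -> T1) (g : T1 * T1 -> R) (M : R) :
  measurable_fun setT X -> measurable_fun setT Y ->
  (forall A B, measurable A -> measurable B ->
     P (X @^-1` A `&` Y @^-1` B) = (P (X @^-1` A) * P (Y @^-1` B))%E) ->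
  measurable_fun setT g -> (forall z, `|g z| <= M) ->
  \int[P]_w g (X w, Y w) = \int[P]_w \int[P]_w' g (X w, Y w').
Proof.
move=> mX mY indep mg gM.
pose X' : {mfun Omega >-> T1} := HB.pack X (isMeasurableFun.Build _ _ _ _ X mX).
pose Y' : {mfun Omega >-> T1} := HB.pack Y (isMeasurableFun.Build _ _ _ _ Y mY).
have mXY : measurable_fun setT (fun w => (X w, Y w)).
  by apply/measurable_fun_pairP; split.
pose XY' : {mfun Omega >-> (T1 * T1)%type} :=
  HB.pack (fun w => (X w, Y w)) (isMeasurableFun.Build _ _ _ _ (fun w => (X w, Y w)) mXY).
pose mu := distribution P X'; pose nu := distribution P Y'.
have joint A : measurable A -> (mu \x nu)%E A = distribution P XY' A.
  by apply: product_measure_unique => B C mB mC; rewrite -indep.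
have mge : measurable_fun setT (EFin \o g) by exact/measurable_EFinP.
have I0 : P.-integrable setT ((EFin \o g) \o (fun w => (X w, Y w))).
  by apply: (@bounded_integrable _ _ _ P (fun w => g (X w, Y w)) M) => //;
     exact: (measurableT_comp mg mXY).
have Iprod : (mu \x nu)%E.-integrable setT (EFin \o g).
  apply: measurable_bounded_integrable => //.
    by rewrite [X in (X < _)%E](joint _ measurableT) (le_lt_trans (probability_le1 _ _)) ?ltry.
  exists M; split; first exact: num_real.
  by move=> N MN w _; rewrite /= (le_trans (gM w))// ltW.
rewrite {1}/Rintegral.
have -> : (\int[P]_w (g (X w, Y w))%:E = \int[mu \x nu]_z (g z)%:E)%E.
  transitivity (\int[distribution P XY']_z (EFin \o g) z)%E.
    by rewrite /distribution (integral_pushforward (phi := fun w => (X w, Y w))).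
  by apply: eq_measure_integral => A mA _; exact/esym/joint.
rewrite -integral12_prod_meas1//.
have mga a : measurable_fun setT (fun b => g (a, b)).
  by apply: measurableT_comp => //; exact: measurable_pair1.
have inner a : fubini_F nu (EFin \o g) a = (\int[P]_w' g (a, Y w'))%:E.
  rewrite /fubini_F /nu /distribution /Rintegral fineK; last first.
    apply: integrable_fin_num => //.
    by apply: (@bounded_integrable _ _ _ P (fun w => g (a, Y w)) M) => //;
      exact: (measurableT_comp (mga a) mY).
  rewrite (integral_pushforward (phi := Y))//; first exact/measurable_EFinP.
  by apply: (@bounded_integrable _ _ _ P (fun w => g (a, Y w)) M) => //;
      exact: (measurableT_comp (mga a) mY).
under eq_integral do rewrite inner.
have mF : measurable_fun setT (fun a => \int[P]_w' g (a, Y w')).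
  apply/measurable_EFinP.
  rewrite (_ : EFin \o _ = fubini_F nu (EFin \o g)); first exact: (measurable_fubini_F Iprod).
  by apply/funext => a; rewrite inner.
rewrite /mu /distribution (integral_pushforward (phi := X))//; first exact/measurable_EFinP.
apply: (@bounded_integrable _ _ _ P (fun w => \int[P]_w' g (X w, Y w')) M).
  exact: (measurableT_comp mF mX).
move=> w; apply: mean_bound => //.
exact: (measurableT_comp (mga (X w)) mY).
Qed.

End independence.

Section stable_process_semigroup.
Context {R : realType} {disp : measure_display} {Omega : measurableType disp} {d : nat}.
Local Notation V := 'rV[R]_d.
Variables (P : probability Omega R) (alpha : R) (F : R -> set (set Omega))
  (Y Z : R -> Omega -> V).
Hypotheses (HF : filtration F) (HL : levy_process P F (fun t w => row_mx (Y t w) (Z t w)))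
  (HZ : symmetric_stable P alpha Z).

Definition process_semigroup (t : R) (f : V -> R) (x : V) : R := fine 'E_P[fun w => f (x + Z t w)%R]%E.

Lemma process_semigroupE t f x : process_semigroup t f x = \int[P]_w f (x + Z t w).
Proof. by rewrite /process_semigroup unlock. Qed.

Let measurable_rsub : measurable_fun setT (fun x : 'rV[R]_(d + d) => rsubmx x).
Proof.
apply: measurable_fun_rVP => i.
rewrite (_ : (fun x => _) = fun x : 'rV[R]_(d + d) => x ord0 (rshift d i)).
  exact: measurable_rV_coord.
by apply/funext => x; rewrite mxE.
Qed.

Let rsub_preimage (B : set V) : measurable B -> measurable (@rsubmx R 1 d d @^-1` B).
Proof. by move=> mB; rewrite -[_ @^-1` _]setTI; exact: measurable_rsub. Qed.

Lemma process_adapted t (B : set V) : 0 <= t -> measurable B -> F t (Z t @^-1` B).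
Proof.
move=> t0 mB; have := levy_adapted HL t0 (rsub_preimage mB).
by congr (F t _); apply/seteqP; split => w /=; rewrite row_mxKr.
Qed.

Lemma process_measurable t : 0 <= t -> measurable_fun setT (Z t).
Proof.
move=> t0 _ B mB; rewrite setTI; have [H _] := HF; have [_ sub] := H t t0.
exact/sub/process_adapted.
Qed.

Let mshift t f x : 0 <= t -> UCb f -> measurable_fun setT (fun w => f (x + Z t w)).
Proof.
move=> t0 Uf; under eq_fun do rewrite addrC.
apply: (measurableT_comp (UCb_measurable Uf)).
exact: measurableT_comp (measurable_shift x) (process_measurable t0).
Qed.

(** Z_(s+t) = Z_s + I, where I is independent of Z_s and distributed as Z_t; integrating I out gives
    the semigroup law. *)
Let process_add s t f x : 0 <= s -> 0 <= t -> UCb f ->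
  process_semigroup (s + t) f x = process_semigroup s (process_semigroup t f) x.
Proof.
move=> s0 t0 Uf; have [M M0 fM] := UCb_bound Uf.
have st0 : 0 <= s + t by exact: addr_ge0.
pose I w := Z (s + t) w - Z s w.
have mI : measurable_fun setT I.
  apply: measurable_fun_rVP => i.
  rewrite (_ : (fun w => _) = fun w => Z (s + t) w ord0 i - Z s w ord0 i).
    apply: measurable_funB.
      exact: measurableT_comp (measurable_rV_coord i) (process_measurable st0).
    exact: measurableT_comp (measurable_rV_coord i) (process_measurable s0).
  by apply/funext => w; rewrite !mxE.
(* The Lévy property concerns the pair (Y, Z), so events for Z are pulled back along the second
   block. *)
have IE (B : set V) : [set w | (@rsubmx R 1 d d @^-1` B)
    (row_mx (Y (s + t) w) (Z (s + t) w) - row_mx (Y s w) (Z s w))] = I @^-1` B.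
  apply/seteqP; split => w; rewrite /= /I.
    by rewrite opp_row_mx add_row_mx row_mxKr.
  by rewrite opp_row_mx add_row_mx row_mxKr.
have law B : measurable B -> P (I @^-1` B) = P (Z t @^-1` B).
  move=> mB; have := levy_stationary HL s0 (_ : s <= s + t) (rsub_preimage mB).
  rewrite lerDl => /(_ t0); rewrite (IE B) => ->; congr (P _).
  rewrite (_ : s + t - s = t); last by ring.
  by apply/seteqP; split => w /=; rewrite row_mxKr.
have indep A B : measurable A -> measurable B ->
    P (Z s @^-1` A `&` I @^-1` B) = (P (Z s @^-1` A) * P (I @^-1` B))%E.
  move=> mA mB; have := levy_indep HL s0 (_ : s <= s + t) (process_adapted s0 mA) (rsub_preimage mB).
  by rewrite lerDl => /(_ t0) /=; rewrite (IE B).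
have mpair : measurable_fun setT (fun z : V * V => z.1 + z.2).
  apply: measurable_fun_rVP => i.
  rewrite (_ : (fun w => _) = fun z : V * V => z.1 ord0 i + z.2 ord0 i).
    apply: measurable_funD.
      exact: measurableT_comp (measurable_rV_coord i) measurable_fst.
    exact: measurableT_comp (measurable_rV_coord i) measurable_snd.
  by apply/funext => w; rewrite !mxE.
have mg : measurable_fun setT (fun z : V * V => f (z.1 + z.2 + x)).
  apply: (measurableT_comp (UCb_measurable Uf)).
  exact: measurableT_comp (measurable_shift x) mpair.
have := mean_independent_pair (process_measurable s0) mI indep mg (fun z => fM _).
rewrite !process_semigroupE /= => E.
transitivity (\int[P]_w f (Z s w + I w + x)).
  by apply: eq_Rintegral => w _; rewrite /I subrKC addrC.
rewrite E; apply: eq_Rintegral => w _; rewrite process_semigroupE.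
pose I' : {mfun Omega >-> V} := HB.pack I (isMeasurableFun.Build _ _ _ _ I mI).
pose Z' : {mfun Omega >-> V} := HB.pack (Z t) (isMeasurableFun.Build _ _ _ _ (Z t) (process_measurable t0)).
pose h v := f (Z s w + v + x).
have mz : measurable_fun setT (fun v : V => Z s w + v).
  rewrite (_ : (fun v : V => _) = fun v => v + Z s w); first exact: measurable_shift.
  by apply/funext => v; rewrite addrC.
have mh : measurable_fun setT h.
  exact: (measurableT_comp (UCb_measurable Uf) (measurableT_comp (measurable_shift x) mz)).
have push (W : {mfun Omega >-> V}) : \int[P]_w' h (W w') = \int[distribution P W]_v h v.
  rewrite /Rintegral /distribution (integral_pushforward (phi := W))//; first exact/measurable_EFinP.
  apply: (@bounded_integrable _ _ _ P (fun w => h (W w)) M) => [|w']; last exact: fM.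
  exact: measurableT_comp.
transitivity (\int[P]_w' h (Z t w')); last first.
  by apply: eq_Rintegral => w' _; rewrite /h [x + Z s w]addrC addrAC.
have := push I'; have := push Z' => /= -> ->.
rewrite /Rintegral; congr fine; apply: eq_measure_integral => A mA _.
exact: law.
Qed.

Lemma process_stable_semigroup : stable_semigroup alpha process_semigroup.
Proof.
split.
- move=> t a f g x t0 Uf Ug; rewrite !process_semigroupE.
  have [M M0 fM] := UCb_bound Uf; have [N N0 gN] := UCb_bound Ug.
  by apply: (@mean_lin _ _ _ P a _ _ M N) => [||w|w]; [exact: mshift|exact: mshift|exact: fM|exact: gN].
- move=> t M f t0 Uf fM x; rewrite process_semigroupE.
  have [N N0 fN] := UCb_bound Uf.
  apply: (@mean_le _ _ _ P _ (- N)); first exact: mshift.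
  by move=> w; rewrite fM andbT; have := fN (x + Z t w); rewrite ler_norml => /andP[].
- move=> t f h x t0 Uf; rewrite !process_semigroupE.
  by apply: eq_Rintegral => w _; rewrite addrAC.
- move=> f x Uf; rewrite process_semigroupE -[RHS](mean_cst P).
  rewrite /Rintegral; congr fine; apply: ae_eq_integral => //.
  + by apply/measurable_EFinP; exact: mshift.
  + have := levy0 HL; apply: filterS => w /= /(congr1 rsubmx).
    by rewrite row_mxKr linear0 => -> _; rewrite addr0.
- exact: process_add.
- move=> f U2 e e0.
  have /supnorm_right0P /(_ e e0) [r r0 h] := stable_generator HZ U2.
  exists r => // t tr x; have t0 : 0 < t by case/andP: tr.
  have := h t tr x; rewrite -/(process_semigroup t f x).
  move: (frac_lap alpha f x) (process_semigroup t f x) => A B.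
  move=> H; rewrite -(ler_pM2l t0) -{1}(gtr0_norm t0) -normrM in H.
  apply: le_trans H; rewrite le_eqVlt; apply/orP; left; apply/eqP; congr (`| _ |).
  by field; rewrite gt_eqF.
Qed.

End stable_process_semigroup.

Section transition_semigroup.
Context {R : realType} {d : nat}.
Local Notation V := 'rV[R]_d.
Variables (alpha beta : R) (b : V -> R) (X : forall x : V, weak_solution alpha beta b x).

Lemma transition_bound (t M : R) (f : V -> R) : 0 <= t -> UCb f -> (forall x, `|f x| <= M) ->
  forall x, `|transition X t f x| <= M.
Proof.
move=> t0 Uf fM x; rewrite /transition unlock.
case: (X x) => ds Omega Pr F Y Z X' [HF _ _ _ _ adX _ _ _] /=.
apply: (@mean_bound _ _ _ Pr (fun w => f (X' t w))) => [|w]; last exact: fM.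
apply: (measurableT_comp (UCb_measurable Uf)) => _ B mB; rewrite setTI.
by have [H _] := HF; have [_ sub] := H t t0; apply/sub/adX.
Qed.

Lemma transition_contraction_semigroup : C0_semigroup (transition X) ->
  (forall f, UCb2 f -> generator (transition X) f (sde_generator alpha beta b f)) ->
  contraction_semigroup (sde_generator alpha beta b) (transition X).
Proof.
move=> HC HG; split.
- by move=> t f t0 Uf; exact: (C0_UCb HC).
- by move=> t a f g x t0 Uf Ug; rewrite (C0_linear HC).
- exact: transition_bound.
- by move=> f Uf; exact: (C0_zero HC).
- by move=> s t f s0 t0 Uf; exact: (C0_add HC).
- by move=> f Uf e e0; have /supnorm_right0P/(_ e e0) := C0_continuous HC Uf.
- by move=> f /HG[].
- move=> f /HG[_ _ /supnorm_right0P H] e /H[r r0 h]; exists r => // t tr x.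
  have t0 : 0 < t by case/andP: tr.
  have := h t tr x; move: (transition X t f x) (sde_generator alpha beta b f x) => A B {}h.
  rewrite -(ler_pM2l t0) -{1}(gtr0_norm t0) -normrM in h.
  apply: le_trans h; rewrite le_eqVlt; apply/orP; left; apply/eqP; congr (`| _ |).
  by field; rewrite gt_eqF.
Qed.

(** The comparison semigroup is that of the driving process Z of a single solution, whatever its
    starting point. *)
Lemma weak_solution_stable_semigroup (x : V) :
  exists S : R -> (V -> R) -> V -> R, stable_semigroup alpha S.
Proof.
case: (X x) => ds Omega Pr F Y Z X' [HF HL _ HZ _ _ _ _ _].
by exists (process_semigroup Pr Z); exact: process_stable_semigroup HF HL HZ.
Qed.

End transition_semigroup.

Lemma supnorm_fineK {R : realType} {d : nat} (f : 'rV[R]_d -> R) : UCb f ->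
  (fine (supnorm f))%:E = supnorm f /\ forall x, `|f x| <= fine (supnorm f).
Proof.
move=> /UCb_bound[M M0 fM].
have fin : (fine (supnorm f))%:E = supnorm f.
  apply: fineK; rewrite ge0_fin_numE ?supnorm_ge0//.
  by apply: le_lt_trans (ltry M); apply/supnorm_leP.
by split=> //; apply/supnorm_leP; rewrite fin.
Qed.

(** * Choice of the constants and conclusion *)

Theorem theorem5p1 (R : realType) (d : nat) (hd : (1 <= d)%N) :
  (* t0 alpha beta |b|_oo ; C1, C2 alpha beta t0 *)
  exists t0 C1 C2 : R -> R -> R -> R,
  forall alpha beta : R, 0 < alpha < 2 -> 0 < beta < 2 ->
    0 < beta < alpha / 2 ->
  forall b : 'rV[R]_d -> R, UCb2 b ->
  let T := t0 alpha beta (fine (supnorm b)) in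
  0 < T < 1 /\
  forall X : (forall x : 'rV[R]_d, weak_solution alpha beta b x),
  unique_in_law alpha beta b ->
  C0_semigroup (transition X) ->
  (forall f, UCb2 f ->
    generator (transition X) f (sde_generator alpha beta b f)) ->
  backward_kolmogorov (transition X) ->
  forall f, UCb f ->
    (forall t : R, 0 < t -> t <= T ->
      exists2 g, frac_lap_closure beta (transition X t f) g &
        (supnorm g <= (C1 alpha beta T * t `^ (- 2^-1))%:E * supnorm f)%E) /\
    (forall t : R, T < t ->
      exists2 g, frac_lap_closure beta (transition X t f) g &
        (supnorm g <= (C2 alpha beta T)%:E * supnorm f)%E).
Proof.
have /choice[CC HCC] : forall ab : R * R, exists C : R * R,
    0 < ab.1 < 2 -> 0 < ab.2 < ab.1 / 2 ->
  [/\ 0 < C.1, 0 < C.2,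
  forall (g : 'rV[R]_d -> R) (F s : R), UCb g -> (forall x, `|g x| <= F) -> 0 < s <= 1 ->
    holder (ab.1 / 2) (2 * C.1 * F / Num.sqrt s) g ->
    forall x, `|frac_lap ab.2 g x| <= C.2 * F / Num.sqrt s &
  forall (b : 'rV[R]_d -> R) (cbar T : R) (S P : R -> ('rV[R]_d -> R) -> 'rV[R]_d -> R),
    stable_semigroup ab.1 S -> contraction_semigroup (sde_generator ab.1 ab.2 b) P ->
    (forall x, `|b x| `^ ab.2 <= cbar) -> 0 < T <= 1 -> Num.sqrt T * (8 * cbar * C.2) <= 1 ->
    forall f (F t : R), UCb f -> (forall x, `|f x| <= F) -> 0 < t <= T ->
      holder (ab.1 / 2) (2 * C.1 * F / Num.sqrt t) (P t f)].
  move=> [alpha beta] /=.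
  (* Outside the admissible parameters the constants take the default value 0. *)
  have [h1|h1] := boolP (0 < alpha < 2); last by exists (0, 0).
  have [h2|h2] := boolP (0 < beta < alpha / 2); last by exists (0, 0).
  by have [C [C3 H]] := @holder_regularization R d hd alpha beta h1 h2; exists (C, C3).
(* With T = W^(-2), so that sqrt T = 1 / W, the first summand gives the absorption condition, and
   the second gives W >= 8, hence T < 1 even for b = 0. *)
pose W alpha beta (B : R) : R := 8 * (B `^ beta) * (CC (alpha, beta)).2 + 8.
exists (fun alpha beta B => (W alpha beta B)^-1 ^+ 2),
  (fun alpha beta _ => (CC (alpha, beta)).2),
  (fun alpha beta T => (CC (alpha, beta)).2 * T `^ (- 2^-1)).
move=> alpha beta a02 _ ba b U2b T.
have [C0 C30 lap hold] := HCC (alpha, beta) a02 ba.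
move: C0 C30 lap hold; set C := (CC _).1; set C3 := (CC _).2; rewrite /= => C0 C30 lap hold.
have [finb bB] := supnorm_fineK (UCb2_UCb U2b).
set cbar := fine (supnorm b) `^ beta.
have beta0 : 0 < beta by case/andP: ba.
have alpha0 : 0 < alpha by case/andP: a02.
have cbar0 : 0 <= cbar by exact: powR_ge0.
have Ws : 8 <= W alpha beta (fine (supnorm b)).
  by rewrite /W lerDr !mulr_ge0 ?(ltW C30).
have W0 : 0 < W alpha beta (fine (supnorm b)) by lra.
have Wi : 0 < (W alpha beta (fine (supnorm b)))^-1 by rewrite invr_gt0.
have Wi1 : (W alpha beta (fine (supnorm b)))^-1 < 1 by rewrite invf_lt1//; lra.
have T0 : 0 < T by rewrite exprn_gt0.
have T1 : T < 1 by rewrite exprn_ilt1// ltW.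
have sqT : Num.sqrt T = (W alpha beta (fine (supnorm b)))^-1.
  by rewrite /T sqrtr_sqr gtr0_norm.
have HT : Num.sqrt T * (8 * cbar * C3) <= 1.
  by rewrite sqT ler_pdivrMl// mulr1 /W lerDl.
split; first by rewrite T0.
move=> X _ HC HG _ f Uf.
have [S HS] := weak_solution_stable_semigroup X 0.
have HP := transition_contraction_semigroup HC HG.
have bc x : `|b x| `^ beta <= cbar.
  rewrite ge0_ler_powR ?nnegrE ?(ltW beta0)//.
  exact: le_trans (bB x).
have [finf fF] := supnorm_fineK Uf.
have theta1 : alpha / 2 <= 1 by case/andP: a02 => _ ?; rewrite ler_pdivrMr// mul1r ltW.
have beta_theta : beta < alpha / 2 by case/andP: ba.
(* Stated for any g bounded by the norm of f, so that it serves both g = f at times t <= T and g =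
   P_(t-T) f at time T. *)
have small (g : 'rV[R]_d -> R) t : UCb g -> (forall x, `|g x| <= fine (supnorm f)) ->
    0 < t <= T -> exists2 u, frac_lap_closure beta (transition X t g) u &
      (supnorm u <= (C3 * t `^ (- 2^-1))%:E * supnorm f)%E.
  move=> Ug gF tT; have /andP[t0 tT'] := tT.
  have t1 : 0 < t <= 1 by rewrite t0 (le_trans tT')// ltW.
  have sq0 : 0 < Num.sqrt t by rewrite sqrtr_gt0.
  have T01 : 0 < T <= 1 by rewrite T0 ltW.
  have H := hold b cbar T S _ HS HP bc T01 HT g _ t Ug gF tT.
  have UP := ct_UCb HP (ltW t0) Ug; have PF := ct_bound HP (ltW t0) Ug gF.
  have F0 : 0 <= fine (supnorm f) := le_trans (normr_ge0 _) (fF 0).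
  have H0 : 0 <= 2 * C * fine (supnorm f) / Num.sqrt t.
    by rewrite !mulr_ge0 ?invr_ge0 ?(ltW sq0) ?(ltW C0).
  exists (frac_lap beta (transition X t g)).
    exact: (frac_lap_closure_holder hd beta0 beta_theta theta1 UP H0 H).
  rewrite -finf -EFinM; apply/supnorm_leP => x.
  have := lap _ _ t UP PF t1 H x; rewrite powRN12_sqrt ?(ltW t0)// => /le_trans; apply.
  by rewrite mulrAC.
split=> t t0 => [tT|]; first by apply: small => //; rewrite t0.
have tT0 : 0 <= t - T by rewrite subr_ge0 ltW.
have UP := ct_UCb HP tT0 Uf; have PF := ct_bound HP tT0 Uf fF.
have -> : transition X t f = transition X T (transition X (t - T) f).
  by rewrite -(ct_add HP (ltW T0) tT0 Uf) subrKC.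
by apply: small => //; rewrite T0 lexx.
Qed.
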